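(* Let $R_1>R_2>0$. Let $\Sigma$ be a compact connected smoothly immersed surface of revolution in $\mathbb{R}^3$ with two boundary components, whose boundary components (circles) have radii $R_1$ and $R_2$. Let $A$ be an annulus in $\mathbb{R}^2$ with outer radius $R_1$ and inner radius $R_2$. If $\Sigma$ is not isometric to $A$, then for every $j=1,2,3,\ldots$, $$\lambda_j(\Sigma)<\lambda_j(A).$$
   Context: $\Sigma$ carries the Riemannian metric induced from $\mathbb{R}^3$ and $\Delta_\Sigma$ is its Laplace-Beltrami operator. $0<\lambda_1(\Sigma)<\lambda_2(\Sigma)\le\lambda_3(\Sigma)\le\cdots$ denote the Dirichlet eigenvalues of $-\Delta_\Sigma$, counted with multiplicity. $0<\lambda_1(A)<\lambda_2(A)\le\lambda_3(A)\le\cdots$ denote the Dirichlet eigenvalues of the negative of the Euclidean Laplacian on $A$ (the region between the two concentric circles), counted with multiplicity. *)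

(* Defs.v *)
(* Classical reals of the standard library, with Coquelicot. *)
From Stdlib Require Export Reals List.
From Coquelicot Require Export Coquelicot.
Open Scope R_scope.

Definition d1 (u : R -> R -> R) : R -> R -> R := fun x y => Derive (fun z => u z y) x.
Definition d2 (u : R -> R -> R) : R -> R -> R := fun x y => Derive (fun z => u x z) y.

Definition R3 : Type := (R * R * R)%type.

Definition mk3 (x y z : R) : R3 := (x, y, z).
Definition pr_x (v : R3) : R := fst (fst v).
Definition pr_y (v : R3) : R := snd (fst v).
Definition pr_z (v : R3) : R := snd v.

Definition dot (v w : R3) : R := pr_x v * pr_x w + pr_y v * pr_y w + pr_z v * pr_z w.
Definition add3 (v w : R3) : R3 := mk3 (pr_x v + pr_x w) (pr_y v + pr_y w) (pr_z v + pr_z w).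
Definition scal3 (k : R) (v : R3) : R3 := mk3 (k * pr_x v) (k * pr_y v) (k * pr_z v).

Definition lift3 (D : (R -> R -> R) -> R -> R -> R) (X : R -> R -> R3) (s t : R) : R3 :=
  mk3 (D (fun s t => pr_x (X s t)) s t)
      (D (fun s t => pr_y (X s t)) s t)
      (D (fun s t => pr_z (X s t)) s t).

Definition smooth1 (f : R -> R) : Prop := forall n x, ex_derive_n f n x.
Definition smooth2 (f : R -> R -> R) : Prop := forall n x y, ex_diff_n f n x y.

(* A parametrized surface is a map X : R -> R -> R3 of which only the values on
   [a, b] x R matter; it is 2 PI-periodic in the second variable, and Sigma is the
   immersed image of the cylinder [a, b] x (R / 2 PI Z).  Functions on Sigma are
   functions on [a, b] x R that are 2 PI-periodic in the second variable.
   "Smooth" on a set with boundary means: restriction of a smooth map. *)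

Definition immersed (a b : R) (X : R -> R -> R3) : Prop :=
  forall s t, a <= s <= b ->
  forall k l : R,
    add3 (scal3 k (lift3 d1 X s t)) (scal3 l (lift3 d2 X s t)) = mk3 0 0 0 ->
    k = 0 /\ l = 0.

Definition orthonormal_frame (e1 e2 e3 : R3) : Prop :=
  dot e1 e1 = 1 /\ dot e2 e2 = 1 /\ dot e3 e3 = 1 /\
  dot e1 e2 = 0 /\ dot e1 e3 = 0 /\ dot e2 e3 = 0.

(* The axis is the line p + R e3; the profile curve s |-> (F s, G s) lies in an open
   half-plane bounded by the axis, F being the distance to the axis.  (A connected
   surface of revolution with two boundary circles does not meet its axis.) *)
Definition surface_of_revolution (R1 R2 a b : R) (X : R -> R -> R3) : Prop :=
  exists (p e1 e2 e3 : R3) (F G : R -> R),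
    orthonormal_frame e1 e2 e3 /\
    smooth1 F /\ smooth1 G /\
    (forall s, a <= s <= b -> 0 < F s) /\
    F a = R1 /\ F b = R2 /\
    (forall s t, X s t =
       add3 p (add3 (scal3 (F s * cos t) e1)
              (add3 (scal3 (F s * sin t) e2) (scal3 (G s) e3)))) /\
    immersed a b X.

(* Induced metric g11 ds^2 + 2 g12 ds dt + g22 dt^2. *)
Definition g11 (X : R -> R -> R3) (s t : R) : R := dot (lift3 d1 X s t) (lift3 d1 X s t).
Definition g12 (X : R -> R -> R3) (s t : R) : R := dot (lift3 d1 X s t) (lift3 d2 X s t).
Definition g22 (X : R -> R -> R3) (s t : R) : R := dot (lift3 d2 X s t) (lift3 d2 X s t).

Definition area_density (X : R -> R -> R3) (s t : R) : R :=
  sqrt (g11 X s t * g22 X s t - (g12 X s t) ^ 2).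

(* (det g)^(-1/2) d_i ((det g)^(1/2) g^{ij} d_j u), with the inverse matrix written out. *)
Definition laplace_beltrami (X : R -> R -> R3) (u : R -> R -> R) (s t : R) : R :=
  / area_density X s t *
  (d1 (fun s t => (g22 X s t * d1 u s t - g12 X s t * d2 u s t) / area_density X s t) s t +
   d2 (fun s t => (g11 X s t * d2 u s t - g12 X s t * d1 u s t) / area_density X s t) s t).

Definition laplacian (u : R -> R -> R) (x y : R) : R := d1 (d1 u) x y + d2 (d2 u) x y.

Definition open_annulus (c1 c2 R1 R2 x y : R) : Prop := R2 < dist_euc c1 c2 x y < R1.
Definition closed_annulus (c1 c2 R1 R2 x y : R) : Prop := R2 <= dist_euc c1 c2 x y <= R1.

Definition periodic2 (a b : R) (u : R -> R -> R) : Prop :=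
  forall s t, a <= s <= b -> u s (t + 2 * PI) = u s t.

(* (P, Q) is a smooth bijection from [a, b] x (R / 2 PI Z) onto the closed annulus
   that pulls back dx^2 + dy^2 to the induced metric of X. *)
Definition isometric_to_annulus (a b : R) (X : R -> R -> R3) (c1 c2 R1 R2 : R) : Prop :=
  exists P Q : R -> R -> R,
    smooth2 P /\ smooth2 Q /\ periodic2 a b P /\ periodic2 a b Q /\
    (forall s t, a <= s <= b -> closed_annulus c1 c2 R1 R2 (P s t) (Q s t)) /\
    (forall x y, closed_annulus c1 c2 R1 R2 x y ->
       exists s t, a <= s <= b /\ P s t = x /\ Q s t = y) /\
    (forall s t s' t', a <= s <= b -> a <= s' <= b ->
       P s t = P s' t' -> Q s t = Q s' t' ->
       s = s' /\ exists k : Z, t' = t + 2 * PI * IZR k) /\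
    (forall s t, a <= s <= b ->
       d1 P s t * d1 P s t + d1 Q s t * d1 Q s t = g11 X s t /\
       d1 P s t * d2 P s t + d1 Q s t * d2 Q s t = g12 X s t /\
       d2 P s t * d2 P s t + d2 Q s t * d2 Q s t = g22 X s t).

(* u is continuous on the closed region K, C^2 on its interior U, zero on the
   boundary K \ U, and - L u = mu u on U.  The zero function is allowed, so that
   these functions form the eigenspace of mu. *)
Definition dirichlet_solution (U K : R -> R -> Prop)
    (L : (R -> R -> R) -> R -> R -> R) (mu : R) (u : R -> R -> R) : Prop :=
  continuous_on (fun p : R * R => K (fst p) (snd p)) (fun p : R * R => u (fst p) (snd p)) /\
  (forall x y, U x y -> ex_diff_n u 2 x y) /\
  (forall x y, K x y -> ~ U x y -> u x y = 0) /\
  (forall x y, U x y -> - L u x y = mu * u x y).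

(* Functions that agree on K are identified. *)
Definition has_dimension (K : R -> R -> Prop) (E : (R -> R -> R) -> Prop) (d : nat) : Prop :=
  exists e : nat -> R -> R -> R,
    (forall i, (1 <= i <= d)%nat -> E (e i)) /\
    (forall c : nat -> R,
       (forall x y, K x y -> sum_n_m (fun i => c i * e i x y) 1 d = 0) ->
       forall i, (1 <= i <= d)%nat -> c i = 0) /\
    (forall u, E u -> exists c : nat -> R,
       forall x y, K x y -> u x y = sum_n_m (fun i => c i * e i x y) 1 d).

(* lam 1 <= lam 2 <= ... lists the eigenvalues, each one repeated according to the
   dimension of its eigenspace (lam 0 is irrelevant).  Values mu that are not
   eigenvalues have a zero-dimensional E mu, hence do not occur in the list. *)
Definition lists_eigenvalues (K : R -> R -> Prop)
    (E : R -> (R -> R -> R) -> Prop) (lam : nat -> R) : Prop :=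
  (forall j, (1 <= j)%nat -> lam j <= lam (S j)) /\
  (forall mu, exists js : list nat,
     NoDup js /\
     (forall j, In j js <-> (1 <= j)%nat /\ lam j = mu) /\
     has_dimension K (E mu) (length js)).

Definition dirichlet_eigenvalues_surface (a b : R) (X : R -> R -> R3) (lam : nat -> R) : Prop :=
  lists_eigenvalues (fun s t => a <= s <= b)
    (fun mu u => periodic2 a b u /\
       dirichlet_solution (fun s t => a < s < b) (fun s t => a <= s <= b)
         (laplace_beltrami X) mu u)
    lam.

Definition dirichlet_eigenvalues_annulus (c1 c2 R1 R2 : R) (lam : nat -> R) : Prop :=
  lists_eigenvalues (closed_annulus c1 c2 R1 R2)
    (dirichlet_solution (open_annulus c1 c2 R1 R2) (closed_annulus c1 c2 R1 R2) laplacian)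
    lam.

(* Main.v *)
Require Import Defs.
From Stdlib Require Import Lra Lia Psatz Classical ClassicalEpsilon Permutation FunctionalExtensionality.

(** Only the metric [h ^ 2 ds ^ 2 + F ^ 2 dt ^ 2] of the surface matters, where
    [(F, G)] is the profile and [h] its speed.  In two dimensions the Dirichlet
    integral is conformally invariant, so the surface is compared with the
    annulus through the conformal length [tau s], the integral of [h / F] from [a]
    to [s].  For the annulus this is the logarithm [t] of [R1 / r], its total length is
    [T = ln (R1 / R2)] and its weight at [t] is [r ^ 2 = R1 ^ 2 exp (- 2 t)].
    Since [|F'| <= h], the function [ln F + tau] is nondecreasing.  Hence the weight
    [F ^ 2] of the surface is at least that of the annulus at the same conformal
    length, and the surface has conformal length at least [T].  Equality holds only if
    [F' = - h] everywhere, that is, for the flat annulus.  So the surface is a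
    strictly longer cylinder with at least the same weight on the common part, and
    both facts lower the eigenvalues ([log_radius_lower_bound],
    [conformal_length_gt]).

    The comparison itself is made frequency by frequency, which replaces the
    variational principle by Sturm theory.  For the wave number [k] the radial
    equation is [(phi' / w)' = w (k ^ 2 - nu rho) phi] with [w = h / F] and
    [rho = F ^ 2]; the polar angle [th] of [(phi, phi' / w)], started at 0, obeys the
    first-order equation [phase], and [nu] is an eigenvalue when [th] ends at
    a multiple of [PI].  The angle increases with the weight and with [nu], and it crosses
    multiples of [PI] only upwards.  Let [mu = lamA j].  If [nu <= mu] is an eigenvalue
    of the annulus with final angle [c], then at parameter [mu] the angle on the surface
    reaches [c] within the length [T] and exceeds it strictly at the end; lowering the
    parameter gives an eigenvalue [nu' < mu] of the surface with the same final angle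
    [c] ([mode_transfer]).  The angle [c] determines [nu], so this is injective.

    It remains to translate between the two-dimensional spectra and the modes.  On the
    annulus the Fourier coefficients of an eigenfunction solve the radial equation with
    zero boundary values, so each is a multiple of one function, and by completeness of
    the trigonometric system the multiplicity of [nu] is at most the number of modes
    for which [nu] is an eigenvalue ([annulus_multiplicity]).  On the surface each such
    mode gives an eigenfunction [phi s * trig p t], and these are independent, so the
    multiplicity is at least that number ([surface_multiplicity]).  Both
    inequalities point in the direction needed to turn the injection on modes into
    [lamS j < lamA j] ([counting_comparison]). *)

(** * Differential inequalities *)

(* Integrals are typed in a structure whose carrier is R; [ring] has to see R. *)
Ltac ring_R :=
  match goal with |- @eq _ ?x ?y => change (@eq R x y) end;
  repeat match goal with |- context [@RInt ?V ?f ?u ?v] =>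
    let r := fresh "r" in pose (r := @RInt V f u v : R);
    change (@RInt V f u v) with r; clearbody r end;
  ring.

Lemma mean_value_open (f df : R -> R) (a b : R) :
  a < b ->
  (forall x, a < x < b -> is_derive f x (df x)) ->
  (forall x, a <= x <= b -> continuous f x) ->
  exists c, a < c < b /\ f b - f a = df c * (b - a).
Proof.
  intros ab hd hc.
  assert (pr : forall c, a < c < b -> derivable_pt f c).
  { intros c hx. exists (df c). apply is_derive_Reals, hd, hx. }
  assert (prid : forall c, a < c < b -> derivable_pt id c).
  { intros c _. apply derivable_pt_id. }
  destruct (MVT f id a b pr prid ab) as [c [P hM]].
  - intros c hx. apply continuity_pt_filterlim, hc, hx.
  - intros c _. apply derivable_continuous_pt, derivable_pt_id.
  - exists c. split; [exact P|].
    assert (E1 : derive_pt f c (pr c P) = df c).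
    { apply derive_pt_eq_0, is_derive_Reals, hd, P. }
    assert (E2 : derive_pt id c (prid c P) = 1).
    { apply derive_pt_eq_0, derivable_pt_lim_id. }
    rewrite E1, E2 in hM. unfold id in hM. lra.
Qed.

Lemma nonneg_derive_le (f df : R -> R) (a b : R) :
  a <= b ->
  (forall x, a < x < b -> is_derive f x (df x) /\ 0 <= df x) ->
  (forall x, a <= x <= b -> continuous f x) ->
  f a <= f b.
Proof.
  intros ab hd hc. destruct (Req_dec a b) as [->|ne]; [lra|].
  destruct (mean_value_open f df a b) as [c [hx E]]; try assumption; [lra| |].
  - intros x hx. apply hd, hx.
  - destruct (hd c hx) as [_ hp].
    assert (0 <= df c * (b - a)) by (apply Rmult_le_pos; lra). lra.
Qed.

Lemma pos_derive_lt (f df : R -> R) (a b : R) :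
  a < b ->
  (forall x, a < x < b -> is_derive f x (df x) /\ 0 < df x) ->
  (forall x, a <= x <= b -> continuous f x) ->
  f a < f b.
Proof.
  intros ab hd hc.
  destruct (mean_value_open f df a b) as [c [hx E]]; try assumption.
  - intros x hx. apply hd, hx.
  - destruct (hd c hx) as [_ hp].
    assert (0 < df c * (b - a)) by (apply Rmult_lt_0_compat; lra). lra.
Qed.

Lemma zero_derive_const (f : R -> R) (a b s t : R) :
  (forall x, a < x < b -> is_derive f x 0) -> a < s < b -> a < t < b -> f s = f t.
Proof.
  intros hd hs ht.
  assert (G : forall u v, a < u -> u < v -> v < b -> f u = f v).
  { intros u v h1 h2 h3. destruct (mean_value_open f (fun _ => 0) u v) as [c [_ E]]; [exact h2| | |lra].
    - intros x hx. apply hd. lra.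
    - intros x hx. apply (ex_derive_continuous f). eexists. apply hd. lra. }
  destruct (Rtotal_order s t) as [h|[->|h]]; [|reflexivity|symmetry]; apply G; lra.
Qed.

Lemma is_derive_neg_part_sqr (x : R) :
  is_derive (fun y => Rmin y 0 ^ 2) x (2 * Rmin x 0).
Proof.
  apply is_derive_Reals. intros eps heps.
  exists (mkposreal eps heps). intros h hne hh. simpl in hh.
  assert (B : Rabs (Rmin (x + h) 0 ^ 2 - Rmin x 0 ^ 2 - 2 * Rmin x 0 * h) <= h ^ 2).
  { apply Rabs_le. unfold Rmin. destruct (Rle_dec (x + h) 0), (Rle_dec x 0); nra. }
  replace ((Rmin (x + h) 0 ^ 2 - Rmin x 0 ^ 2) / h - 2 * Rmin x 0)
    with ((Rmin (x + h) 0 ^ 2 - Rmin x 0 ^ 2 - 2 * Rmin x 0 * h) / h) by (field; exact hne).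
  unfold Rdiv. rewrite Rabs_mult, Rabs_inv.
  assert (hp : 0 < Rabs h) by (apply Rabs_pos_lt; exact hne).
  apply Rle_lt_trans with (h ^ 2 * / Rabs h).
  - apply Rmult_le_compat_r; [left; apply Rinv_0_lt_compat; exact hp|exact B].
  - rewrite <- pow2_abs. replace (Rabs h ^ 2 * / Rabs h) with (Rabs h) by (field; lra).
    exact hh.
Qed.

Lemma continuous_exp_lin (L x : R) : continuous (fun t => exp (L * t)) x.
Proof.
  apply (ex_derive_continuous (fun t => exp (L * t))). auto_derive. exact I.
Qed.

Lemma is_derive_exp_lin (L x : R) : is_derive (fun t => exp (L * t)) x (L * exp (L * x)).
Proof. auto_derive; [exact I|ring]. Qed.

Lemma is_derive_mult_R (f g : R -> R) (x df dg : R) :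
  is_derive f x df -> is_derive g x dg ->
  is_derive (fun t => f t * g t) x (df * g x + f x * dg).
Proof.
  intros hf hg. apply (is_derive_mult f g x df dg hf hg). exact Rmult_comm.
Qed.

Lemma continuous_mult_R (f g : R -> R) (x : R) :
  continuous f x -> continuous g x -> continuous (fun t => f t * g t) x.
Proof. intros hf hg. exact (continuous_mult f g x hf hg). Qed.

(** The square [m] of the negative part of [d] is differentiable, vanishes at [a]
    and satisfies [m' <= 2 L m], hence is 0. *)
Lemma gronwall_nonneg (d dd : R -> R) (L a b : R) :
  (forall x, a < x < b -> is_derive d x (dd x) /\ - L * Rabs (d x) <= dd x) ->
  (forall x, a <= x <= b -> continuous d x) ->
  0 <= d a -> forall t, a <= t <= b -> 0 <= d t.
Proof.
  intros hd hc ha t ht.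
  set (m := fun x => Rmin (d x) 0 ^ 2).
  assert (hm : - (m a * exp (- (2 * L) * a)) <= - (m t * exp (- (2 * L) * t))).
  { apply (nonneg_derive_le (fun x => - (m x * exp (- (2 * L) * x)))
       (fun x => - (dd x * (2 * Rmin (d x) 0) * exp (- (2 * L) * x)
                    + m x * (- (2 * L) * exp (- (2 * L) * x))))); [lra| |].
    - intros x hx. destruct (hd x) as [D hL]; [lra|]. split.
      + apply (is_derive_opp (fun x => m x * exp (- (2 * L) * x))).
        apply (is_derive_mult_R m (fun x => exp (- (2 * L) * x))); [|apply is_derive_exp_lin].
        apply (is_derive_comp (fun y => Rmin y 0 ^ 2) d); [apply is_derive_neg_part_sqr|exact D].
      + pose proof (exp_pos (- (2 * L) * x)) as hp.
        assert (dd x * (2 * Rmin (d x) 0) + m x * (- (2 * L)) <= 0).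
        { unfold m. destruct (Rle_dec (d x) 0) as [hs|hs].
          - rewrite Rmin_left by exact hs. rewrite Rabs_left1 in hL by exact hs.
            assert (d x * dd x <= d x * (L * d x)) by (apply Rmult_le_compat_neg_l; lra).
            nra.
          - rewrite Rmin_right by lra. lra. }
        change (opp (dd x * (2 * Rmin (d x) 0) * exp (- (2 * L) * x) +
                m x * (- (2 * L) * exp (- (2 * L) * x))))
        with (- (dd x * (2 * Rmin (d x) 0) * exp (- (2 * L) * x) +
                m x * (- (2 * L) * exp (- (2 * L) * x)))).
        nra.
    - intros x hx. apply (continuous_opp (fun x => m x * exp (- (2 * L) * x))).
      apply (continuous_mult_R m (fun x => exp (- (2 * L) * x))); [|apply continuous_exp_lin].
      apply (continuous_comp d (fun y => Rmin y 0 ^ 2)); [apply hc; lra|].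
      apply (ex_derive_continuous (fun y => Rmin y 0 ^ 2)). eexists; apply is_derive_neg_part_sqr. }
  assert (ma : m a = 0) by (unfold m; rewrite Rmin_right by lra; ring).
  rewrite ma in hm. pose proof (exp_pos (- (2 * L) * t)) as hp.
  assert (hm0 : 0 <= m t) by (unfold m; apply pow2_ge_0).
  assert (mt : m t = 0) by nra.
  unfold m in mt. destruct (Rle_dec 0 (d t)) as [|n]; [assumption|].
  rewrite Rmin_left in mt by lra. nra.
Qed.

(** Once [d >= 0] is known, the hypothesis reads [d' > - L d], so that
    [d exp (L t)] is strictly increasing. *)
Lemma gronwall_pos (d dd : R -> R) (L a b : R) :
  a < b ->
  (forall x, a < x < b -> is_derive d x (dd x) /\ - L * Rabs (d x) < dd x) ->
  (forall x, a <= x <= b -> continuous d x) ->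
  0 <= d a -> 0 < d b.
Proof.
  intros ab hd hc ha.
  assert (hn : forall t, a <= t <= b -> 0 <= d t).
  { apply (gronwall_nonneg d dd L); try assumption.
    intros x hx. destruct (hd x hx). split; [assumption|lra]. }
  assert (E : d a * exp (L * a) < d b * exp (L * b)).
  { apply (pos_derive_lt (fun x => d x * exp (L * x))
      (fun x => dd x * exp (L * x) + d x * (L * exp (L * x)))); [exact ab| |].
    - intros x hx. destruct (hd x hx) as [D hL]. split.
      + apply (is_derive_mult_R d (fun x => exp (L * x))); [exact D|apply is_derive_exp_lin].
      + rewrite Rabs_pos_eq in hL by (apply hn; lra).
        pose proof (exp_pos (L * x)). nra.
    - intros x hx. apply (continuous_mult_R d (fun x => exp (L * x))); [apply hc; lra|apply continuous_exp_lin]. }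
  pose proof (exp_pos (L * a)). pose proof (exp_pos (L * b)). nra.
Qed.

Lemma sin2_lipschitz (x y : R) : Rabs (sin x ^ 2 - sin y ^ 2) <= Rabs (x - y).
Proof.
  assert (G : forall u v, u <= v -> Rabs (sin v ^ 2 - sin u ^ 2) <= v - u).
  { intros u v huv.
    destruct (MVT_gen (fun z => sin z ^ 2) u v (fun z => 2 * sin z * cos z)) as [c [_ E]].
    - intros z _. auto_derive; [exact I|ring].
    - intros z _. apply continuity_pt_filterlim.
      apply (ex_derive_continuous (fun z => sin z ^ 2)). auto_derive. exact I.
    - rewrite E. rewrite Rabs_mult, (Rabs_pos_eq (v - u)) by lra.
      rewrite <- (Rmult_1_l (v - u)) at 2. apply Rmult_le_compat_r; [lra|].
      apply Rabs_le. pose proof (sin2_cos2 c) as H. unfold Rsqr in H.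
      pose proof (Rle_0_sqr (sin c + cos c)). pose proof (Rle_0_sqr (sin c - cos c)).
      unfold Rsqr in *. nra. }
  destruct (Rle_dec x y) as [h|h].
  - rewrite Rabs_minus_sym, (Rabs_minus_sym x y), (Rabs_pos_eq (y - x)) by lra. now apply G.
  - rewrite (Rabs_pos_eq (x - y)) by lra. apply G. lra.
Qed.

(** * Global solutions of Lipschitz equations *)

Lemma lipschitz_continuous (f : R -> R) (M x : R) :
  (forall y z, Rabs (f y - f z) <= M * Rabs (y - z)) -> continuous f x.
Proof.
  intros h. apply filterlim_locally. intros eps.
  assert (hM : 0 <= M).
  { specialize (h 1 0). pose proof (Rabs_pos (f 1 - f 0)).
    rewrite (Rabs_pos_eq (1 - 0)) in h by lra. lra. }
  assert (hd : 0 < eps / (M + 1)) by (apply Rdiv_lt_0_compat; [apply cond_pos|lra]).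
  exists (mkposreal _ hd). intros y hy.
  change (Rabs (y - x) < eps / (M + 1)) in hy.
  change (Rabs (f y - f x) < eps).
  apply Rle_lt_trans with (M * Rabs (y - x)); [apply h|].
  apply Rle_lt_trans with (M * (eps / (M + 1))); [apply Rmult_le_compat_l; lra|].
  apply Rlt_le_trans with ((M + 1) * (eps / (M + 1))); [nra|]. right. field. lra.
Qed.

Lemma ln_ratio_pos (x y : R) : 0 < y < x -> 0 < ln (x / y).
Proof.
  intros h. rewrite <- ln_1. apply ln_increasing; [lra|].
  apply (Rmult_lt_reg_r y); [lra|]. field_simplify; lra.
Qed.

Lemma RInt_const_R (c a b : R) : RInt (fun _ => c) a b = (b - a) * c.
Proof. exact (RInt_const a b c). Qed.

Lemma locally_open_interval (a b s : R) : a < s < b -> locally s (fun z => a < z < b).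
Proof.
  intros h. apply (filter_and (fun s => a < s) (fun s => s < b)); [apply open_gt|apply open_lt]; lra.
Qed.

Lemma ex_RInt_continuous_all (f : R -> R) (a b : R) :
  (forall x, continuous f x) -> ex_RInt f a b.
Proof. intros h. apply (ex_RInt_continuous f). intros z _. apply h. Qed.

Lemma abs_RInt_le_RInt (f g : R -> R) (a b : R) :
  a <= b ->
  (forall x, continuous f x) -> (forall x, continuous g x) ->
  (forall x, a <= x <= b -> Rabs (f x) <= g x) ->
  Rabs (RInt f a b) <= RInt g a b.
Proof.
  intros ab hf hg h.
  exact (norm_RInt_le f g a b _ _ ab h
    (RInt_correct f a b (ex_RInt_continuous_all f a b hf))
    (RInt_correct g a b (ex_RInt_continuous_all g a b hg))).
Qed.

Lemma RInt_minus_all (f g : R -> R) (a b : R) :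
  (forall x, continuous f x) -> (forall x, continuous g x) ->
  RInt (fun x => f x - g x) a b = RInt f a b - RInt g a b.
Proof.
  intros hf hg.
  exact (RInt_minus f g a b (ex_RInt_continuous_all f a b hf) (ex_RInt_continuous_all g a b hg)).
Qed.

Lemma is_derive_RInt_all (f : R -> R) (a x : R) :
  (forall x, continuous f x) -> is_derive (fun t => RInt f a t) x (f x).
Proof.
  intros hf. apply (is_derive_RInt f (fun t => RInt f a t) a x).
  - exists (mkposreal 1 Rlt_0_1). intros y _.
    apply (RInt_correct f a y), ex_RInt_continuous_all, hf.
  - apply hf.
Qed.

Lemma exp_ge_1 (x : R) : 0 <= x -> 1 <= exp x.
Proof.
  intros [h|<-].
  - rewrite <- exp_0. left. now apply exp_increasing.
  - rewrite exp_0. lra.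
Qed.

Fixpoint picard (F : R -> R -> R) (a : R) (n : nat) (t : R) : R :=
  match n with
  | O => 0
  | S n => RInt (fun s => F s (picard F a n s)) a (Rmax a t)
  end.

(** Picard iteration.  Measuring the increments with the weight
    [exp (2 L (t - a))] makes every step contract by the factor 1/2 on the whole
    half-line at once.  The integrals stop at [Rmax a t], so that the solution
    is constant to the left of [a] and continuous at [a]. *)
Lemma ode_solution (F : R -> R -> R) (a L M : R) :
  0 < L ->
  (forall g : R -> R, (forall s, continuous g s) -> forall s, continuous (fun s => F s (g s)) s) ->
  (forall s x, Rabs (F s x) <= M) ->
  (forall s x y, Rabs (F s x - F s y) <= L * Rabs (x - y)) ->
  exists th : R -> R, (forall t, continuous th t) /\ th a = 0 /\
    forall t, a < t -> is_derive th t (F t (th t)).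
Proof.
  intros hL hF hM hlip.
  assert (hM0 : 0 <= M) by (pose proof (Rabs_pos (F 0 0)); pose proof (hM 0 0); lra).
  assert (Ilip : forall g, (forall s, continuous g s) -> forall y z,
    Rabs (RInt (fun s => F s (g s)) a (Rmax a y) - RInt (fun s => F s (g s)) a (Rmax a z))
      <= M * Rabs (y - z)).
  { intros g hg.
    assert (G : forall y z, y <= z -> Rabs (RInt (fun s => F s (g s)) a (Rmax a z)
       - RInt (fun s => F s (g s)) a (Rmax a y)) <= M * (z - y)).
    { intros y z hyz.
      assert (ex : forall u v, ex_RInt (fun s => F s (g s)) u v)
        by (intros u v; apply ex_RInt_continuous_all, hF, hg).
      pose proof (RInt_Chasles (fun s => F s (g s)) a (Rmax a y) (Rmax a z) (ex _ _) (ex _ _)) as C.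
      change (RInt (fun s => F s (g s)) a (Rmax a y) + RInt (fun s => F s (g s)) (Rmax a y) (Rmax a z)
              = RInt (fun s => F s (g s)) a (Rmax a z)) in C.
      rewrite <- C. replace (_ + _ - _) with (RInt (fun s => F s (g s)) (Rmax a y) (Rmax a z)) by ring_R.
      assert (hmax : Rmax a y <= Rmax a z <= Rmax a y + (z - y)).
      { unfold Rmax. destruct (Rle_dec a y), (Rle_dec a z); lra. }
      eapply Rle_trans; [apply (abs_RInt_le_const (fun s => F s (g s)) _ _ M)|].
      - lra.
      - apply ex.
      - intros t _. apply hM.
      - rewrite Rmult_comm. apply Rmult_le_compat_l; lra. }
    intros y z. destruct (Rle_dec y z).
    - rewrite Rabs_minus_sym, (Rabs_minus_sym y z), (Rabs_pos_eq (z - y)) by lra. now apply G.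
    - rewrite (Rabs_pos_eq (y - z)) by lra. apply G. lra. }
  set (p := picard F a).
  assert (pc : forall n t, continuous (p n) t).
  { induction n as [|n IH]; intros t.
    - apply continuous_const.
    - apply (lipschitz_continuous (p (S n)) M). apply (Ilip (p n) IH). }
  assert (plip : forall n y z, Rabs (p n y - p n z) <= M * Rabs (y - z)).
  { intros [|n] y z.
    - change (Rabs (0 - 0) <= M * Rabs (y - z)). rewrite Rminus_diag, Rabs_R0. apply Rmult_le_pos; [exact hM0|apply Rabs_pos].
    - apply (Ilip (p n) (pc n)). }
  set (K := M / (2 * L)).
  assert (hK : 0 <= K) by (apply Rmult_le_pos; [exact hM0|left; apply Rinv_0_lt_compat; lra]).
  set (E := fun t => exp (2 * L * (t - a))).
  assert (Eder : forall t, is_derive E t (2 * L * E t)) by (intros t; unfold E; auto_derive; [exact I|unfold Rminus; ring]).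
  assert (Ec : forall t, continuous E t)
    by (intros t; apply (ex_derive_continuous E); eexists; apply Eder).
  assert (Eint : forall c t, RInt (fun s => 2 * L * c * E s) a t = c * E t - c).
  { intros c t. apply is_RInt_unique.
    replace (c * E t - c) with (minus (c * E t) (c * E a)).
    2:{ unfold E at 2. replace (2 * L * (a - a)) with 0 by ring. rewrite exp_0.
        unfold minus, plus, opp; simpl; ring. }
    apply (is_RInt_derive (fun s => c * E s) (fun s => 2 * L * c * E s)).
    - intros x _. replace (2 * L * c * E x) with (c * (2 * L * E x)) by ring.
      apply (is_derive_scal E x c). apply Eder.
    - intros x _. apply (continuous_scal_r (2 * L * c) E). apply Ec. }
  assert (contract : forall g1 g2 c, (forall s, continuous g1 s) -> (forall s, continuous g2 s) ->
    0 <= c -> (forall s, a <= s -> Rabs (g1 s - g2 s) <= c * E s) ->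
    forall t, a <= t ->
    Rabs (RInt (fun s => F s (g1 s)) a t - RInt (fun s => F s (g2 s)) a t) <= c / 2 * E t).
  { intros g1 g2 c h1 h2 c0 h t hat.
    rewrite <- (RInt_minus_all (fun s => F s (g1 s)) (fun s => F s (g2 s))) by (now apply hF).
    eapply Rle_trans.
    - apply (abs_RInt_le_RInt _ (fun s => 2 * L * (c / 2) * E s) a t hat).
      + intros x. apply (continuous_minus (fun s => F s (g1 s)) (fun s => F s (g2 s))); now apply hF.
      + intros x. apply (continuous_scal_r (2 * L * (c / 2)) E). apply Ec.
      + intros x hx. eapply Rle_trans; [apply hlip|].
        replace (2 * L * (c / 2) * E x) with (L * (c * E x)) by field.
        apply Rmult_le_compat_l; [lra|]. apply h. lra.
    - rewrite Eint. lra. }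
  assert (step : forall n t, a <= t -> Rabs (p (S n) t - p n t) <= K * (/ 2) ^ n * E t).
  { induction n as [|n IH]; intros t hat.
    - change (p 1%nat t) with (RInt (fun s => F s 0) a (Rmax a t)).
      change (p 0%nat t) with 0. simpl pow.
      rewrite Rminus_0_r, Rmax_right by exact hat.
      eapply Rle_trans.
      + apply (abs_RInt_le_RInt _ (fun s => 2 * L * K * E s) a t hat).
        * apply hF. intros s. apply continuous_const.
        * intros x. apply (continuous_scal_r (2 * L * K) E). apply Ec.
        * intros x hx. eapply Rle_trans; [apply hM|].
          replace (2 * L * K * E x) with (M * E x) by (unfold K; field; lra).
          assert (1 <= E x).
          { apply exp_ge_1. apply Rmult_le_pos; lra. }
          nra.
      + rewrite Eint. lra.
    - change (p (S (S n)) t) with (RInt (fun s => F s (p (S n) s)) a (Rmax a t)).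
      change (p (S n) t) with (RInt (fun s => F s (p n s)) a (Rmax a t)).
      rewrite Rmax_right by exact hat.
      replace (K * (/ 2) ^ S n * E t) with (K * (/ 2) ^ n / 2 * E t) by (simpl; field).
      apply contract; try assumption; try apply pc.
      apply Rmult_le_pos; [exact hK|]. apply pow_le. lra. }
  assert (tail : forall n m t, a <= t ->
    Rabs (p (n + m)%nat t - p n t) <= 2 * K * ((/ 2) ^ n - (/ 2) ^ (n + m)) * E t).
  { intros n m t hat. induction m as [|m IH].
    - rewrite Nat.add_0_r, !Rminus_diag, Rabs_R0. lra.
    - rewrite Nat.add_succ_r.
      replace (p (S (n + m)) t - p n t)
        with ((p (S (n + m)) t - p (n + m)%nat t) + (p (n + m)%nat t - p n t)) by ring.
      eapply Rle_trans; [apply Rabs_triang|].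
      pose proof (step (n + m)%nat t hat). simpl pow. nra. }
  assert (tail' : forall n m t, a <= t -> (n <= m)%nat ->
    Rabs (p m t - p n t) <= 2 * K * (/ 2) ^ n * E t).
  { intros n m t hat hnm. replace m with (n + (m - n))%nat by lia.
    eapply Rle_trans; [apply tail, hat|].
    apply Rmult_le_compat_r; [left; apply exp_pos|]. apply Rmult_le_compat_l; [lra|].
    assert (0 <= (/ 2) ^ (n + (m - n))) by (apply pow_le; lra). lra. }
  assert (small : forall t, is_lim_seq (fun n => (2 * K * E t) * (/ 2) ^ n) 0).
  { intros t. replace (Finite 0) with (Rbar_mult (2 * K * E t) 0) by (simpl; f_equal; ring).
    apply is_lim_seq_scal_l, is_lim_seq_geom. rewrite Rabs_pos_eq; lra. }
  assert (cv : forall t, a <= t -> ex_finite_lim_seq (fun n => p n t)).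
  { intros t hat. apply ex_lim_seq_cauchy_corr. intros eps.
    pose proof (small t) as hl. apply is_lim_seq_spec in hl. destruct (hl (pos_div_2 eps)) as [N hN]. simpl in hN.
    exists N. intros n m hn hm.
    replace (p n t - p m t) with ((p n t - p N t) - (p m t - p N t)) by ring.
    eapply Rle_lt_trans; [apply Rabs_triang|]. rewrite Rabs_Ropp.
    specialize (hN N (Nat.le_refl N)). rewrite Rminus_0_r, Rabs_pos_eq in hN.
    2:{ apply Rmult_le_pos; [|apply pow_le; lra].
        apply Rmult_le_pos; [lra|left; apply exp_pos]. }
    pose proof (tail' N n t hat hn). pose proof (tail' N m t hat hm). lra. }
  set (th := fun t => real (Lim_seq (fun n => p n (Rmax a t)))).
  assert (thl : forall t, is_lim_seq (fun n => p n (Rmax a t)) (th t)).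
  { intros t. apply Lim_seq_correct'. apply cv, Rmax_l. }
  assert (le_lim : forall (u : nat -> R) (l c B : R), is_lim_seq u l ->
    (exists N, forall n, (N <= n)%nat -> Rabs (u n - c) <= B) -> Rabs (l - c) <= B).
  { intros u l c B hu hB.
    assert (H : is_lim_seq (fun n => Rabs (u n - c)) (Rabs (l - c))).
    { apply (is_lim_seq_abs (fun n => u n - c) (l - c)).
      apply (is_lim_seq_minus' u (fun _ => c) l c); [exact hu|apply is_lim_seq_const]. }
    apply (is_lim_seq_le_loc (fun n => Rabs (u n - c)) (fun _ => B) (Rabs (l - c)) B);
      [exact hB|exact H|apply is_lim_seq_const]. }
  assert (thlip : forall y z, Rabs (th y - th z) <= M * Rabs (y - z)).
  { intros y z.
    assert (H : is_lim_seq (fun n => p n (Rmax a y) - p n (Rmax a z)) (th y - th z)).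
    { apply is_lim_seq_minus'; apply thl. }
    rewrite <- (Rminus_0_r (th y - th z)). apply (le_lim _ _ _ _ H). exists O. intros n _.
    rewrite Rminus_0_r. eapply Rle_trans; [apply plip|].
    apply Rmult_le_compat_l; [exact hM0|].
    unfold Rmax. destruct (Rle_dec a y), (Rle_dec a z); unfold Rabs;
      repeat destruct Rcase_abs; lra. }
  assert (thc : forall t, continuous th t) by (intros t; now apply (lipschitz_continuous th M)).
  assert (thn : forall n t, a <= t -> Rabs (p n t - th t) <= 2 * K * (/ 2) ^ n * E t).
  { intros n t hat. rewrite Rabs_minus_sym. apply (le_lim (fun m => p m t)).
    - pose proof (thl t) as H. now rewrite Rmax_right in H.
    - exists n. intros m hm. now apply tail'. }
  assert (eqn : forall t, a <= t -> th t = RInt (fun s => F s (th s)) a t).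
  { intros t hat.
    assert (H : Rabs (th t - RInt (fun s => F s (th s)) a t) <= 0).
    { refine (is_lim_seq_le (fun _ => _) _ _ (Finite 0) _ (is_lim_seq_const _) (small t)).
      intros n.
      replace (th t - RInt (fun s => F s (th s)) a t) with
        ((p (S n) t - RInt (fun s => F s (th s)) a t) - (p (S n) t - th t)) by ring.
      eapply Rle_trans; [apply Rabs_triang|]. rewrite Rabs_Ropp.
      pose proof (thn (S n) t hat) as B1.
      assert (B2 : Rabs (p (S n) t - RInt (fun s => F s (th s)) a t)
                   <= 2 * K * (/ 2) ^ n / 2 * E t).
      { change (p (S n) t) with (RInt (fun s => F s (p n s)) a (Rmax a t)).
        rewrite Rmax_right by exact hat.
        apply contract; try assumption; [apply pc| |].
        - apply Rmult_le_pos; [lra|]. apply pow_le. lra.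
        - intros s hs. now apply thn. }
      simpl pow in B1. lra. }
    pose proof (Rabs_pos (th t - RInt (fun s => F s (th s)) a t)) as H0.
    assert (H1 : Rabs (th t - RInt (fun s => F s (th s)) a t) = 0) by lra.
    apply Rabs_eq_0 in H1. lra. }
  exists th. split; [exact thc|]. split.
  - rewrite (eqn a) by lra. exact (RInt_point a (fun s => F s (th s))).
  - intros t ht.
    apply (is_derive_ext_loc (fun t => RInt (fun s => F s (th s)) a t)).
    + apply (filter_imp (fun s => a < s)); [intros s hs; symmetry; apply eqn; lra|].
      apply (open_gt a t ht).
    + apply (is_derive_RInt_all (fun s => F s (th s))). apply hF, thc.
Qed.

(** * The phase equation *)

Lemma gronwall_growth (d dd : R -> R) (L a b s : R) :
  (forall x, a < x < b -> is_derive d x (dd x) /\ - L * Rabs (d x) <= dd x) ->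
  (forall x, a <= x <= b -> continuous d x) ->
  0 <= d a -> a <= s <= b -> 0 < d s -> 0 < d b.
Proof.
  intros hd hc ha hs hp.
  assert (hn := gronwall_nonneg d dd L a b hd hc ha).
  assert (E : d s * exp (L * s) <= d b * exp (L * b)).
  { apply (nonneg_derive_le (fun x => d x * exp (L * x))
      (fun x => dd x * exp (L * x) + d x * (L * exp (L * x)))); [lra| |].
    - intros x hx. destruct (hd x) as [D hL]; [lra|]. split.
      + apply (is_derive_mult_R d (fun x => exp (L * x))); [exact D|apply is_derive_exp_lin].
      + rewrite Rabs_pos_eq in hL by (apply hn; lra).
        pose proof (exp_pos (L * x)). nra.
    - intros x hx. apply (continuous_mult_R d (fun x => exp (L * x))); [apply hc; lra|apply continuous_exp_lin]. }
  pose proof (exp_pos (L * s)). pose proof (exp_pos (L * b)). nra.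
Qed.

(** With [phi = r sin th] and [phi' / w = r cos th], this is the equation of the
    angle [th] of a solution of [(phi' / w)' = - w q phi] with [phi a = 0]. *)
Definition phase (a b : R) (w q th : R -> R) : Prop :=
  (forall t, continuous th t) /\ th a = 0 /\
  forall t, a < t < b -> is_derive th t (w t * (cos (th t) ^ 2 + q t * sin (th t) ^ 2)).

Lemma phase_rhs (w q x : R) :
  w * (cos x ^ 2 + q * sin x ^ 2) = w + w * (q - 1) * sin x ^ 2.
Proof.
  pose proof (sin2_cos2 x) as H. unfold Rsqr in H.
  replace (cos x ^ 2) with (1 - sin x ^ 2) by lra. ring.
Qed.

Lemma sin2_term_bound (c L x y : R) :
  Rabs c <= L -> - (L * Rabs (x - y)) <= c * (sin x ^ 2 - sin y ^ 2) <= L * Rabs (x - y).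
Proof.
  intros h. apply Rabs_le_between. rewrite Rabs_mult.
  apply Rmult_le_compat; try apply Rabs_pos; [exact h|apply sin2_lipschitz].
Qed.

Lemma phase_exists (a : R) (w q : R -> R) (M : R) :
  (forall t, continuous w t) -> (forall t, continuous q t) ->
  (forall t, Rabs (w t) <= M) -> (forall t, Rabs (q t) <= M) ->
  exists th, forall b, phase a b w q th.
Proof.
  intros hw hq bw bq.
  assert (hM : 0 <= M) by (pose proof (Rabs_pos (w 0)); pose proof (bw 0); lra).
  assert (bwq : forall t, Rabs (w t * (q t - 1)) <= M * (M + 1)).
  { intros t. rewrite Rabs_mult. apply Rmult_le_compat; try apply Rabs_pos; [apply bw|].
    eapply Rle_trans; [apply Rabs_triang|]. rewrite Rabs_Ropp, Rabs_R1. specialize (bq t). lra. }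
  assert (sin2 : forall x, 0 <= sin x ^ 2 <= 1).
  { intros x. pose proof (sin2_cos2 x) as H. unfold Rsqr in H.
    pose proof (pow2_ge_0 (sin x)). pose proof (pow2_ge_0 (cos x)). nra. }
  destruct (ode_solution (fun t x => w t * (cos x ^ 2 + q t * sin x ^ 2)) a
    (M * (M + 1) + 1) (M + M * (M + 1))) as [th [c [e d]]].
  - nra.
  - intros g hg s.
    apply continuous_ext with (fun t => w t * (cos (g t) * cos (g t) + q t * (sin (g t) * sin (g t)))).
    { intros t. ring_R. }
    assert (hs := continuous_sin_comp g s (hg s)). assert (hk := continuous_cos_comp g s (hg s)).
    apply (continuous_mult_R w); [apply hw|].
    apply (continuous_plus (fun t => cos (g t) * cos (g t)) (fun t => q t * (sin (g t) * sin (g t)))).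
    + now apply (continuous_mult_R (fun t => cos (g t)) (fun t => cos (g t))).
    + apply (continuous_mult_R q); [apply hq|].
      now apply (continuous_mult_R (fun t => sin (g t)) (fun t => sin (g t))).
  - intros s x. rewrite phase_rhs. eapply Rle_trans; [apply Rabs_triang|].
    apply Rplus_le_compat; [apply bw|].
    rewrite Rabs_mult, (Rabs_pos_eq (sin x ^ 2)) by apply sin2.
    specialize (bwq s). specialize (sin2 x). pose proof (Rabs_pos (w s * (q s - 1))). nra.
  - intros s x y. rewrite !phase_rhs.
    replace (w s + w s * (q s - 1) * sin x ^ 2 - (w s + w s * (q s - 1) * sin y ^ 2))
      with (w s * (q s - 1) * (sin x ^ 2 - sin y ^ 2)) by ring.
    rewrite Rabs_mult. apply Rmult_le_compat; try apply Rabs_pos.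
    + specialize (bwq s). lra.
    + apply sin2_lipschitz.
  - exists th. intros b. split; [exact c|]. split; [exact e|].
    intros t ht. apply d. lra.
Qed.

(** Since [sin ^ 2] is 1-Lipschitz, the difference of the two angles satisfies the
    hypothesis of [gronwall_nonneg]. *)
Lemma phase_le (a b : R) (w q1 q2 th1 th2 : R -> R) (L : R) :
  phase a b w q1 th1 -> phase a b w q2 th2 ->
  (forall t, a < t < b -> 0 <= w t) ->
  (forall t, a < t < b -> q2 t <= q1 t) ->
  (forall t, a < t < b -> Rabs (w t * (q1 t - 1)) <= L) ->
  forall t, a <= t <= b -> th2 t <= th1 t.
Proof.
  intros [c1 [e1 d1]] [c2 [e2 d2]] hw hq hL t ht.
  assert (0 <= th1 t - th2 t); [|lra].
  apply (gronwall_nonneg (fun t => th1 t - th2 t)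
    (fun t => w t * (cos (th1 t) ^ 2 + q1 t * sin (th1 t) ^ 2)
            - w t * (cos (th2 t) ^ 2 + q2 t * sin (th2 t) ^ 2)) L a b); try assumption.
  - intros x hx. split.
    + apply (is_derive_minus th1 th2); [now apply d1|now apply d2].
    + rewrite !phase_rhs.
      pose proof (sin2_term_bound _ L (th1 x) (th2 x) (hL x hx)) as H2.
      assert (0 <= w x * (q1 x - q2 x) * sin (th2 x) ^ 2).
      { apply Rmult_le_pos; [|apply pow2_ge_0]. specialize (hw x hx). specialize (hq x hx).
        apply Rmult_le_pos; lra. }
      lra.
  - intros x _. apply (continuous_minus th1 th2); [apply c1|apply c2].
  - lra.
Qed.

(** At a multiple [c] of [PI] the angle moves at speed [w > 0]: it crosses each
    such level once, upwards. *)
Lemma phase_barrier (a b : R) (w q th : R -> R) (L c t0 t1 : R) :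
  phase a b w q th ->
  (forall t, a < t < b -> 0 < w t) ->
  (forall t, a < t < b -> Rabs (w t * (q t - 1)) <= L) ->
  sin c = 0 -> a <= t0 -> t0 < t1 -> t1 <= b -> c <= th t0 -> c < th t1.
Proof.
  intros [ct [_ d]] hw hL hc h0 h1 h2 hle.
  assert (0 < th t1 - c); [|lra].
  apply (gronwall_pos (fun t => th t - c)
    (fun t => w t * (cos (th t) ^ 2 + q t * sin (th t) ^ 2)) L t0 t1); [assumption| | |lra].
  - intros x hx. assert (hx' : a < x < b) by lra. split.
    + replace (w x * (cos (th x) ^ 2 + q x * sin (th x) ^ 2))
        with (w x * (cos (th x) ^ 2 + q x * sin (th x) ^ 2) - 0) by ring.
      apply (is_derive_minus th (fun _ => c)); [now apply d|apply (is_derive_const c)].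
    + rewrite phase_rhs.
      pose proof (sin2_term_bound _ L (th x) c (hL x hx')) as H2. rewrite hc in H2. specialize (hw x hx'). nra.
  - intros x _. apply (continuous_minus th (fun _ => c)); [apply ct|apply continuous_const].
Qed.

Lemma phase_pos (a b : R) (w q th : R -> R) (L t : R) :
  phase a b w q th ->
  (forall t, a < t < b -> 0 < w t) ->
  (forall t, a < t < b -> Rabs (w t * (q t - 1)) <= L) ->
  a < t <= b -> 0 < th t.
Proof.
  intros h hw hL ht.
  apply (phase_barrier a b w q th L 0 a t); try assumption; try lra.
  - apply sin_0.
  - destruct h as [_ [e _]]. lra.
Qed.

(** Where [sin th2 = 0] the coefficient [q] drops out of the equation, so strictness
    is obtained just after [a], where [0 < th2 < PI], and then propagated to [b]. *)
Lemma phase_lt (a b : R) (w q1 q2 th1 th2 : R -> R) (L : R) :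
  a < b ->
  phase a b w q1 th1 -> phase a b w q2 th2 ->
  (forall t, a < t < b -> 0 < w t) ->
  (forall t, a < t < b -> q2 t < q1 t) ->
  (forall t, a < t < b -> Rabs (w t * (q1 t - 1)) <= L) ->
  (forall t, a < t < b -> Rabs (w t * (q2 t - 1)) <= L) ->
  th2 b < th1 b.
Proof.
  intros ab h1 h2 hw hq hL1 hL2.
  assert (pos2 := fun t => phase_pos a b w q2 th2 L t h2 hw hL2).
  destruct h1 as [c1 [e1 d1]], h2 as [c2 [e2 d2]].
  set (dd := fun t => w t * (cos (th1 t) ^ 2 + q1 t * sin (th1 t) ^ 2)
            - w t * (cos (th2 t) ^ 2 + q2 t * sin (th2 t) ^ 2)).
  assert (D : forall x, a < x < b -> is_derive (fun t => th1 t - th2 t) x (dd x)).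
  { intros x hx. apply (is_derive_minus th1 th2); [now apply d1|now apply d2]. }
  assert (C : forall x, continuous (fun t => th1 t - th2 t) x).
  { intros x. apply (continuous_minus th1 th2); [apply c1|apply c2]. }
  assert (B : forall x, a < x < b ->
     w x * (q1 x - q2 x) * sin (th2 x) ^ 2 - L * Rabs (th1 x - th2 x) <= dd x).
  { intros x hx. unfold dd. rewrite !phase_rhs.
    pose proof (sin2_term_bound _ L (th1 x) (th2 x) (hL1 x hx)) as H2. lra. }
  assert (N : exists s, a < s < b /\ forall t, a < t < s -> 0 < th2 t < 1).
  { pose proof (proj1 (filterlim_locally th2 (th2 a)) (c2 a)) as H.
    destruct (H (mkposreal 1 Rlt_0_1)) as [eta he].
    exists (Rmin (a + eta) ((a + b) / 2)). pose proof (cond_pos eta). split.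
    - unfold Rmin. destruct Rle_dec; lra.
    - intros t ht. assert (t < a + eta /\ t < (a + b) / 2) as [H1 H2].
      { revert ht. unfold Rmin. destruct Rle_dec; lra. }
      split; [apply pos2; lra|].
      assert (Hb : ball a eta t) by (change (Rabs (t - a) < eta); rewrite Rabs_pos_eq; lra).
      specialize (he t Hb). change (Rabs (th2 t - th2 a) < 1) in he.
      rewrite e2 in he. apply Rabs_def2 in he. lra. }
  destruct N as [s [hs hN]].
  assert (Hs : 0 < th1 s - th2 s).
  { apply (gronwall_pos (fun t => th1 t - th2 t) dd L a s); [lra| | |lra].
    - intros x hx. assert (hx' : a < x < b) by lra. split; [now apply D|].
      specialize (B x hx'). specialize (hN x hx). pose proof PI_RGT_0. pose proof PI2_3_2.
      assert (0 < sin (th2 x)) by (apply sin_gt_0; unfold PI2 in *; lra).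
      assert (0 < w x * (q1 x - q2 x) * sin (th2 x) ^ 2).
      { apply Rmult_lt_0_compat; [|now apply pow_lt]. specialize (hw x hx'). specialize (hq x hx').
        apply Rmult_lt_0_compat; lra. }
      lra.
    - intros x _. apply C. }
  assert (0 < th1 b - th2 b); [|lra].
  apply (gronwall_growth (fun t => th1 t - th2 t) dd L a b s); try assumption; try lra.
  - intros x hx. split; [now apply D|]. specialize (B x hx).
    assert (0 <= w x * (q1 x - q2 x) * sin (th2 x) ^ 2).
    { apply Rmult_le_pos; [|apply pow2_ge_0]. specialize (hw x hx). specialize (hq x hx).
      apply Rmult_le_pos; lra. }
    lra.
  - intros x _. apply C.
Qed.

(** When [q <= 0] the solution [phi] has no turning point: the angle stays below
    the constant solution [PI / 2] of the equation with [q = 0]. *)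
Lemma phase_le_PI2 (a b : R) (w q th : R -> R) (L : R) :
  phase a b w q th ->
  (forall t, a < t < b -> 0 <= w t <= L) ->
  (forall t, a < t < b -> q t <= 0) ->
  forall t, a <= t <= b -> th t <= PI / 2.
Proof.
  intros [c [e d]] hw hq t ht.
  assert (0 <= PI / 2 - th t); [|lra].
  apply (gronwall_nonneg (fun t => PI / 2 - th t)
    (fun t => 0 - w t * (cos (th t) ^ 2 + q t * sin (th t) ^ 2)) L a b); try assumption.
  - intros x hx. split.
    + apply (is_derive_minus (fun _ => PI / 2) th); [apply (is_derive_const (PI / 2))|now apply d].
    + pose proof (sin2_lipschitz (PI / 2 - th x) 0) as H. rewrite sin_shift, sin_0 in H.
      replace (cos (th x) ^ 2 - 0 ^ 2) with (cos (th x) ^ 2) in H by ring.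
      rewrite Rabs_pos_eq in H by apply pow2_ge_0. rewrite Rminus_0_r in H.
      specialize (hw x hx). specialize (hq x hx). pose proof (pow2_ge_0 (cos (th x))).
      assert (w x * cos (th x) ^ 2 <= L * Rabs (PI / 2 - th x)) by (apply Rmult_le_compat; lra).
      assert (0 <= w x * (- q x) * sin (th x) ^ 2).
      { apply Rmult_le_pos; [|apply pow2_ge_0]. apply Rmult_le_pos; lra. }
      lra.
  - intros x _. apply (continuous_minus (fun _ => PI / 2) th); [apply continuous_const|apply c].
  - rewrite e. pose proof PI_RGT_0. lra.
Qed.

(** The function [eps exp ((L + 1) (t - a))] grows fast enough to stay above the
    difference of the angles.  Applied to nearby parameters, this bound makes the angle
    continuous in the parameter. *)
Lemma phase_stable (a b : R) (w q1 q2 th1 th2 : R -> R) (L eps : R) :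
  phase a b w q1 th1 -> phase a b w q2 th2 ->
  (forall t, a < t < b -> Rabs (w t * (q1 t - q2 t)) <= eps) ->
  (forall t, a < t < b -> Rabs (w t * (q1 t - 1)) <= L) ->
  0 <= L -> 0 <= eps ->
  forall t, a <= t <= b -> th1 t - th2 t <= eps * exp ((L + 1) * (t - a)).
Proof.
  intros [c1 [e1 d1]] [c2 [e2 d2]] heps hL L0 eps0 t ht.
  set (E := fun t => exp ((L + 1) * (t - a))).
  assert (Eder : forall t, is_derive (fun t => eps * E t) t (eps * ((L + 1) * E t))).
  { intros x. unfold E. auto_derive; [exact I|]. unfold Rminus. ring. }
  assert (0 <= eps * E t - (th1 t - th2 t)); [|unfold E in *; lra].
  apply (gronwall_nonneg (fun t => eps * E t - (th1 t - th2 t))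
    (fun t => eps * ((L + 1) * E t) -
            (w t * (cos (th1 t) ^ 2 + q1 t * sin (th1 t) ^ 2)
            - w t * (cos (th2 t) ^ 2 + q2 t * sin (th2 t) ^ 2))) L a b); try assumption.
  - intros x hx. split.
    + apply (is_derive_minus (fun t => eps * E t) (fun t => th1 t - th2 t)); [apply Eder|].
      apply (is_derive_minus th1 th2); [now apply d1|now apply d2].
    + rewrite !phase_rhs.
      pose proof (sin2_term_bound _ L (th1 x) (th2 x) (hL x hx)) as H2. specialize (heps x hx).
      assert (H3 : Rabs (w x * (q1 x - q2 x) * sin (th2 x) ^ 2) <= eps * 1).
      { rewrite Rabs_mult. apply Rmult_le_compat; try apply Rabs_pos; [assumption|].
        rewrite Rabs_pos_eq by apply pow2_ge_0.
        pose proof (sin2_cos2 (th2 x)) as H. unfold Rsqr in H. pose proof (pow2_ge_0 (cos (th2 x))). nra. }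
      apply Rabs_le_between in H3.
      assert (HE : 1 <= E x).
      { apply exp_ge_1. apply Rmult_le_pos; lra. }
      assert (H4 : Rabs (th1 x - th2 x) <= Rabs (eps * E x - (th1 x - th2 x)) + eps * E x).
      { replace (th1 x - th2 x) with (- (eps * E x - (th1 x - th2 x)) + eps * E x) at 1 by ring.
        eapply Rle_trans; [apply Rabs_triang|]. rewrite Rabs_Ropp, (Rabs_pos_eq (eps * E x)); [lra|].
        apply Rmult_le_pos; lra. }
      apply (Rmult_le_compat_l L) in H4; [|exact L0]. nra.
  - intros x _. apply (continuous_minus (fun t => eps * E t) (fun t => th1 t - th2 t)).
    + apply (ex_derive_continuous (fun t => eps * E t)). eexists; apply Eder.
    + apply (continuous_minus th1 th2); [apply c1|apply c2].
  - rewrite e1, e2. assert (0 < E a) by apply exp_pos. nra.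
Qed.

Lemma is_derive_sin_comp (g : R -> R) (x l : R) :
  is_derive g x l -> is_derive (fun t => sin (g t)) x (cos (g x) * l).
Proof.
  intros h. replace (cos (g x) * l) with (l * cos (g x)) by ring.
  apply (is_derive_comp sin g); [|exact h]. apply is_derive_Reals, derivable_pt_lim_sin.
Qed.

Lemma is_derive_cos_comp (g : R -> R) (x l : R) :
  is_derive g x l -> is_derive (fun t => cos (g t)) x (- sin (g x) * l).
Proof.
  intros h. replace (- sin (g x) * l) with (l * - sin (g x)) by ring.
  apply (is_derive_comp cos g); [|exact h]. apply is_derive_Reals, derivable_pt_lim_cos.
Qed.

(** The amplitude solves the linear equation [r' = w (1 - q) sin th cos th r],
    hence is the exponential of an integral. *)
Lemma phase_solution (a b : R) (w q th : R -> R) :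
  phase a b w q th ->
  (forall t, continuous w t) -> (forall t, continuous q t) ->
  exists phi psi : R -> R,
    (forall t, continuous phi t) /\ (forall t, continuous psi t) /\
    (forall t, a < t < b -> is_derive phi t (w t * psi t)) /\
    (forall t, a < t < b -> is_derive psi t (- (w t * q t * phi t))) /\
    (forall t, phi t = 0 <-> sin (th t) = 0) /\
    (forall t, 0 < phi t ^ 2 + psi t ^ 2).
Proof.
  intros [c [e d]] hw hq.
  assert (hs := fun t => continuous_sin_comp th t (c t)).
  assert (hk := fun t => continuous_cos_comp th t (c t)).
  set (g := fun t => w t * (1 - q t) * (sin (th t) * cos (th t))).
  assert (hg : forall t, continuous g t).
  { intros t. apply (continuous_mult_R (fun t => w t * (1 - q t)) (fun t => sin (th t) * cos (th t))).
    - apply (continuous_mult_R w (fun t => 1 - q t)); [apply hw|].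
      apply (continuous_minus (fun _ => 1) q); [apply continuous_const|apply hq].
    - now apply (continuous_mult_R (fun t => sin (th t)) (fun t => cos (th t))). }
  set (r := fun t => exp (RInt g a t)).
  assert (dr : forall t, is_derive r t (g t * r t)).
  { intros t. apply (is_derive_comp exp (fun t => RInt g a t)).
    - apply is_derive_Reals, derivable_pt_lim_exp.
    - now apply is_derive_RInt_all. }
  assert (cr : forall t, continuous r t).
  { intros t. apply (ex_derive_continuous r). eexists; apply dr. }
  assert (pr : forall t, 0 < r t) by (intros t; apply exp_pos).
  exists (fun t => r t * sin (th t)), (fun t => r t * cos (th t)).
  split; [|split; [|split; [|split; [|split]]]].
  - intros t. now apply (continuous_mult_R r).
  - intros t. now apply (continuous_mult_R r).
  - intros t ht.
    replace (w t * (r t * cos (th t))) with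
      (g t * r t * sin (th t) + r t * (cos (th t) * (w t * (cos (th t) ^ 2 + q t * sin (th t) ^ 2)))).
    + apply (is_derive_mult_R r (fun t => sin (th t))); [apply dr|].
      apply is_derive_sin_comp. now apply d.
    + unfold g. pose proof (sin2_cos2 (th t)) as H. unfold Rsqr in H.
      transitivity (w t * (r t * cos (th t)) * (sin (th t) * sin (th t) + cos (th t) * cos (th t)));
        [ring|rewrite H; ring].
  - intros t ht.
    replace (- (w t * q t * (r t * sin (th t)))) with
      (g t * r t * cos (th t) + r t * (- sin (th t) * (w t * (cos (th t) ^ 2 + q t * sin (th t) ^ 2)))).
    + apply (is_derive_mult_R r (fun t => cos (th t))); [apply dr|].
      apply is_derive_cos_comp. now apply d.
    + unfold g. pose proof (sin2_cos2 (th t)) as H. unfold Rsqr in H.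
      transitivity (- (w t * q t * (r t * sin (th t))) * (sin (th t) * sin (th t) + cos (th t) * cos (th t)));
        [ring|rewrite H; ring].
  - intros t. specialize (pr t). split; intros H.
    + apply Rmult_integral in H. destruct H; [lra|assumption].
    + rewrite H. ring.
  - intros t. pose proof (sin2_cos2 (th t)) as H. unfold Rsqr in H. specialize (pr t).
    replace (_ + _) with (r t ^ 2 * (sin (th t) * sin (th t) + cos (th t) * cos (th t))) by ring.
    rewrite H, Rmult_1_r. now apply pow_lt.
Qed.

(** * Comparison of radial eigenvalues *)

Lemma choice_function {A B : Type} (P : A -> B -> Prop) :
  (forall x, exists y, P x y) -> exists f : A -> B, forall x, P x (f x).
Proof.
  intros h.
  exists (fun x => proj1_sig (constructive_indefinite_description _ (h x))).
  intros x. apply proj2_sig.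
Qed.

Lemma continuous_locally_lipschitz (f : R -> R) (x C : R) :
  0 <= C ->
  (forall y, Rabs (y - x) <= 1 -> Rabs (f y - f x) <= C * Rabs (y - x)) -> continuous f x.
Proof.
  intros hC h. apply filterlim_locally. intros eps.
  assert (hd : 0 < Rmin 1 (eps / (C + 1))).
  { apply Rmin_pos; [lra|]. apply Rdiv_lt_0_compat; [apply cond_pos|lra]. }
  exists (mkposreal _ hd). intros y hy.
  change (Rabs (y - x) < Rmin 1 (eps / (C + 1))) in hy.
  change (Rabs (f y - f x) < eps).
  pose proof (Rmin_l 1 (eps / (C + 1))). pose proof (Rmin_r 1 (eps / (C + 1))).
  apply Rle_lt_trans with (C * Rabs (y - x)); [apply h; lra|].
  pose proof (cond_pos eps).
  apply Rle_lt_trans with (C * (eps / (C + 1))); [apply Rmult_le_compat_l; lra|].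
  assert (0 < eps / (C + 1)) by (apply Rdiv_lt_0_compat; lra).
  apply Rlt_le_trans with ((C + 1) * (eps / (C + 1))); [nra|]. right. field. lra.
Qed.

Definition bounded_by (M : R) (f : R -> R) : Prop := forall t, Rabs (f t) <= M.

Lemma mode_coefficient_bound (w rho : R -> R) (M k nu : R) :
  bounded_by M w -> bounded_by M rho ->
  forall t, Rabs (w t * (nu * rho t - k - 1)) <= M * (Rabs nu * M + Rabs k + 1).
Proof.
  intros hw hr t. rewrite Rabs_mult. apply Rmult_le_compat; try apply Rabs_pos; [apply hw|].
  eapply Rle_trans; [apply Rabs_triang|]. rewrite Rabs_Ropp, Rabs_R1.
  apply Rplus_le_compat_r.
  eapply Rle_trans; [apply Rabs_triang|]. rewrite Rabs_Ropp.
  apply Rplus_le_compat_r. rewrite Rabs_mult. apply Rmult_le_compat_l; [apply Rabs_pos|apply hr].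
Qed.

(** [Th k nu] is the angle of the radial solution with angular constant [k]
    (the square of the wave number) and spectral parameter [nu]. *)
Definition phase_family (a : R) (w rho : R -> R) (Th : R -> R -> R -> R) : Prop :=
  forall k nu b, phase a b w (fun t => nu * rho t - k) (Th k nu).

Lemma mode_coefficient_continuous (rho : R -> R) (k nu t : R) :
  continuous rho t -> continuous (fun t => nu * rho t - k) t.
Proof.
  intros h. apply (continuous_minus (fun t => nu * rho t) (fun _ => k)); [|apply continuous_const].
  now apply (continuous_scal_r nu rho).
Qed.

Lemma phase_family_exists (a : R) (w rho : R -> R) (M : R) :
  (forall t, continuous w t) -> (forall t, continuous rho t) ->
  bounded_by M w -> bounded_by M rho -> exists Th, phase_family a w rho Th.
Proof.
  intros cw cr bw br.
  assert (hM : 0 <= M) by (pose proof (Rabs_pos (w 0)); pose proof (bw 0); lra).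
  assert (H : forall p : R * R, exists th, forall b, phase a b w (fun t => snd p * rho t - fst p) th).
  { intros [k nu]. simpl.
    apply (phase_exists a w _ (M + Rabs nu * M + Rabs k)); try assumption.
    - intros t. apply mode_coefficient_continuous, cr.
    - intros t. specialize (bw t). pose proof (Rabs_pos k).
      assert (0 <= Rabs nu * M) by (apply Rmult_le_pos; [apply Rabs_pos|exact hM]). lra.
    - intros t. eapply Rle_trans; [apply Rabs_triang|]. rewrite Rabs_Ropp, Rabs_mult.
      assert (Rabs nu * Rabs (rho t) <= Rabs nu * M) by (apply Rmult_le_compat_l; [apply Rabs_pos|apply br]).
      lra. }
  destruct (choice_function _ H) as [f hf].
  exists (fun k nu => f (k, nu)). intros k nu b. exact (hf (k, nu) b).
Qed.

Lemma phase_family_continuous (a : R) (w rho : R -> R) (M : R) (Th : R -> R -> R -> R) :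
  bounded_by M w -> bounded_by M rho -> phase_family a w rho Th ->
  forall k b nu, a <= b -> continuous (fun nu => Th k nu b) nu.
Proof.
  intros bw br hT k b nu ab.
  assert (hM : 0 <= M) by (pose proof (Rabs_pos (w 0)); pose proof (bw 0); lra).
  set (L := M * ((Rabs nu + 1) * M + Rabs k + 1)).
  pose proof (Rabs_pos nu) as Pn. pose proof (Rabs_pos k) as Pk.
  assert (hL : 0 <= L).
  { apply Rmult_le_pos; [exact hM|]. assert (0 <= (Rabs nu + 1) * M) by (apply Rmult_le_pos; lra). lra. }
  assert (S : forall n1 n2, Rabs n1 <= Rabs nu + 1 -> Rabs n2 <= Rabs nu + 1 ->
     Th k n1 b - Th k n2 b <= M * M * Rabs (n1 - n2) * exp ((L + 1) * (b - a))).
  { intros n1 n2 h1 h2.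
    apply (phase_stable a b w (fun t => n1 * rho t - k) (fun t => n2 * rho t - k)); try lra.
    - apply hT.
    - apply hT.
    - intros t _. replace (w t * (n1 * rho t - k - (n2 * rho t - k))) with (w t * rho t * (n1 - n2)) by ring.
      rewrite !Rabs_mult. apply Rmult_le_compat_r; [apply Rabs_pos|].
      apply Rmult_le_compat; try apply Rabs_pos; [apply bw|apply br].
    - intros t _. eapply Rle_trans; [apply (mode_coefficient_bound w rho M); assumption|].
      unfold L. apply Rmult_le_compat_l; [exact hM|].
      assert (Rabs n1 * M <= (Rabs nu + 1) * M) by (apply Rmult_le_compat_r; assumption). lra.
    - apply Rmult_le_pos; [nra|apply Rabs_pos]. }
  assert (P : 0 < exp ((L + 1) * (b - a))) by apply exp_pos.
  apply (continuous_locally_lipschitz _ _ (M * M * exp ((L + 1) * (b - a)))); [nra|].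
  intros y hy.
  assert (hy' : Rabs y <= Rabs nu + 1).
  { replace y with (nu + (y - nu)) by ring. eapply Rle_trans; [apply Rabs_triang|]. lra. }
  pose proof (S y nu hy' ltac:(lra)) as H1. pose proof (S nu y ltac:(lra) hy') as H2.
  rewrite (Rabs_minus_sym nu y) in H2.
  apply Rabs_le. split; lra.
Qed.

Lemma sin_zero_ge_PI (c : R) : 0 < c -> sin c = 0 -> PI <= c.
Proof.
  intros h0 hs. destruct (Rle_dec PI c) as [|h]; [assumption|].
  assert (0 < sin c) by (apply sin_gt_0; lra). lra.
Qed.

(** The first problem, on [[0, T]], is transported to [[a, s0]] by the change of
    variable [tau].  There both angles satisfy equations with the same speed [w] and
    comparable weights, so the second angle is at least as large at [s0]; the
    barrier makes it strictly larger at [b > s0].  Decreasing the parameter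
    from [mu] to [0] brings the angle at [b] below [PI], so that on the way it takes
    the value that it has at an eigenvalue of the first problem.  That common
    value recovers the eigenvalue, whence injectivity. *)
Lemma mode_transfer (a b s0 T M M' : R) (w rho rhoA tau : R -> R) (ThS ThA : R -> R -> R -> R) (mu : R) :
  a <= s0 < b -> 0 < T ->
  bounded_by M w -> bounded_by M rho -> bounded_by M' rhoA -> 1 <= M' ->
  (forall t, 0 < w t) -> (forall t, 0 < rhoA t) ->
  (forall t, continuous tau t) -> tau a = 0 -> tau s0 = T ->
  (forall s, a < s < s0 -> is_derive tau s (w s)) ->
  (forall s, a < s < s0 -> 0 < tau s < T) ->
  (forall s, a < s < s0 -> rhoA (tau s) <= rho s) ->
  phase_family a w rho ThS -> phase_family 0 (fun _ => 1) rhoA ThA ->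
  exists tr : R -> R -> R,
    (forall k nu, 0 <= k -> nu <= mu -> sin (ThA k nu T) = 0 ->
       tr k nu < mu /\ sin (ThS k (tr k nu) b) = 0) /\
    (forall k nu1 nu2, 0 <= k -> nu1 <= mu -> nu2 <= mu ->
       sin (ThA k nu1 T) = 0 -> sin (ThA k nu2 T) = 0 ->
       tr k nu1 = tr k nu2 -> nu1 = nu2).
Proof.
  intros hs hT bw br bA hM' pw pA ctau tau0 tauT dtau rtau cmp fS fA.
  assert (b1 : bounded_by M' (fun _ => 1)) by (intros t; rewrite Rabs_R1; exact hM').
  assert (posA : forall k nu, 0 < ThA k nu T).
  { intros k nu.
    apply (phase_pos 0 T (fun _ => 1) (fun t => nu * rhoA t - k) _
      (M' * (Rabs nu * M' + Rabs k + 1)) T (fA k nu T)); [intros; lra| |lra].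
    intros t _. now apply (mode_coefficient_bound (fun _ => 1) rhoA M'). }
  assert (monoA : forall k nu1 nu2, nu1 < nu2 -> ThA k nu1 T < ThA k nu2 T).
  { intros k nu1 nu2 hn.
    assert (B : forall nu t, 0 <= Rabs (1 * (nu * rhoA t - k - 1)) <= M' * (Rabs nu * M' + Rabs k + 1)).
    { intros nu t. split; [apply Rabs_pos|]. now apply (mode_coefficient_bound (fun _ => 1) rhoA). }
    apply (phase_lt 0 T (fun _ => 1) (fun t => nu2 * rhoA t - k) (fun t => nu1 * rhoA t - k) _ _
      (M' * (Rabs nu1 * M' + Rabs k + 1) + M' * (Rabs nu2 * M' + Rabs k + 1))); try apply fA; try lra.
    - intros; lra.
    - intros t _. specialize (pA t). nra.
    - intros t _. specialize (B nu1 t) as h1. specialize (B nu2 t) as h2. lra.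
    - intros t _. specialize (B nu1 t) as h1. specialize (B nu2 t) as h2. lra. }
  assert (EX : forall p : R * R, exists nu', 0 <= fst p -> snd p <= mu -> sin (ThA (fst p) (snd p) T) = 0 ->
     nu' < mu /\ ThS (fst p) nu' b = ThA (fst p) (snd p) T).
  { intros [k nu]. simpl.
    destruct (classic (0 <= k /\ nu <= mu /\ sin (ThA k nu T) = 0)) as [[hk [hnu hsin]]|hn].
    2:{ exists 0. intros h1 h2 h3. tauto. }
    set (c := ThA k nu T) in *.
    assert (hc : PI <= c) by (apply sin_zero_ge_PI; [apply posA|exact hsin]).
    assert (hmu : c <= ThA k mu T).
    { destruct hnu as [h|h]; [left; now apply monoA|rewrite <- h; right; reflexivity]. }
    assert (mupos : 0 < mu).
    { destruct (Rlt_dec 0 mu) as [|hneg]; [assumption|].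
      assert (ThA k mu T <= PI / 2).
      { apply (phase_le_PI2 0 T (fun _ => 1) (fun t => mu * rhoA t - k) _ 1 (fA k mu T)); [intros; lra| |lra].
        intros t _. specialize (pA t). nra. }
      pose proof PI_RGT_0. lra. }
    assert (LS := fun n t => mode_coefficient_bound w rho M k n bw br t).
    assert (hs0 : c <= ThS k mu s0).
    { apply Rle_trans with (ThA k mu (tau s0)); [rewrite tauT; exact hmu|].
      apply (phase_le a s0 w (fun s => mu * rho s - k) (fun s => mu * rhoA (tau s) - k)
         (ThS k mu) (fun s => ThA k mu (tau s)) (M * (Rabs mu * M + Rabs k + 1))).
      - apply fS.
      - destruct (fA k mu T) as [cA [eA dA]]. split; [|split].
        + intros t. apply (continuous_comp tau (ThA k mu)); [apply ctau|apply cA].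
        + now rewrite tau0.
        + intros s hss.
          replace (w s * (cos (ThA k mu (tau s)) ^ 2 + (mu * rhoA (tau s) - k) * sin (ThA k mu (tau s)) ^ 2))
            with (w s * (1 * (cos (ThA k mu (tau s)) ^ 2 + (mu * rhoA (tau s) - k) * sin (ThA k mu (tau s)) ^ 2))) by ring.
          apply (is_derive_comp (ThA k mu) tau); [apply dA; now apply rtau|now apply dtau].
      - intros t _. left. apply pw.
      - intros t ht. specialize (cmp t ht). nra.
      - intros t _. apply LS.
      - lra. }
    assert (hb : c < ThS k mu b).
    { apply (phase_barrier a b w (fun s => mu * rho s - k) (ThS k mu) (M * (Rabs mu * M + Rabs k + 1)) c s0 b);
        try lra; try apply fS.
      - intros; apply pw.
      - intros t _. apply LS. }
    assert (h0 : ThS k 0 b < c).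
    { assert (ThS k 0 b <= PI / 2).
      { apply (phase_le_PI2 a b w (fun t => 0 * rho t - k) _ M (fS k 0 b)); [| |lra].
        - intros t _. split; [left; apply pw|]. specialize (bw t). specialize (pw t).
          rewrite Rabs_pos_eq in bw; lra.
        - intros t _. lra. }
      pose proof PI_RGT_0. lra. }
    destruct (IVT (fun n => ThS k n b - c) 0 mu) as [z [hz ez]]; try lra.
    { intros n. apply continuity_pt_filterlim.
      apply (continuous_minus (fun n => ThS k n b) (fun _ => c)); [|apply continuous_const].
      apply (phase_family_continuous a w rho M); try assumption. lra. }
    exists z. intros _ _ _. split; [|lra].
    destruct (Req_dec z mu) as [->|]; lra. }
  destruct (choice_function _ EX) as [f hf].
  exists (fun k nu => f (k, nu)). split.
  - intros k nu hk hnu hsin. destruct (hf (k, nu) hk hnu hsin) as [h1 h2]. simpl in *.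
    split; [exact h1|]. now rewrite h2.
  - intros k nu1 nu2 hk hn1 hn2 hs1 hs2 e.
    destruct (hf (k, nu1) hk hn1 hs1) as [_ h1]. destruct (hf (k, nu2) hk hn2 hs2) as [_ h2].
    simpl in *. rewrite e, h2 in h1.
    destruct (Rtotal_order nu1 nu2) as [h|[h|h]]; [|exact h|]; apply (monoA k) in h; lra.
Qed.

(** * Counting with multiplicity *)

Lemma list_matching {A B : Type} (d : B) (l1 : list A) (l2 : list B) :
  NoDup l1 -> NoDup l2 -> (length l1 <= length l2)%nat ->
  exists f : A -> B, (forall x, In x l1 -> In (f x) l2) /\
    (forall x y, In x l1 -> In y l1 -> f x = f y -> x = y).
Proof.
  revert l2. induction l1 as [|x l1 IH]; intros l2 n1 n2 hl.
  - exists (fun _ => d). split; [intros x []|intros x y []].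
  - destruct l2 as [|y l2]; simpl in hl; [lia|].
    inversion n1 as [|? ? nx n1']; inversion n2 as [|? ? ny n2']; subst.
    destruct (IH l2 n1' n2') as [f [f1 f2]]; [lia|].
    exists (fun z => if excluded_middle_informative (z = x) then y else f z). split.
    + intros z hz. destruct excluded_middle_informative as [|ne]; [now left|].
      right. apply f1. destruct hz; [congruence|assumption].
    + intros z z' hz hz'.
      destruct (excluded_middle_informative (z = x)), (excluded_middle_informative (z' = x));
        intros hfe; try congruence.
      * exfalso. apply ny. rewrite hfe. apply f1. destruct hz'; [congruence|assumption].
      * exfalso. apply ny. rewrite <- hfe. apply f1. destruct hz; [congruence|assumption].
      * apply f2; [destruct hz|destruct hz'|]; congruence || assumption.
Qed.

Lemma NoDup_map_on {A B : Type} (f : A -> B) (l : list A) :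
  NoDup l -> (forall x y, In x l -> In y l -> f x = f y -> x = y) -> NoDup (map f l).
Proof.
  induction l as [|x l IH]; intros n h; simpl; [constructor|].
  inversion n; subst. constructor.
  - rewrite in_map_iff. intros [y [e hy]].
    assert (y = x) by (apply h; [now right|now left|exact e]). congruence.
  - apply IH; [assumption|]. intros; apply h; try right; assumption.
Qed.

(** The multiplicity of [nu] is bounded above by the number of modes on one
    side, below on the other.  So the first [j] indices of [lamA] inject into
    pairs (mode, eigenvalue), then by the transfer into such pairs with eigenvalue below
    [lamA j], then into indices of [lamS]; if [lamS j >= lamA j] these indices are all
    below [j], which is one too few. *)
Lemma counting_comparison {M : Type} (m0 : M) (lamS lamA : nat -> R)
  (eigS eigA : M -> R -> Prop) (tr : M -> R -> R) (j : nat) :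
  (1 <= j)%nat ->
  (forall i, (1 <= i)%nat -> lamS i <= lamS (S i)) ->
  (forall i, (1 <= i)%nat -> lamA i <= lamA (S i)) ->
  (forall nu, exists (js : list nat) (ps : list M),
     (forall i, In i js <-> (1 <= i)%nat /\ lamA i = nu) /\ NoDup js /\ NoDup ps /\
     (length js <= length ps)%nat /\ forall p, In p ps -> eigA p nu) ->
  (forall nu, exists js : list nat,
     (forall i, In i js <-> (1 <= i)%nat /\ lamS i = nu) /\ NoDup js /\
     forall ps, NoDup ps -> (forall p, In p ps -> eigS p nu) -> (length ps <= length js)%nat) ->
  (forall p nu, nu <= lamA j -> eigA p nu -> tr p nu < lamA j /\ eigS p (tr p nu)) ->
  (forall p nu1 nu2, nu1 <= lamA j -> nu2 <= lamA j -> eigA p nu1 -> eigA p nu2 ->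
     tr p nu1 = tr p nu2 -> nu1 = nu2) ->
  lamS j < lamA j.
Proof.
  intros hj mS mA hA hS htr hinj.
  destruct (Rlt_dec (lamS j) (lamA j)) as [|hge]; [assumption|exfalso].
  assert (monoS : forall i i', (1 <= i)%nat -> (i <= i')%nat -> lamS i <= lamS i').
  { intros i i' h1 h2. induction h2 as [|i' h2 IH]; [lra|]. specialize (mS i' ltac:(lia)). lra. }
  assert (monoA : forall i i', (1 <= i)%nat -> (i <= i')%nat -> lamA i <= lamA i').
  { intros i i' h1 h2. induction h2 as [|i' h2 IH]; [lra|]. specialize (mA i' ltac:(lia)). lra. }
  assert (HA : forall nu, exists f : nat -> M,
     (forall i, (1 <= i)%nat -> lamA i = nu -> eigA (f i) nu) /\
     (forall i i', (1 <= i)%nat -> (1 <= i')%nat -> lamA i = nu -> lamA i' = nu -> f i = f i' -> i = i')).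
  { intros nu. destruct (hA nu) as [js [ps [hjs [n1 [n2 [hl he]]]]]].
    destruct (list_matching m0 js ps n1 n2 hl) as [f [f1 f2]].
    exists f. split.
    - intros i h1 h2. apply he, f1, hjs. now split.
    - intros i i' h1 h1' h2 h2'. apply f2; apply hjs; now split. }
  destruct (choice_function _ HA) as [pick hpick]. clear HA.
  set (g := fun i => (pick (lamA i) i, tr (pick (lamA i) i) (lamA i))).
  set (idx := seq 1 j).
  assert (hidx : forall i, In i idx <-> (1 <= i <= j)%nat).
  { intros i. unfold idx. rewrite in_seq. lia. }
  assert (gprop : forall i, In i idx -> snd (g i) < lamA j /\ eigS (fst (g i)) (snd (g i))).
  { intros i hi. apply hidx in hi. simpl. apply htr.
    - apply monoA; lia.
    - apply hpick; [lia|reflexivity]. }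
  assert (ginj : forall i i', In i idx -> In i' idx -> g i = g i' -> i = i').
  { intros i i' hi hi'. apply hidx in hi. apply hidx in hi'. unfold g. intros e.
    injection e as e1 e2. rewrite e1 in e2.
    assert (lamA i = lamA i') as el.
    { apply (hinj (pick (lamA i') i')); try (apply monoA; lia); [| |exact e2].
      - rewrite <- e1. apply hpick; [lia|reflexivity].
      - apply hpick; [lia|reflexivity]. }
    apply (proj2 (hpick (lamA i))); try lia; congruence. }
  set (L := map g idx).
  assert (hL : forall p, In p L -> snd p < lamA j /\ eigS (fst p) (snd p)).
  { intros p hp. apply in_map_iff in hp. destruct hp as [i [<- hi]]. now apply gprop. }
  assert (nL : NoDup L) by (apply NoDup_map_on; [apply seq_NoDup|exact ginj]).
  assert (HS : forall nu, exists f : M -> nat,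
     (forall p, In (p, nu) L -> (1 <= f p)%nat /\ lamS (f p) = nu) /\
     (forall p p', In (p, nu) L -> In (p', nu) L -> f p = f p' -> p = p')).
  { intros nu. destruct (hS nu) as [js [hjs [n1 hb]]].
    set (ps := map fst (filter (fun q => if excluded_middle_informative (snd q = nu) then true else false) L)).
    assert (hps : forall p, In p ps <-> In (p, nu) L).
    { intros p. unfold ps. rewrite in_map_iff. split.
      - intros [[p' nu'] [e hq]]. apply filter_In in hq. destruct hq as [hq hf]. simpl in *.
        destruct excluded_middle_informative; [|discriminate]. now subst.
      - intros hp. exists (p, nu). split; [reflexivity|]. apply filter_In. split; [exact hp|].
        simpl. destruct excluded_middle_informative; congruence. }
    assert (nps : NoDup ps).
    { apply NoDup_map_on; [apply NoDup_filter, nL|].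
      intros [p nu1] [p' nu2] h1 h2. apply filter_In in h1. apply filter_In in h2. simpl in *.
      destruct h1 as [_ h1], h2 as [_ h2].
      repeat destruct excluded_middle_informative; try discriminate. congruence. }
    destruct (list_matching O ps js nps n1) as [f [f1 f2]].
    { apply hb; [exact nps|]. intros p hp. apply hps, hL in hp. apply hp. }
    exists f. split.
    - intros p hp. apply hjs, f1, hps, hp.
    - intros p p' h1 h2. apply f2; now apply hps. }
  destruct (choice_function _ HS) as [F hF]. clear HS.
  set (G := fun q : M * R => F (snd q) (fst q)).
  assert (nG : NoDup (map G L)).
  { apply NoDup_map_on; [exact nL|]. intros [p nu] [p' nu'] h1 h2. unfold G. simpl. intros e.
    assert (nu = nu') as <-.
    { destruct (hF nu) as [h _]. destruct (h p h1) as [_ e1].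
      destruct (hF nu') as [h' _]. destruct (h' p' h2) as [_ e2]. congruence. }
    f_equal. now apply (proj2 (hF nu)). }
  assert (hincl : incl (map G L) (seq 1 (j - 1))).
  { intros i hi. apply in_map_iff in hi. destruct hi as [[p nu] [<- hq]].
    destruct (hF nu) as [h _]. destruct (h p hq) as [h1 h2].
    destruct (hL _ hq) as [h3 _]. unfold G. simpl in *. apply in_seq.
    destruct (Nat.le_gt_cases j (F nu p)) as [hle|]; [|lia].
    pose proof (monoS j (F nu p) hj hle). lra. }
  pose proof (NoDup_incl_length nG hincl) as H. rewrite length_map, length_seq in H.
  unfold L in H. rewrite length_map in H. unfold idx in H. rewrite length_seq in H. lia.
Qed.

Fixpoint lsum {A : Type} (f : A -> R) (l : list A) : R :=
  match l with nil => 0 | x :: l => f x + lsum f l end.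

Lemma lsum_ext {A : Type} (f g : A -> R) (l : list A) :
  (forall x, In x l -> f x = g x) -> lsum f l = lsum g l.
Proof.
  induction l as [|x l IH]; intros h; simpl; [reflexivity|].
  rewrite h by now left. rewrite IH; [reflexivity|]. intros; apply h. now right.
Qed.

Lemma lsum_plus {A : Type} (f g : A -> R) (l : list A) :
  lsum (fun x => f x + g x) l = lsum f l + lsum g l.
Proof. induction l as [|x l IH]; simpl; [ring|]. rewrite IH. ring. Qed.

Lemma lsum_scal {A : Type} (c : R) (f : A -> R) (l : list A) :
  lsum (fun x => c * f x) l = c * lsum f l.
Proof. induction l as [|x l IH]; simpl; [ring|]. rewrite IH. ring. Qed.

Lemma lsum_zero {A : Type} (f : A -> R) (l : list A) :
  (forall x, In x l -> f x = 0) -> lsum f l = 0.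
Proof.
  intros h. induction l as [|x l IH]; simpl; [reflexivity|].
  rewrite h by now left. rewrite IH; [ring|]. intros; apply h. now right.
Qed.

Lemma lsum_single {A : Type} (f : A -> R) (l : list A) (x : A) :
  NoDup l -> In x l -> (forall y, In y l -> y <> x -> f y = 0) -> lsum f l = f x.
Proof.
  induction l as [|y l IH]; intros n hx h; [contradiction|]. simpl.
  inversion n; subst. destruct hx as [->|hx].
  - rewrite lsum_zero; [ring|]. intros z hz. apply h; [now right|]. congruence.
  - rewrite IH; try assumption.
    + rewrite h; [ring|now left|]. congruence.
    + intros; apply h; [now right|assumption].
Qed.

Lemma lsum_permutation {A : Type} (f : A -> R) (l l' : list A) :
  Permutation l l' -> lsum f l = lsum f l'.
Proof. induction 1; simpl; lra. Qed.

Lemma lsum_swap {A B : Type} (f : A -> B -> R) (l : list A) (l' : list B) :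
  lsum (fun x => lsum (f x) l') l = lsum (fun y => lsum (fun x => f x y) l) l'.
Proof.
  induction l as [|x l IH]; simpl.
  - symmetry. now apply lsum_zero.
  - rewrite IH, lsum_plus. reflexivity.
Qed.

Lemma lsum_seq (f : nat -> R) (d : nat) : sum_n_m f 1 d = lsum f (seq 1 d).
Proof.
  assert (G : forall d m, sum_n_m f m (m + d) = lsum f (seq m (S d))).
  { induction d0 as [|d0 IH]; intros m.
    - rewrite Nat.add_0_r, sum_n_n. simpl. ring.
    - rewrite sum_Sn_m by lia. replace (m + S d0)%nat with (S m + d0)%nat by lia.
      rewrite IH. reflexivity. }
  destruct d as [|d].
  - rewrite sum_n_m_zero by lia. reflexivity.
  - exact (G d 1%nat).
Qed.

(** Gaussian elimination of one unknown per equation. *)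
Lemma homogeneous_system {E V : Type} (eqs : list E) (vars : list V) (C : E -> V -> R) :
  NoDup vars -> (length eqs < length vars)%nat ->
  exists c : V -> R, (exists v, In v vars /\ c v <> 0) /\
    forall e, In e eqs -> lsum (fun v => c v * C e v) vars = 0.
Proof.
  revert vars C. induction eqs as [|e eqs IH]; intros vars C nv hl.
  - destruct vars as [|v vars]; simpl in hl; [lia|].
    exists (fun _ => 1). split; [|intros e []]. exists v. split; [now left|lra].
  - simpl in hl. destruct (classic (exists v0, In v0 vars /\ C e v0 <> 0)) as [[v0 [h0 hC]]|hn].
    + destruct (in_split v0 vars h0) as [l1 [l2 ->]].
      assert (P : Permutation (l1 ++ v0 :: l2) (v0 :: l1 ++ l2)) by (symmetry; apply Permutation_middle).
      assert (nv' := Permutation_NoDup P nv). inversion nv' as [|? ? nin nd]; subst.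
      destruct (IH (l1 ++ l2) (fun e' v => C e' v - C e' v0 * C e v / C e v0) nd) as [c [[v [hv hc]] hs]].
      { rewrite length_app in hl |- *. simpl in hl. lia. }
      set (s := lsum (fun v => c v * C e v) (l1 ++ l2)).
      set (c' := fun v => if excluded_middle_informative (v = v0) then - (s / C e v0) else c v).
      assert (c0 : c' v0 = - (s / C e v0)) by (unfold c'; destruct excluded_middle_informative; congruence).
      assert (cr : forall v, In v (l1 ++ l2) -> c' v = c v).
      { intros u hu. unfold c'. destruct excluded_middle_informative; [congruence|reflexivity]. }
      exists c'. split.
      * exists v. split; [|now rewrite cr].
        apply (Permutation_in v (Permutation_sym P)). now right.
      * intros e' he'. rewrite (lsum_permutation _ _ _ P). simpl. rewrite c0.
        rewrite (lsum_ext (fun v => c' v * C e' v) (fun v => c v * C e' v))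
          by (intros u hu; now rewrite cr).
        destruct he' as [<-|he'].
        -- fold s. field. exact hC.
        -- specialize (hs e' he').
           assert (D : lsum (fun v => c v * (C e' v - C e' v0 * C e v / C e v0)) (l1 ++ l2)
             = lsum (fun v => c v * C e' v) (l1 ++ l2) + (- (C e' v0 / C e v0)) * s).
           { unfold s. rewrite <- lsum_scal, <- lsum_plus. apply lsum_ext. intros u _. field. exact hC. }
           rewrite D in hs. lra.
    + destruct (IH vars C nv) as [c [hc hs]]; [lia|]. exists c. split; [exact hc|].
      intros e' [<-|he']; [|now apply hs]. apply lsum_zero. intros v hv.
      destruct (Req_dec (C e v) 0) as [->|h]; [ring|]. exfalso. apply hn. now exists v.
Qed.

(** * Fourier series on the circle *)

(** [inl k] stands for [cos (k x)] and [inr k] for [sin ((k + 1) x)], so that no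
    mode vanishes identically. *)
Definition freq (p : nat + nat) : R :=
  match p with inl k => INR k | inr k => INR (S k) end.

Definition trig (p : nat + nat) (x : R) : R :=
  match p with inl _ => cos (freq p * x) | inr _ => sin (freq p * x) end.

Lemma sin_INR_2PI (k : nat) : sin (INR k * (2 * PI)) = 0.
Proof.
  replace (INR k * (2 * PI)) with (0 + 2 * INR k * PI) by ring.
  rewrite sin_period. apply sin_0.
Qed.

Lemma cos_INR_2PI (k : nat) : cos (INR k * (2 * PI)) = 1.
Proof.
  replace (INR k * (2 * PI)) with (0 + 2 * INR k * PI) by ring.
  rewrite cos_period. apply cos_0.
Qed.

Lemma cos_plus_2PI (x : R) : cos (x + 2 * PI) = cos x.
Proof. replace (x + 2 * PI) with (x + 2 * INR 1 * PI) by (simpl; ring). apply cos_period. Qed.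

Lemma sin_plus_2PI (x : R) : sin (x + 2 * PI) = sin x.
Proof. replace (x + 2 * PI) with (x + 2 * INR 1 * PI) by (simpl; ring). apply sin_period. Qed.

Lemma cos_Rabs (x : R) : cos (Rabs x) = cos x.
Proof. unfold Rabs. destruct Rcase_abs; [apply cos_neg|reflexivity]. Qed.

Lemma trig_periodic (p : nat + nat) (x : R) : trig p (x + 2 * PI) = trig p x.
Proof.
  destruct p as [k|k]; unfold trig, freq.
  - replace (INR k * (x + 2 * PI)) with (INR k * x + 2 * INR k * PI) by ring. apply cos_period.
  - replace (INR (S k) * (x + 2 * PI)) with (INR (S k) * x + 2 * INR (S k) * PI) by ring. apply sin_period.
Qed.

Definition dtrig (p : nat + nat) (x : R) : R :=
  match p with inl _ => - (freq p * sin (freq p * x)) | inr _ => freq p * cos (freq p * x) end.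

Lemma is_derive_trig (p : nat + nat) (x : R) : is_derive (trig p) x (dtrig p x).
Proof.
  destruct p as [k|k]; unfold trig, dtrig; [generalize (freq (inl k))|generalize (freq (inr k))];
    intros c; auto_derive; try exact I; ring.
Qed.

Lemma is_derive_dtrig (p : nat + nat) (x : R) : is_derive (dtrig p) x (- (freq p ^ 2 * trig p x)).
Proof.
  destruct p as [k|k]; unfold trig, dtrig; [generalize (freq (inl k))|generalize (freq (inr k))];
    intros c; auto_derive; try exact I; ring.
Qed.

Lemma continuous_trig (p : nat + nat) (x : R) : continuous (trig p) x.
Proof. apply (ex_derive_continuous (trig p)). eexists; apply is_derive_trig. Qed.

Lemma dtrig_periodic (p : nat + nat) (x : R) : dtrig p (x + 2 * PI) = dtrig p x.
Proof.
  destruct p as [k|k]; unfold dtrig, freq.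
  - replace (INR k * (x + 2 * PI)) with (INR k * x + 2 * INR k * PI) by ring. now rewrite sin_period.
  - replace (INR (S k) * (x + 2 * PI)) with (INR (S k) * x + 2 * INR (S k) * PI) by ring. now rewrite cos_period.
Qed.

Lemma continuous_cos_lin (c x : R) : continuous (fun x => cos (c * x)) x.
Proof. apply (ex_derive_continuous (fun x => cos (c * x))). auto_derive. exact I. Qed.

Lemma continuous_sin_lin (c x : R) : continuous (fun x => sin (c * x)) x.
Proof. apply (ex_derive_continuous (fun x => sin (c * x))). auto_derive. exact I. Qed.

Lemma RInt_cos_lin (c : R) : c <> 0 -> sin (c * (2 * PI)) = 0 ->
  RInt (fun x => cos (c * x)) 0 (2 * PI) = 0.
Proof.
  intros hc hs. apply is_RInt_unique.
  replace 0 with (minus (sin (c * (2 * PI)) / c) (sin (c * 0) / c)) at 2.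
  2:{ rewrite hs, Rmult_0_r, sin_0. unfold minus, plus, opp; simpl. field. exact hc. }
  apply (is_RInt_derive (fun x => sin (c * x) / c) (fun x => cos (c * x))).
  - intros x _. auto_derive; [exact I|]. field. exact hc.
  - intros x _. apply continuous_cos_lin.
Qed.

Lemma RInt_sin_lin (c : R) : c <> 0 -> cos (c * (2 * PI)) = 1 ->
  RInt (fun x => sin (c * x)) 0 (2 * PI) = 0.
Proof.
  intros hc hs. apply is_RInt_unique.
  replace 0 with (minus (- cos (c * (2 * PI)) / c) (- cos (c * 0) / c)) at 2.
  2:{ rewrite hs, Rmult_0_r, cos_0. unfold minus, plus, opp; simpl. field. exact hc. }
  apply (is_RInt_derive (fun x => - cos (c * x) / c) (fun x => sin (c * x))).
  - intros x _. auto_derive; [exact I|]. field. exact hc.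
  - intros x _. apply continuous_sin_lin.
Qed.

Lemma RInt_plus_all (f g : R -> R) (a b : R) :
  (forall x, continuous f x) -> (forall x, continuous g x) ->
  RInt (fun x => f x + g x) a b = RInt f a b + RInt g a b.
Proof.
  intros hf hg.
  exact (RInt_plus f g a b (ex_RInt_continuous_all f a b hf) (ex_RInt_continuous_all g a b hg)).
Qed.

Lemma RInt_scal_all (c : R) (f : R -> R) (a b : R) :
  (forall x, continuous f x) -> RInt (fun x => c * f x) a b = c * RInt f a b.
Proof.
  intros hf. exact (RInt_scal f a b c (ex_RInt_continuous_all f a b hf)).
Qed.

Lemma RInt_lsum {A : Type} (f : A -> R -> R) (l : list A) (a b : R) :
  (forall i, In i l -> forall x, continuous (f i) x) ->
  (forall x, continuous (fun x => lsum (fun i => f i x) l) x) /\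
  RInt (fun x => lsum (fun i => f i x) l) a b = lsum (fun i => RInt (f i) a b) l.
Proof.
  induction l as [|i l IH]; intros hf; simpl.
  - split; [intros; apply continuous_const|].
    rewrite RInt_const_R. ring_R.
  - destruct IH as [IH1 IH2]; [intros j hj; apply hf; now right|].
    assert (hi : forall x, continuous (f i) x) by (apply hf; now left).
    split.
    + intros x. apply (continuous_plus (f i) (fun x => lsum (fun i => f i x) l)); auto.
    + rewrite (RInt_plus_all (f i) (fun x => lsum (fun i => f i x) l)) by assumption.
      now rewrite IH2.
Qed.

Lemma RInt_ext_all (f g : R -> R) (a b : R) : (forall x, f x = g x) -> RInt f a b = RInt g a b.
Proof. intros h. apply (RInt_ext f g). intros x _. apply h. Qed.

(** Integrating [f g' - f' g] over a period separates different frequencies; a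
    sine and a cosine of the same frequency have an exact primitive as product. *)
Lemma trig_orthogonal (p q : nat + nat) :
  p <> q -> RInt (fun x => trig p x * trig q x) 0 (2 * PI) = 0.
Proof.
  intros hpq.
  assert (cpq : forall x, continuous (fun x => trig p x * trig q x) x).
  { intros x. apply (continuous_mult_R (trig p) (trig q)); apply continuous_trig. }
  destruct (Req_dec (freq p) (freq q)) as [e|ne].
  - assert (G : forall k l, INR k = INR (S l) ->
       RInt (fun x => trig (inl k) x * trig (inr l) x) 0 (2 * PI) = 0).
    { intros k l ekl. apply INR_eq in ekl. subst k. unfold trig, freq.
      rewrite (RInt_ext_all _ (fun x => / 2 * sin (INR (2 * S l) * x))).
      - rewrite (RInt_scal_all (/ 2) (fun x => sin (INR (2 * S l) * x))) by (intros; apply continuous_sin_lin).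
        rewrite RInt_sin_lin by first [apply cos_INR_2PI|apply not_0_INR; lia].
        ring_R.
      - intros x. rewrite mult_INR.
        replace (INR 2 * INR (S l) * x) with (2 * (INR (S l) * x)) by (simpl (INR 2); ring).
        rewrite sin_2a. field. }
    destruct p as [k|k], q as [l|l]; unfold freq in e.
    + apply INR_eq in e. congruence.
    + now apply G.
    + refine (eq_trans _ (G l k (eq_sym e))). apply RInt_ext_all. intros x. apply Rmult_comm.
    + apply INR_eq in e. congruence.
  - assert (E : RInt (fun x => (freq p ^ 2 - freq q ^ 2) * (trig p x * trig q x)) 0 (2 * PI) = 0).
    { apply is_RInt_unique.
      set (W := fun x => trig p x * dtrig q x - dtrig p x * trig q x).
      replace 0 with (minus (W (2 * PI)) (W 0)) at 2.
      2:{ unfold W. replace (2 * PI) with (0 + 2 * PI) by ring.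
          rewrite !trig_periodic, !dtrig_periodic. unfold minus, plus, opp; simpl. ring. }
      apply (is_RInt_derive W).
      - intros x _. unfold W.
        replace ((freq p ^ 2 - freq q ^ 2) * (trig p x * trig q x)) with
         ((dtrig p x * dtrig q x + trig p x * (- (freq q ^ 2 * trig q x)))
          - ((- (freq p ^ 2 * trig p x)) * trig q x + dtrig p x * dtrig q x)) by ring.
        apply (is_derive_minus (fun x => trig p x * dtrig q x) (fun x => dtrig p x * trig q x));
          apply is_derive_mult_R; first [apply is_derive_trig|apply is_derive_dtrig].
      - intros x _. apply (continuous_scal_r (freq p ^ 2 - freq q ^ 2) (fun x => trig p x * trig q x)).
        apply cpq. }
    rewrite (RInt_scal_all _ (fun x => trig p x * trig q x)) in E by exact cpq.
    apply Rmult_integral in E. destruct E as [E|E]; [|exact E].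
    exfalso. assert (0 <= freq p /\ 0 <= freq q) as [h1 h2].
    { split; [destruct p|destruct q]; apply pos_INR. }
    assert ((freq p - freq q) * (freq p + freq q) = 0) as H by (rewrite <- E; ring).
    apply Rmult_integral in H. destruct H; lra.
Qed.

Lemma trig_norm_pos (p : nat + nat) : 0 < RInt (fun x => trig p x * trig p x) 0 (2 * PI).
Proof.
  pose proof PI_RGT_0 as hpi.
  assert (G : forall (k : nat) (s : R), (k <> 0)%nat ->
    RInt (fun x => / 2 + s * cos (INR (2 * k) * x)) 0 (2 * PI) = PI).
  { intros k s hk.
    rewrite (RInt_plus_all (fun _ => / 2) (fun x => s * cos (INR (2 * k) * x))).
    - rewrite (RInt_scal_all s (fun x => cos (INR (2 * k) * x))) by (intros; apply continuous_cos_lin).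
      rewrite RInt_cos_lin by first [apply sin_INR_2PI|apply not_0_INR; lia].
      rewrite RInt_const_R. simpl. field.
    - intros; apply continuous_const.
    - intros x. apply (continuous_scal_r s (fun x => cos (INR (2 * k) * x))). apply continuous_cos_lin. }
  assert (D : forall k x, INR (2 * k) * x = 2 * (INR k * x)).
  { intros k x. rewrite mult_INR. simpl (INR 2). ring. }
  destruct p as [[|k]|k]; unfold trig, freq.
  - rewrite (RInt_ext_all _ (fun _ => 1)).
    + rewrite RInt_const_R. lra.
    + intros x. simpl. rewrite Rmult_0_l, cos_0. ring.
  - rewrite (RInt_ext_all _ (fun x => / 2 + / 2 * cos (INR (2 * S k) * x))).
    + rewrite G by lia. exact hpi.
    + intros x. rewrite D, cos_2a_cos. field.
  - rewrite (RInt_ext_all _ (fun x => / 2 + (- / 2) * cos (INR (2 * S k) * x))).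
    + rewrite G by lia. exact hpi.
    + intros x. rewrite D, cos_2a_sin. field.
Qed.

Definition fourier_null (g : R -> R) : Prop :=
  (forall x, continuous g x) /\ forall p, RInt (fun x => g x * trig p x) 0 (2 * PI) = 0.

(** The product formulas write a trigonometric polynomial of degree one times a mode
    as a combination of modes, so the functions without Fourier coefficients are
    stable under multiplication by such polynomials. *)
Lemma fourier_null_step (g : R -> R) (A B C : R) :
  fourier_null g -> fourier_null (fun x => g x * (A + B * cos x + C * sin x)).
Proof.
  intros [cg hg].
  assert (ct : forall p x, continuous (fun x => g x * trig p x) x).
  { intros p x. apply (continuous_mult_R g (trig p)); [apply cg|apply continuous_trig]. }
  assert (comb : forall p cs,
    (forall x, (A + B * cos x + C * sin x) * trig p x = lsum (fun c => fst c * trig (snd c) x) cs) ->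
    RInt (fun x => g x * (A + B * cos x + C * sin x) * trig p x) 0 (2 * PI) = 0).
  { intros p cs h.
    rewrite (RInt_ext_all _ (fun x => lsum (fun c => fst c * (g x * trig (snd c) x)) cs)).
    - destruct (RInt_lsum (fun c x => fst c * (g x * trig (snd c) x)) cs 0 (2 * PI)) as [_ E].
      { intros i _ x. apply (continuous_scal_r (fst i) (fun x => g x * trig (snd i) x)). apply ct. }
      rewrite E. apply lsum_zero. intros c _.
      rewrite (RInt_scal_all (fst c) (fun x => g x * trig (snd c) x)) by apply ct.
      rewrite hg. ring.
    - intros x. rewrite Rmult_assoc, h, <- lsum_scal. apply lsum_ext. intros c _. ring. }
  split.
  - intros x. apply (continuous_mult_R g (fun x => A + B * cos x + C * sin x)); [apply cg|].
    apply (ex_derive_continuous (fun x => A + B * cos x + C * sin x)). auto_derive. exact I.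
  - assert (up : forall k x, INR (S (S k)) * x = INR (S k) * x + x) by (intros; rewrite !S_INR; ring).
    assert (down : forall k x, INR k * x = INR (S k) * x - x) by (intros; rewrite S_INR; ring).
    intros [[|k]|k].
    + apply (comb (inl 0%nat) ((A, inl 0%nat) :: (B, inl 1%nat) :: (C, inr 0%nat) :: nil)).
      intros x. unfold trig, freq. simpl. rewrite Rmult_0_l, Rmult_1_l, cos_0. ring.
    + destruct k as [|k].
      * apply (comb (inl 1%nat) ((A, inl 1%nat) :: (B / 2, inl 0%nat) :: (B / 2, inl 2%nat)
          :: (C / 2, inr 1%nat) :: nil)).
        intros x. unfold lsum, fst, snd, trig, freq. rewrite up, (down 0%nat x), cos_plus, cos_minus, sin_plus.
        simpl INR. rewrite Rmult_1_l. pose proof (sin2_cos2 x) as H. unfold Rsqr in H.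
        transitivity (A * cos x + B * (cos x * cos x) + C * (sin x * cos x)); [ring|field].
      * apply (comb (inl (S (S k))) ((A, inl (S (S k))) :: (B / 2, inl (S k)) :: (B / 2, inl (S (S (S k))))
          :: (C / 2, inr (S (S k))) :: (- C / 2, inr k) :: nil)).
        intros x. unfold lsum, fst, snd, trig, freq.
        rewrite (up (S k)), (down (S k) x), cos_plus, cos_minus, sin_plus, sin_minus. field.
    + destruct k as [|k].
      * apply (comb (inr 0%nat) ((A, inr 0%nat) :: (B / 2, inr 1%nat) :: (C / 2, inl 0%nat)
          :: (- C / 2, inl 2%nat) :: nil)).
        intros x. unfold lsum, fst, snd, trig, freq. rewrite up, (down 0%nat x), cos_plus, cos_minus, sin_plus.
        simpl INR. rewrite Rmult_1_l. field.
      * apply (comb (inr (S k)) ((A, inr (S k)) :: (B / 2, inr k) :: (B / 2, inr (S (S k)))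
          :: (C / 2, inl (S k)) :: (- C / 2, inl (S (S (S k)))) :: nil)).
        intros x. unfold lsum, fst, snd, trig, freq.
        rewrite (up (S k)), (down (S k) x), cos_plus, cos_minus, sin_plus, sin_minus. field.
Qed.

Lemma fourier_null_peak (f : R -> R) (x0 c : R) (n : nat) :
  fourier_null f -> fourier_null (fun x => f x * (1 - c + cos (x - x0)) ^ n).
Proof.
  intros hf. induction n as [|n IH].
  - destruct hf as [h1 h2]. split.
    + intros x. apply (continuous_ext f); [intros y; simpl; ring_R|apply h1].
    + intros p. refine (eq_trans _ (h2 p)). apply RInt_ext_all. intros x. simpl. ring.
  - destruct (fourier_null_step _ (1 - c) (cos x0) (sin x0) IH) as [h1 h2].
    assert (E : forall x, f x * (1 - c + cos (x - x0)) ^ n * (1 - c + cos x0 * cos x + sin x0 * sin x)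
                        = f x * (1 - c + cos (x - x0)) ^ S n).
    { intros x. replace (1 - c + cos x0 * cos x + sin x0 * sin x) with (1 - c + cos (x - x0))
        by (rewrite cos_minus; ring). simpl. ring. }
    split.
    + intros x. apply (continuous_ext _ _ _ E). apply h1.
    + intros p. refine (eq_trans _ (h2 p)). apply RInt_ext_all. intros x. now rewrite E.
Qed.

Lemma cos_le_off_peak (d u : R) : 0 <= d <= PI -> d <= Rabs u <= 2 * PI - d -> cos u <= cos d.
Proof.
  intros hd hu.
  rewrite <- (cos_Rabs u).
  destruct (Rle_dec (Rabs u) PI) as [h|h].
  - apply cos_decr_1; lra.
  - replace (cos (Rabs u)) with (cos (2 * PI - Rabs u)).
    + apply cos_decr_1; lra.
    + replace (2 * PI - Rabs u) with (- Rabs u + 2 * PI) by ring.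
      rewrite cos_plus_2PI. apply cos_neg.
Qed.

Lemma continuous_pos_nbhd (f : R -> R) (x : R) :
  continuous f x -> 0 < f x -> exists d, 0 < d /\ forall y, Rabs (y - x) <= d -> f x / 2 <= f y.
Proof.
  intros h hp. assert (he : 0 < f x / 2) by lra.
  destruct (proj1 (filterlim_locally f (f x)) h (mkposreal _ he)) as [d hd].
  exists (d / 2). pose proof (cond_pos d). split; [lra|].
  intros y hy. assert (B : ball x d y) by (change (Rabs (y - x) < d); lra).
  specialize (hd y B). change (Rabs (f y - f x) < f x / 2) in hd.
  apply Rabs_def2 in hd. lra.
Qed.

Lemma RInt_ge_const (f : R -> R) (a b m : R) :
  a <= b -> (forall x, continuous f x) -> (forall x, a < x < b -> m <= f x) -> m * (b - a) <= RInt f a b.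
Proof.
  intros ab hf h.
  replace (m * (b - a)) with (RInt (fun _ => m) a b).
  - apply RInt_le; [exact ab|apply ex_RInt_const|now apply ex_RInt_continuous_all|exact h].
  - rewrite RInt_const_R. ring_R.
Qed.

(** If [f x0 > 0], the powers of [1 - cos d + cos (x - x0)] are trigonometric
    polynomials that stay bounded away from [x0] and blow up around it, so that
    their integrals against [f] tend to infinity instead of vanishing. *)
Lemma fourier_null_nonpos (f : R -> R) (x0 : R) :
  fourier_null f -> 0 < x0 < 2 * PI -> f x0 <= 0.
Proof.
  intros hf hx. destruct (Rle_dec (f x0) 0) as [|hn]; [assumption|exfalso].
  assert (hp : 0 < f x0) by lra. destruct hf as [cf nf]. pose proof PI_RGT_0 as hpi.
  destruct (continuous_pos_nbhd f x0 (cf x0) hp) as [d0 [hd0 hf0]].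
  set (d := Rmin d0 (Rmin x0 (2 * PI - x0))).
  assert (hd : 0 < d /\ d <= d0 /\ d <= x0 /\ d <= 2 * PI - x0).
  { unfold d. split; [|split; [|split]].
    - repeat apply Rmin_pos; lra.
    - apply Rmin_l.
    - eapply Rle_trans; [apply Rmin_r|apply Rmin_l].
    - eapply Rle_trans; [apply Rmin_r|apply Rmin_r]. }
  assert (hdpi : d <= PI) by lra.
  destruct (continuity_ab_maj (fun x => Rabs (f x)) 0 (2 * PI)) as [xm [hM _]]; [lra| |].
  { intros x _. apply continuity_pt_filterlim, continuous_Rabs_comp, cf. }
  set (M := Rabs (f xm)) in *.
  assert (M0 : 0 <= M) by apply Rabs_pos.
  set (T := fun x => 1 - cos d + cos (x - x0)).
  set (eta := cos (d / 2) - cos d).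
  assert (heta : 0 < eta) by (unfold eta; assert (cos d < cos (d / 2)) by (apply cos_decreasing_1; lra); lra).
  assert (cT : forall n x, continuous (fun x => f x * T x ^ n) x).
  { intros n x. apply (continuous_mult_R f (fun x => T x ^ n)); [apply cf|].
    apply (ex_derive_continuous (fun x => T x ^ n)). unfold T. auto_derive. exact I. }
  assert (low : forall n x, 0 <= x <= 2 * PI -> - M <= f x * T x ^ n).
  { intros n x hx'. destruct (Rle_dec d (Rabs (x - x0))) as [h|h].
    - assert (HT : Rabs (T x ^ n) <= 1).
      { rewrite <- RPow_abs. rewrite <- (pow1 n). apply pow_incr. split; [apply Rabs_pos|].
        apply Rabs_le. unfold T.
        assert (cos (x - x0) <= cos d).
        { apply cos_le_off_peak; [lra|]. split; [exact h|].
          apply Rabs_le. lra. }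
        pose proof (COS_bound (x - x0)). pose proof (COS_bound d). lra. }
      assert (H : Rabs (f x * T x ^ n) <= M * 1).
      { rewrite Rabs_mult. apply Rmult_le_compat; try apply Rabs_pos; [now apply hM|exact HT]. }
      apply Rabs_le_between in H. lra.
    - assert (0 <= f x * T x ^ n); [|lra].
      assert (f x0 / 2 <= f x) by (apply hf0; lra).
      apply Rmult_le_pos; [lra|]. apply pow_le. unfold T.
      assert (cos d <= cos (x - x0)).
      { rewrite <- (cos_Rabs (x - x0)). pose proof (Rabs_pos (x - x0)). apply cos_decr_1; lra. }
      lra. }
  assert (mid : forall n x, x0 - d / 2 <= x <= x0 + d / 2 -> f x0 / 2 * (1 + INR n * eta) <= f x * T x ^ n).
  { intros n x hx'.
    assert (hab : Rabs (x - x0) <= d / 2) by (apply Rabs_le; lra).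
    assert (f x0 / 2 <= f x) by (apply hf0; lra).
    assert (1 + eta <= T x).
    { unfold T, eta. assert (cos (d / 2) <= cos (x - x0)); [|lra].
      rewrite <- (cos_Rabs (x - x0)). pose proof (Rabs_pos (x - x0)). apply cos_decr_1; lra. }
    assert (1 + INR n * eta <= T x ^ n).
    { apply Rle_trans with ((1 + eta) ^ n); [now apply poly|]. apply pow_incr. lra. }
    assert (0 <= INR n * eta) by (apply Rmult_le_pos; [apply pos_INR|lra]).
    apply Rmult_le_compat; lra. }
  assert (Z : forall n, RInt (fun x => f x * T x ^ n) 0 (2 * PI) = 0).
  { intros n. destruct (fourier_null_peak f x0 (cos d) n (conj cf nf)) as [_ h].
    refine (eq_trans _ (h (inl 0%nat))). apply RInt_ext_all. intros x.
    unfold trig, freq, T. simpl INR. rewrite Rmult_0_l, cos_0. ring. }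
  assert (K : forall n, d * (f x0 / 2 * (1 + INR n * eta)) <= M * (2 * PI)).
  { intros n. specialize (Z n).
    pose proof (RInt_Chasles (fun x => f x * T x ^ n) 0 (x0 - d / 2) (2 * PI)
      (ex_RInt_continuous_all _ _ _ (cT n)) (ex_RInt_continuous_all _ _ _ (cT n))) as C1.
    pose proof (RInt_Chasles (fun x => f x * T x ^ n) (x0 - d / 2) (x0 + d / 2) (2 * PI)
      (ex_RInt_continuous_all _ _ _ (cT n)) (ex_RInt_continuous_all _ _ _ (cT n))) as C2.
    unfold plus in C1, C2; simpl in C1, C2.
    pose proof (RInt_ge_const (fun x => f x * T x ^ n) 0 (x0 - d / 2) (- M) ltac:(lra) (cT n)
      ltac:(intros; apply low; lra)) as I1.
    pose proof (RInt_ge_const (fun x => f x * T x ^ n) (x0 - d / 2) (x0 + d / 2) (f x0 / 2 * (1 + INR n * eta))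
      ltac:(lra) (cT n) ltac:(intros; apply mid; lra)) as I2.
    pose proof (RInt_ge_const (fun x => f x * T x ^ n) (x0 + d / 2) (2 * PI) (- M) ltac:(lra) (cT n)
      ltac:(intros; apply low; lra)) as I3.
    nra. }
  destruct (INR_archimed (d * (f x0 / 2) * eta) (M * (2 * PI))) as [n hn'].
  { apply Rmult_lt_0_compat; [apply Rmult_lt_0_compat; lra|exact heta]. }
  specialize (K n). assert (0 < d * (f x0 / 2)) by (apply Rmult_lt_0_compat; lra). nra.
Qed.

Lemma fourier_complete (f : R -> R) (x : R) :
  fourier_null f -> 0 < x < 2 * PI -> f x = 0.
Proof.
  intros hf hx. apply Rle_antisym; [now apply fourier_null_nonpos|].
  assert (- f x <= 0); [|lra].
  apply (fourier_null_nonpos (fun x => - f x)); [|exact hx].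
  destruct hf as [h1 h2]. split.
  - intros y. apply (continuous_opp f), h1.
  - intros p. rewrite (RInt_ext_all _ (fun x => (-1) * (f x * trig p x))) by (intros; ring).
    rewrite (RInt_scal_all (-1) (fun x => f x * trig p x)); [rewrite h2; ring_R|].
    intros y. apply (continuous_mult_R f (trig p)); [apply h1|apply continuous_trig].
Qed.

(** * Functions of two variables and the radial equation *)

Definition continuous2 (f : R -> R -> R) (x y : R) : Prop :=
  continuous (fun z : R * R => f (fst z) (snd z)) (x, y).

Lemma continuous2_plus (f g : R -> R -> R) (x y : R) :
  continuous2 f x y -> continuous2 g x y -> continuous2 (fun x y => f x y + g x y) x y.
Proof. intros hf hg. exact (continuous_plus _ _ _ hf hg). Qed.

Lemma continuous2_mult (f g : R -> R -> R) (x y : R) :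
  continuous2 f x y -> continuous2 g x y -> continuous2 (fun x y => f x y * g x y) x y.
Proof. intros hf hg. exact (continuous_mult _ _ _ hf hg). Qed.

Lemma continuous2_opp (f : R -> R -> R) (x y : R) :
  continuous2 f x y -> continuous2 (fun x y => - f x y) x y.
Proof. intros hf. exact (continuous_opp _ _ hf). Qed.

Lemma continuous2_fst (f : R -> R) (x y : R) :
  continuous f x -> continuous2 (fun x _ => f x) x y.
Proof.
  intros hf. apply (continuous_comp (fun z : R * R => fst z) f); [apply continuous_fst|exact hf].
Qed.

Lemma continuous2_snd (f : R -> R) (x y : R) :
  continuous f y -> continuous2 (fun _ y => f y) x y.
Proof.
  intros hf. apply (continuous_comp (fun z : R * R => snd z) f); [apply continuous_snd|exact hf].
Qed.

Lemma continuous2_comp (g X Y : R -> R -> R) (x y : R) :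
  continuous2 X x y -> continuous2 Y x y -> continuous2 g (X x y) (Y x y) ->
  continuous2 (fun x y => g (X x y) (Y x y)) x y.
Proof.
  intros hX hY hg.
  exact (continuous_comp_2 (fun z : R * R => X (fst z) (snd z)) (fun z => Y (fst z) (snd z)) g (x, y) hX hY hg).
Qed.

Lemma continuous2_continuity_2d (f : R -> R -> R) (x y : R) :
  continuous2 f x y <-> continuity_2d_pt f x y.
Proof. symmetry. apply continuity_2d_pt_filterlim. Qed.

Lemma continuous2_slice (f : R -> R -> R) (x y : R) :
  continuous2 f x y -> continuous (fun y => f x y) y.
Proof.
  intros h.
  apply (continuous_comp_2 (fun _ : R => x) (fun y => y) f y);
    [apply continuous_const|apply continuous_id|exact h].
Qed.

(** Continuous first partial derivatives on an open set make [u] differentiable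
    there. *)
Lemma chain_2d (U : R -> R -> Prop) (u : R -> R -> R) (X Y : R -> R) (t X' Y' : R) :
  (forall x y, U x y -> locally_2d U x y) ->
  (forall x y, U x y -> ex_diff_n u 1 x y) ->
  U (X t) (Y t) -> is_derive X t X' -> is_derive Y t Y' ->
  is_derive (fun s => u (X s) (Y s)) t (d1 u (X t) (Y t) * X' + d2 u (X t) (Y t) * Y').
Proof.
  intros hU hu hP hX hY. apply is_derive_Reals.
  apply derivable_pt_lim_comp_2d; [|now apply is_derive_Reals|now apply is_derive_Reals].
  apply filterdiff_differentiable_pt_lim.
  apply (is_derive_filterdiff u (X t) (Y t) (d1 u) (d2 u (X t) (Y t))).
  - apply (filter_imp (fun z : R * R => U (fst z) (snd z))).
    + intros z hz. destruct (hu _ _ hz) as [_ [h _]]. apply Derive_correct. exact h.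
    + apply (proj1 (locally_2d_locally U (X t) (Y t))), hU, hP.
  - destruct (hu _ _ hP) as [_ [_ [h _]]]. apply Derive_correct. exact h.
  - destruct (hu _ _ hP) as [_ [_ [_ [h _]]]]. apply continuous2_continuity_2d, h.
Qed.

Lemma ex_diff_n_le (u : R -> R -> R) (x y : R) : ex_diff_n u 2 x y -> ex_diff_n u 1 x y.
Proof.
  intros [h0 [h1 [h2 [h3 h4]]]]. repeat split; try assumption; [apply h3|apply h4].
Qed.

Lemma RInt_param_derive (v vt : R -> R -> R) (m : R -> R) (T t : R) :
  0 < t < T ->
  (forall t al, 0 < t < T -> is_derive (fun s => v s al) t (vt t al)) ->
  (forall t al, 0 < t < T -> continuous2 v t al) ->
  (forall t al, 0 < t < T -> continuous2 vt t al) ->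
  (forall al, continuous m al) ->
  is_derive (fun s => RInt (fun al => v s al * m al) 0 (2 * PI)) t
    (RInt (fun al => vt t al * m al) 0 (2 * PI)).
Proof.
  intros ht hd hv hvt hm.
  assert (L := locally_open_interval 0 T t ht).
  assert (D : forall s al, 0 < s < T -> is_derive (fun z => v z al * m al) s (vt s al * m al)).
  { intros s al hs.
    replace (vt s al * m al) with (vt s al * m al + v s al * 0) by ring.
    apply (is_derive_mult_R (fun z => v z al) (fun _ => m al)); [now apply hd|].
    apply (is_derive_const (m al)). }
  rewrite (RInt_ext (fun al => vt t al * m al) (fun al => Derive (fun z => v z al * m al) t)).
  2:{ intros al _. symmetry. apply is_derive_unique. now apply D. }
  apply (is_derive_RInt_param (fun s al => v s al * m al)).
  - apply (filter_imp (fun s => 0 < s < T)); [|exact L].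
    intros s hs al _. eexists. now apply D.
  - intros al _. apply (continuity_2d_pt_ext_loc (fun s be => vt s be * m be)).
    + apply locally_2d_locally.
      apply (filter_imp (fun z : R * R => 0 < fst z < T)).
      * intros z hz. symmetry. apply is_derive_unique. now apply D.
      * exact (continuous_fst t al (fun s => 0 < s < T) L).
    + apply continuous2_continuity_2d, (continuous2_mult vt (fun _ be => m be)); [now apply hvt|].
      apply continuous2_snd, hm.
  - apply (filter_imp (fun s => 0 < s < T)); [|exact L].
    intros s hs. apply ex_RInt_continuous_all. intros al.
    apply (continuous_mult_R (fun al => v s al) m); [|apply hm].
    apply (continuous2_slice v). now apply hv.
Qed.

Lemma RInt_param_continuous (v : R -> R -> R) (m : R -> R) (t : R) :
  (forall t al, continuous2 v t al) -> (forall al, continuous m al) ->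
  continuous (fun s => RInt (fun al => v s al * m al) 0 (2 * PI)) t.
Proof.
  intros hv hm. pose proof PI_RGT_0 as hpi.
  assert (hc : forall s al, continuous2 (fun s al => v s al * m al) s al).
  { intros s al. apply (continuous2_mult v (fun _ be => m be)); [apply hv|apply continuous2_snd, hm]. }
  assert (hs : forall s al, continuous (fun al => v s al * m al) al).
  { intros s al. apply (continuous2_slice (fun s al => v s al * m al)). apply hc. }
  apply filterlim_locally. intros eps.
  assert (he : 0 < eps / (4 * PI)) by (apply Rdiv_lt_0_compat; [apply cond_pos|lra]).
  destruct (uniform_continuity_2d_1d (fun al s => v s al * m al) 0 (2 * PI) t) with (eps := mkposreal _ he) as [d hd].
  { intros al _. apply continuous2_continuity_2d.
    apply (continuous2_comp (fun s al => v s al * m al) (fun _ s => s) (fun al _ => al));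
      [apply continuous2_snd, continuous_id|apply continuous2_fst, continuous_id|apply hc]. }
  exists d. intros s hst. change (Rabs (s - t) < d) in hst.
  change (Rabs (RInt (fun al => v s al * m al) 0 (2 * PI) - RInt (fun al => v t al * m al) 0 (2 * PI)) < eps).
  rewrite <- (RInt_minus_all (fun al => v s al * m al) (fun al => v t al * m al)) by apply hs.
  apply Rle_lt_trans with (2 * PI * (eps / (4 * PI))).
  - replace (2 * PI) with (2 * PI - 0) at 2 by ring.
    apply (abs_RInt_le_const (fun al => v s al * m al - v t al * m al)); [lra| |].
    + apply ex_RInt_continuous_all. intros al.
      apply (continuous_minus (fun al => v s al * m al) (fun al => v t al * m al)); apply hs.
    + intros al hal. left. apply Rabs_def2 in hst. pose proof (cond_pos d).
      apply (hd al t al s); try lra. rewrite Rminus_diag, Rabs_R0. lra.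
  - replace (2 * PI * (eps / (4 * PI))) with (eps / 2) by (field; lra).
    pose proof (cond_pos eps). lra.
Qed.

Lemma continuous_zero_right_end (f : R -> R) (a b : R) :
  a < b -> continuous f b -> (forall t, a < t < b -> f t = 0) -> f b = 0.
Proof.
  intros ab hc h0. destruct (Req_dec (f b) 0) as [|hn]; [assumption|exfalso].
  assert (hp : 0 < Rabs (f b)) by now apply Rabs_pos_lt.
  destruct (proj1 (filterlim_locally f (f b)) hc (mkposreal _ hp)) as [d hd].
  pose proof (cond_pos d) as dp.
  set (t := Rmax ((a + b) / 2) (b - d / 2)).
  assert (ht : a < t < b /\ b - t < d).
  { unfold t, Rmax. destruct Rle_dec; lra. }
  specialize (hd t). change (Rabs (t - b) < d -> Rabs (f t - f b) < Rabs (f b)) in hd.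
  rewrite h0 in hd by lra. rewrite Rminus_0_l, Rabs_Ropp in hd.
  assert (Rabs (f b) < Rabs (f b)); [apply hd|lra].
  rewrite Rabs_minus_sym, Rabs_pos_eq; lra.
Qed.

Lemma continuous_zero_left_end (f : R -> R) (a b : R) :
  a < b -> continuous f a -> (forall t, a < t < b -> f t = 0) -> f a = 0.
Proof.
  intros ab hc h0.
  replace (f a) with (f (- - a)) by (f_equal; ring).
  apply (continuous_zero_right_end (fun t => f (- t)) (- b) (- a)); [lra| |intros; apply h0; lra].
  apply (continuous_comp (fun t => - t) f).
  - apply (ex_derive_continuous (fun t => - t)). auto_derive. exact I.
  - replace (- - a) with a by ring. exact hc.
Qed.

(** The Wronskian of [y] and [phi] is constant and tends to 0 at the left end,
    because [z = y'] stays bounded there.  So [(y, z)] is parallel to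
    [(phi, psi)], and the factor of proportionality has derivative 0. *)
Lemma radial_multiple (T : R) (q y z phi psi : R -> R) :
  0 < T -> (forall t, continuous q t) ->
  (forall t, continuous y t) -> y 0 = 0 -> y T = 0 ->
  (forall t, 0 < t < T -> is_derive y t (z t)) ->
  (forall t, 0 < t < T -> is_derive z t (- (q t * y t))) ->
  (forall t, continuous phi t) -> (forall t, continuous psi t) -> phi 0 = 0 ->
  (forall t, 0 < t < T -> is_derive phi t (psi t)) ->
  (forall t, 0 < t < T -> is_derive psi t (- (q t * phi t))) ->
  (forall t, 0 < phi t ^ 2 + psi t ^ 2) ->
  exists c, (forall t, 0 <= t <= T -> y t = c * phi t) /\ (phi T <> 0 -> c = 0).
Proof.
  intros hT cq cy y0 yT dy dz cphi cpsi phi0 dphi dpsi hN.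
  assert (cz : forall t, 0 < t < T -> continuous z t).
  { intros t ht. apply (ex_derive_continuous z). eexists. now apply dz. }
  set (W := fun t => y t * psi t - z t * phi t).
  assert (dW : forall t, 0 < t < T -> is_derive W t 0).
  { intros t ht.
    replace 0 with ((z t * psi t + y t * (- (q t * phi t))) - (- (q t * y t) * phi t + z t * psi t)) by ring.
    apply (is_derive_minus (fun t => y t * psi t) (fun t => z t * phi t)); apply is_derive_mult_R; auto. }
  destruct (continuity_ab_maj (fun t => Rabs (q t * y t)) 0 T) as [xm [hM _]]; [lra| |].
  { intros x _. apply continuity_pt_filterlim, (continuous_Rabs_comp (fun t => q t * y t)).
    now apply (continuous_mult_R q y). }
  set (M := Rabs (q xm * y xm)) in *.
  assert (M0 : 0 <= M) by apply Rabs_pos.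
  set (B := Rabs (z (T / 2)) + M * T).
  assert (zB : forall s, 0 < s < T / 2 -> Rabs (z s) <= B).
  { intros s hs.
    destruct (mean_value_open z (fun t => - (q t * y t)) s (T / 2)) as [c [hc E]]; [lra| | |].
    - intros x hx. apply dz. lra.
    - intros x hx. apply cz. lra.
    - replace (z s) with (z (T / 2) + (q c * y c) * (T / 2 - s)) by lra.
      eapply Rle_trans; [apply Rabs_triang|]. apply Rplus_le_compat_l.
      rewrite Rabs_mult. apply Rmult_le_compat; try apply Rabs_pos; [apply hM; lra|].
      rewrite Rabs_pos_eq; lra. }
  assert (W0 : forall t, 0 < t < T -> W t = 0).
  { intros t ht. destruct (Req_dec (W t) 0) as [|hn]; [assumption|exfalso].
    set (g := fun s => Rabs (y s * psi s) + B * Rabs (phi s)).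
    assert (cg : continuous g 0).
    { apply (continuous_plus (fun s => Rabs (y s * psi s)) (fun s => B * Rabs (phi s))).
      - apply (continuous_Rabs_comp (fun s => y s * psi s)). now apply (continuous_mult_R y psi).
      - apply (continuous_scal_r B (fun s => Rabs (phi s))).
        apply continuous_Rabs_comp, cphi. }
    assert (g0 : g 0 = 0) by (unfold g; rewrite y0, phi0, Rmult_0_l, Rabs_R0; ring).
    assert (hp : 0 < Rabs (W t)) by now apply Rabs_pos_lt.
    destruct (proj1 (filterlim_locally g (g 0)) cg (mkposreal _ hp)) as [d hd].
    pose proof (cond_pos d) as dp.
    set (s := Rmin (d / 2) (Rmin (t / 2) (T / 4))).
    assert (hs : 0 < s /\ s < d /\ s <= t /\ s < T / 2).
    { unfold s. split; [repeat apply Rmin_pos; lra|].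
      pose proof (Rmin_l (d / 2) (Rmin (t / 2) (T / 4))).
      pose proof (Rmin_r (d / 2) (Rmin (t / 2) (T / 4))).
      pose proof (Rmin_l (t / 2) (T / 4)). pose proof (Rmin_r (t / 2) (T / 4)). lra. }
    specialize (hd s). change (Rabs (s - 0) < d -> Rabs (g s - g 0) < Rabs (W t)) in hd.
    rewrite g0, !Rminus_0_r, Rabs_pos_eq in hd by lra.
    assert (gs : 0 <= g s).
    { unfold g. pose proof (Rabs_pos (y s * psi s)). pose proof (Rabs_pos (phi s)).
      assert (0 <= B * Rabs (phi s)); [|lra]. apply Rmult_le_pos; [|assumption].
      unfold B. pose proof (Rabs_pos (z (T / 2))). assert (0 <= M * T) by (apply Rmult_le_pos; lra). lra. }
    rewrite Rabs_pos_eq in hd by exact gs.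
    assert (Rabs (W t) <= g s); [|specialize (hd ltac:(lra)); lra].
    rewrite <- (zero_derive_const W 0 T s t dW) by lra. unfold W, g. eapply Rle_trans; [apply Rabs_triang|].
    apply Rplus_le_compat_l. rewrite Rabs_Ropp, Rabs_mult.
    apply Rmult_le_compat_r; [apply Rabs_pos|]. apply zB. lra. }
  set (N := fun t => phi t ^ 2 + psi t ^ 2).
  set (k := fun t => (y t * phi t + z t * psi t) / N t).
  assert (dk : forall t, 0 < t < T -> is_derive k t 0).
  { intros t ht.
    assert (Hn : is_derive (fun t => y t * phi t + z t * psi t) t
       ((z t * phi t + y t * psi t) + (- (q t * y t) * psi t + z t * (- (q t * phi t))))).
    { apply (is_derive_plus (fun t => y t * phi t) (fun t => z t * psi t)); apply is_derive_mult_R; auto. }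
    assert (Hd : is_derive N t (2 * phi t * psi t + 2 * psi t * (- (q t * phi t)))).
    { apply (is_derive_ext (fun t => phi t * phi t + psi t * psi t)); [intros x; unfold N; ring_R|].
      replace (2 * phi t * psi t + 2 * psi t * (- (q t * phi t)))
        with ((psi t * phi t + phi t * psi t) + (- (q t * phi t) * psi t + psi t * (- (q t * phi t)))) by ring.
      apply (is_derive_plus (fun t => phi t * phi t) (fun t => psi t * psi t)); apply is_derive_mult_R; auto. }
    pose proof (is_derive_div _ _ t _ _ Hn Hd) as H.
    assert (Nn : N t <> 0) by (specialize (hN t); unfold N; lra).
    specialize (H Nn).
    assert (E : 0 = (((z t * phi t + y t * psi t) + (- (q t * y t) * psi t + z t * (- (q t * phi t)))) * N t
       - (y t * phi t + z t * psi t) * (2 * phi t * psi t + 2 * psi t * (- (q t * phi t)))) / N t ^ 2).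
    { replace (((z t * phi t + y t * psi t) + (- (q t * y t) * psi t + z t * (- (q t * phi t)))) * N t
       - (y t * phi t + z t * psi t) * (2 * phi t * psi t + 2 * psi t * (- (q t * phi t))))
       with ((1 - q t) * (psi t ^ 2 - phi t ^ 2) * W t) by (unfold N, W; ring).
      rewrite W0 by exact ht. field. exact Nn. }
    rewrite E. exact H. }
  assert (kc : forall t, 0 < t < T -> k t = k (T / 2)).
  { intros t ht. apply (zero_derive_const k 0 T t (T / 2) dk); lra. }
  assert (yk : forall t, 0 < t < T -> y t - k (T / 2) * phi t = 0).
  { intros t ht. rewrite <- (kc t ht). unfold k.
    assert (Nn : N t <> 0) by (specialize (hN t); unfold N; lra).
    replace (y t - (y t * phi t + z t * psi t) / N t * phi t) with (psi t * W t / N t)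
      by (unfold W; unfold N in *; field; exact Nn).
    rewrite W0 by exact ht. field. exact Nn. }
  assert (cyk : forall t, continuous (fun t => y t - k (T / 2) * phi t) t).
  { intros t. apply (continuous_minus y (fun t => k (T / 2) * phi t)); [apply cy|].
    apply (continuous_scal_r (k (T / 2)) phi). apply cphi. }
  assert (eT : y T - k (T / 2) * phi T = 0).
  { apply (continuous_zero_right_end (fun t => y t - k (T / 2) * phi t) 0 T); auto. }
  exists (k (T / 2)). split.
  - intros t ht. destruct (Req_dec t 0) as [->|]; [rewrite y0, phi0; ring|].
    destruct (Req_dec t T) as [->|]; [lra|]. specialize (yk t). lra.
  - intros hph. rewrite yT in eT.
    assert (k (T / 2) * phi T = 0) as E by lra. apply Rmult_integral in E. tauto.
Qed.

(** * The annulus in logarithmic polar coordinates *)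

(** Polar coordinates with logarithmic radius: they are conformal, so the Laplacian
    becomes [rad ^ -2] times the flat one. *)
Definition rad (R1 t : R) : R := R1 * exp (- t).
Definition pol_x (c R1 t al : R) : R := c + rad R1 t * cos al.
Definition pol_y (c R1 t al : R) : R := c + rad R1 t * sin al.

Lemma is_derive_rad (R1 t : R) : is_derive (rad R1) t (- rad R1 t).
Proof. unfold rad. auto_derive; [exact I|ring]. Qed.

Lemma continuous_rad (R1 t : R) : continuous (rad R1) t.
Proof. apply (ex_derive_continuous (rad R1)). eexists. apply is_derive_rad. Qed.

Lemma is_derive_pol_x_t (c R1 t al : R) : is_derive (fun s => pol_x c R1 s al) t (- (rad R1 t * cos al)).
Proof. unfold pol_x, rad. auto_derive; [exact I|ring]. Qed.

Lemma is_derive_pol_y_t (c R1 t al : R) : is_derive (fun s => pol_y c R1 s al) t (- (rad R1 t * sin al)).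
Proof. unfold pol_y, rad. auto_derive; [exact I|ring]. Qed.

Lemma is_derive_pol_x_al (c R1 t al : R) : is_derive (pol_x c R1 t) al (- (rad R1 t * sin al)).
Proof. unfold pol_x. auto_derive; [exact I|ring]. Qed.

Lemma is_derive_pol_y_al (c R1 t al : R) : is_derive (pol_y c R1 t) al (rad R1 t * cos al).
Proof. unfold pol_y. auto_derive; [exact I|ring]. Qed.

Lemma continuous2_rad_cos (R1 t al : R) : continuous2 (fun t al => rad R1 t * cos al) t al.
Proof.
  apply (continuous2_mult (fun t _ => rad R1 t) (fun _ al => cos al)).
  - apply continuous2_fst, continuous_rad.
  - apply continuous2_snd, continuous_cos.
Qed.

Lemma continuous2_rad_sin (R1 t al : R) : continuous2 (fun t al => rad R1 t * sin al) t al.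
Proof.
  apply (continuous2_mult (fun t _ => rad R1 t) (fun _ al => sin al)).
  - apply continuous2_fst, continuous_rad.
  - apply continuous2_snd, continuous_sin.
Qed.

Lemma continuous2_pol (g : R -> R -> R) (c1 c2 R1 t al : R) :
  continuous2 g (pol_x c1 R1 t al) (pol_y c2 R1 t al) ->
  continuous2 (fun t al => g (pol_x c1 R1 t al) (pol_y c2 R1 t al)) t al.
Proof.
  intros h. apply (continuous2_comp g (pol_x c1 R1) (pol_y c2 R1)); [| |exact h].
  - apply (continuous2_plus (fun _ _ => c1) (fun t al => rad R1 t * cos al)).
    + apply (continuous2_fst (fun _ => c1)), continuous_const.
    + apply continuous2_rad_cos.
  - apply (continuous2_plus (fun _ _ => c2) (fun t al => rad R1 t * sin al)).
    + apply (continuous2_fst (fun _ => c2)), continuous_const.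
    + apply continuous2_rad_sin.
Qed.

Lemma dist_euc_polar (c1 c2 r al : R) :
  0 <= r -> dist_euc c1 c2 (c1 + r * cos al) (c2 + r * sin al) = r.
Proof.
  intros hr. unfold dist_euc.
  replace (Rsqr (c1 - (c1 + r * cos al)) + Rsqr (c2 - (c2 + r * sin al))) with (Rsqr r).
  - now apply sqrt_Rsqr.
  - pose proof (sin2_cos2 al) as H. unfold Rsqr in *.
    transitivity (r * r * (sin al * sin al + cos al * cos al)); [rewrite H; ring|ring].
Qed.

Lemma polar_angle (c1 c2 x y r : R) :
  0 < r -> dist_euc c1 c2 x y = r ->
  exists al, 0 <= al <= 2 * PI /\ x = c1 + r * cos al /\ y = c2 + r * sin al.
Proof.
  intros hr hd. unfold dist_euc in hd.
  set (X := (x - c1) / r). set (Y := (y - c2) / r).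
  assert (E : X * X + Y * Y = 1).
  { assert (H : Rsqr (c1 - x) + Rsqr (c2 - y) = r * r).
    { rewrite <- hd. symmetry. apply sqrt_sqrt. apply Rplus_le_le_0_compat; apply Rle_0_sqr. }
    unfold Rsqr in H. unfold X, Y.
    replace ((x - c1) / r * ((x - c1) / r) + (y - c2) / r * ((y - c2) / r))
      with (((c1 - x) * (c1 - x) + (c2 - y) * (c2 - y)) / (r * r)) by (field; lra).
    rewrite H. field. lra. }
  assert (hX : -1 <= X <= 1) by nra.
  assert (hs : sin (acos X) = Rabs Y).
  { rewrite sin_acos by exact hX. replace (1 - Rsqr X) with (Rsqr Y) by (unfold Rsqr; lra).
    apply sqrt_Rsqr_abs. }
  pose proof (acos_bound X) as hb. pose proof PI_RGT_0.
  destruct (Rle_dec 0 Y) as [h|h].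
  - exists (acos X). rewrite cos_acos, hs, Rabs_pos_eq by assumption.
    split; [lra|]. split; [unfold X|unfold Y]; field; lra.
  - exists (2 * PI - acos X).
    assert (ec : cos (2 * PI - acos X) = X).
    { replace (2 * PI - acos X) with (- acos X + 2 * PI) by ring.
      rewrite cos_plus_2PI, cos_neg. now apply cos_acos. }
    assert (es : sin (2 * PI - acos X) = Y).
    { replace (2 * PI - acos X) with (- acos X + 2 * PI) by ring.
      rewrite sin_plus_2PI, sin_neg, hs, Rabs_left; lra. }
    rewrite ec, es. split; [lra|]. split; [unfold X|unfold Y]; field; lra.
Qed.

Lemma continuous2_dist (c1 c2 x y : R) : continuous2 (dist_euc c1 c2) x y.
Proof.
  unfold dist_euc, Rsqr.
  apply (continuous_comp (fun z : R * R => (c1 - fst z) * (c1 - fst z) + (c2 - snd z) * (c2 - snd z)) sqrt).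
  - assert (h1 : continuous2 (fun x _ => c1 - x) x y).
    { apply (continuous2_fst (fun x => c1 - x)).
      apply (ex_derive_continuous (fun x => c1 - x)). auto_derive. exact I. }
    assert (h2 : continuous2 (fun _ y => c2 - y) x y).
    { apply (continuous2_snd (fun y => c2 - y)).
      apply (ex_derive_continuous (fun x => c2 - x)). auto_derive. exact I. }
    apply (continuous2_plus (fun x y => (c1 - x) * (c1 - x)) (fun x y => (c2 - y) * (c2 - y))).
    + now apply (continuous2_mult (fun x _ => c1 - x) (fun x _ => c1 - x)).
    + now apply (continuous2_mult (fun _ y => c2 - y) (fun _ y => c2 - y)).
  - apply continuity_pt_filterlim, continuity_pt_sqrt.
    apply Rplus_le_le_0_compat; apply Rle_0_sqr.
Qed.

Lemma locally_dist_gt (c1 c2 x y m : R) :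
  m < dist_euc c1 c2 x y -> locally (x, y) (fun z : R * R => m < dist_euc c1 c2 (fst z) (snd z)).
Proof. intros h. exact (continuous2_dist c1 c2 x y (fun d => m < d) (open_gt m _ h)). Qed.

Lemma locally_dist_lt (c1 c2 x y m : R) :
  dist_euc c1 c2 x y < m -> locally (x, y) (fun z : R * R => dist_euc c1 c2 (fst z) (snd z) < m).
Proof. intros h. exact (continuous2_dist c1 c2 x y (fun d => d < m) (open_lt m _ h)). Qed.

Lemma open_annulus_locally (c1 c2 R1 R2 x y : R) :
  open_annulus c1 c2 R1 R2 x y -> locally_2d (open_annulus c1 c2 R1 R2) x y.
Proof.
  intros [h1 h2]. apply locally_2d_locally. unfold open_annulus.
  apply filter_and; [now apply locally_dist_gt|now apply locally_dist_lt].
Qed.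

Definition extend_by_zero (K : R -> R -> Prop) (u : R -> R -> R) (x y : R) : R :=
  if excluded_middle_informative (K x y) then u x y else 0.

(** A solution vanishes on the boundary circles, so its extension by zero is
    continuous on the plane.  This turns the boundary condition of the Fourier
    coefficients into plain continuity. *)
Lemma extend_by_zero_continuous (c1 c2 R1 R2 mu : R) (u : R -> R -> R) (x y : R) :
  dirichlet_solution (open_annulus c1 c2 R1 R2) (closed_annulus c1 c2 R1 R2) laplacian mu u ->
  continuous2 (extend_by_zero (closed_annulus c1 c2 R1 R2) u) x y.
Proof.
  intros [hc [_ [hz _]]]. unfold continuous2.
  set (e := extend_by_zero (closed_annulus c1 c2 R1 R2) u).
  apply filterlim_locally. intros eps. simpl fst. simpl snd.
  change (locally (x, y) (fun z : R * R => Rabs (e (fst z) (snd z) - e x y) < eps)).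
  pose proof (cond_pos eps) as he.
  destruct (classic (closed_annulus c1 c2 R1 R2 x y)) as [hK|hK].
  - assert (exy : e x y = u x y).
    { unfold e, extend_by_zero. destruct excluded_middle_informative; [reflexivity|contradiction]. }
    pose proof (proj1 (filterlim_locally _ _) (hc (x, y) hK) eps) as H.
    unfold within in H. simpl fst in H. simpl snd in H.
    destruct (classic (open_annulus c1 c2 R1 R2 x y)) as [hU|hU].
    + pose proof (proj1 (locally_2d_locally _ _ _) (open_annulus_locally _ _ _ _ _ _ hU)) as H1.
      apply (filter_imp _ _) with (2 := filter_and _ _ H H1).
      intros [x' y'] [h1 [h2 h3]]. simpl in *. rewrite exy. unfold e, extend_by_zero.
      assert (hK' : closed_annulus c1 c2 R1 R2 x' y') by (unfold closed_annulus; lra).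
      destruct excluded_middle_informative; [|contradiction]. now apply h1.
    + rewrite exy, hz by assumption. rewrite hz in H by assumption.
      apply (filter_imp _ _) with (2 := H). intros [x' y'] h1. simpl in *.
      unfold e, extend_by_zero. destruct excluded_middle_informative as [hK'|_].
      * now apply h1.
      * rewrite Rminus_diag, Rabs_R0. exact he.
  - assert (exy : e x y = 0).
    { unfold e, extend_by_zero. destruct excluded_middle_informative; [contradiction|reflexivity]. }
    assert (H : locally (x, y) (fun z : R * R => ~ closed_annulus c1 c2 R1 R2 (fst z) (snd z))).
    { unfold closed_annulus in *. destruct (Rlt_dec (dist_euc c1 c2 x y) R2) as [h|h].
      - apply (filter_imp (fun z : R * R => dist_euc c1 c2 (fst z) (snd z) < R2)); [intros; lra|].
        now apply locally_dist_lt.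
      - apply (filter_imp (fun z : R * R => R1 < dist_euc c1 c2 (fst z) (snd z))); [intros; lra|].
        apply locally_dist_gt. lra. }
    apply (filter_imp _ _) with (2 := H). intros [x' y'] h1. simpl in *. rewrite exy.
    unfold e, extend_by_zero. destruct excluded_middle_informative; [contradiction|].
    rewrite Rminus_diag, Rabs_R0. exact he.
Qed.

Lemma rad_between (R1 R2 t : R) : 0 < R2 < R1 -> 0 < t < ln (R1 / R2) -> R2 < rad R1 t < R1.
Proof.
  intros hR ht. unfold rad. split.
  - assert (exp t < R1 / R2).
    { rewrite <- (exp_ln (R1 / R2)); [apply exp_increasing, ht|apply Rdiv_lt_0_compat; lra]. }
    rewrite exp_Ropp. pose proof (exp_pos t) as hp.
    apply (Rmult_lt_reg_r (exp t)); [exact hp|].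
    replace (R1 * / exp t * exp t) with (R1 / R2 * R2) by (field; lra).
    rewrite (Rmult_comm R2). apply Rmult_lt_compat_r; lra.
  - rewrite <- (Rmult_1_r R1) at 2. apply Rmult_lt_compat_l; [lra|].
    rewrite <- exp_0. apply exp_increasing. lra.
Qed.

Lemma pol_open (c1 c2 R1 R2 t al : R) : 0 < R2 < R1 -> 0 < t < ln (R1 / R2) ->
  open_annulus c1 c2 R1 R2 (pol_x c1 R1 t al) (pol_y c2 R1 t al).
Proof.
  intros hR ht. pose proof (rad_between R1 R2 t hR ht) as H. unfold open_annulus, pol_x, pol_y.
  rewrite dist_euc_polar; lra.
Qed.

Definition log_polar (c1 c2 R1 R2 : R) (u : R -> R -> R) (t al : R) : R :=
  extend_by_zero (closed_annulus c1 c2 R1 R2) u (pol_x c1 R1 t al) (pol_y c2 R1 t al).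

Lemma log_polar_inside (c1 c2 R1 R2 : R) (u : R -> R -> R) (t al : R) :
  0 < R2 < R1 -> 0 < t < ln (R1 / R2) ->
  log_polar c1 c2 R1 R2 u t al = u (pol_x c1 R1 t al) (pol_y c2 R1 t al).
Proof.
  intros hR ht. unfold log_polar, extend_by_zero.
  destruct excluded_middle_informative as [|h]; [reflexivity|].
  exfalso. apply h. pose proof (pol_open c1 c2 R1 R2 t al hR ht) as H. unfold open_annulus in H.
  unfold closed_annulus. lra.
Qed.

Lemma log_polar_boundary (c1 c2 R1 R2 mu : R) (u : R -> R -> R) (t al : R) :
  0 < R2 < R1 ->
  dirichlet_solution (open_annulus c1 c2 R1 R2) (closed_annulus c1 c2 R1 R2) laplacian mu u ->
  rad R1 t = R1 \/ rad R1 t = R2 -> log_polar c1 c2 R1 R2 u t al = 0.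
Proof.
  intros hR [_ [_ [hz _]]] hr. unfold log_polar, extend_by_zero.
  destruct excluded_middle_informative as [h|]; [|reflexivity].
  apply hz; [exact h|]. unfold open_annulus, pol_x, pol_y.
  rewrite dist_euc_polar by (destruct hr; lra). destruct hr; lra.
Qed.

Definition coefficient (c1 c2 R1 R2 : R) (u : R -> R -> R) (p : nat + nat) (t : R) : R :=
  RInt (fun al => log_polar c1 c2 R1 R2 u t al * trig p al) 0 (2 * PI).

Lemma log_polar_continuous (c1 c2 R1 R2 mu : R) (u : R -> R -> R) (t al : R) :
  dirichlet_solution (open_annulus c1 c2 R1 R2) (closed_annulus c1 c2 R1 R2) laplacian mu u ->
  continuous2 (log_polar c1 c2 R1 R2 u) t al.
Proof.
  intros h. apply (continuous2_pol (extend_by_zero (closed_annulus c1 c2 R1 R2) u)).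
  now apply (extend_by_zero_continuous c1 c2 R1 R2 mu).
Qed.

Lemma rad_ends (R1 R2 : R) : 0 < R2 < R1 -> rad R1 0 = R1 /\ rad R1 (ln (R1 / R2)) = R2.
Proof.
  intros hR. unfold rad. split.
  - rewrite Ropp_0, exp_0. ring.
  - rewrite exp_Ropp, exp_ln by (apply Rdiv_lt_0_compat; lra). field. lra.
Qed.

(** Multiplying by [trig p] and integrating over the circle turns the angular
    second derivative into [- freq p ^ 2]. *)
Lemma coefficient_equation (c1 c2 R1 R2 mu : R) (u : R -> R -> R) (p : nat + nat) :
  0 < R2 < R1 ->
  dirichlet_solution (open_annulus c1 c2 R1 R2) (closed_annulus c1 c2 R1 R2) laplacian mu u ->
  let y := coefficient c1 c2 R1 R2 u p in
  (forall t, continuous y t) /\ y 0 = 0 /\ y (ln (R1 / R2)) = 0 /\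
  exists z, (forall t, 0 < t < ln (R1 / R2) -> is_derive y t (z t)) /\
    forall t, 0 < t < ln (R1 / R2) -> is_derive z t (- ((mu * rad R1 t ^ 2 - freq p ^ 2) * y t)).
Proof.
  intros hR hu y. set (T := ln (R1 / R2)).
  destruct (rad_ends R1 R2 hR) as [r0 rT].
  assert (bd : forall t, rad R1 t = R1 \/ rad R1 t = R2 -> y t = 0).
  { intros t ht. unfold y, coefficient.
    rewrite (RInt_ext_all _ (fun _ => 0)).
    - rewrite RInt_const_R. ring_R.
    - intros al. rewrite (log_polar_boundary c1 c2 R1 R2 mu u); [ring|exact hR|exact hu|exact ht]. }
  split; [|split; [apply bd; now left|split; [apply bd; now right|]]].
  { intros t. apply (RInt_param_continuous (log_polar c1 c2 R1 R2 u) (trig p)).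
    - intros s al. now apply (log_polar_continuous c1 c2 R1 R2 mu).
    - intros al. apply continuous_trig. }
  set (v := log_polar c1 c2 R1 R2 u).
  destruct hu as [hc [hd [hz he]]].
  set (U := open_annulus c1 c2 R1 R2) in *.
  assert (hUl := open_annulus_locally c1 c2 R1 R2). fold U in hUl.
  assert (hU : forall t al, 0 < t < T -> U (pol_x c1 R1 t al) (pol_y c2 R1 t al))
    by (intros; now apply pol_open).
  set (P := fun (g : R -> R -> R) t al => g (pol_x c1 R1 t al) (pol_y c2 R1 t al)).
  assert (hd1 : forall x y, U x y -> ex_diff_n u 1 x y) by (intros; now apply ex_diff_n_le, hd).
  assert (hdx : forall x y, U x y -> ex_diff_n (d1 u) 1 x y) by (intros ? ? h; apply hd in h; apply h).
  assert (hdy : forall x y, U x y -> ex_diff_n (d2 u) 1 x y) by (intros ? ? h; apply hd in h; apply h).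
  assert (dt : forall g, (forall x y, U x y -> ex_diff_n g 1 x y) -> forall t al, 0 < t < T ->
    is_derive (fun s => P g s al) t (P (d1 g) t al * - (rad R1 t * cos al) + P (d2 g) t al * - (rad R1 t * sin al))).
  { intros g hg t al ht.
    apply (chain_2d U g (fun s => pol_x c1 R1 s al) (fun s => pol_y c2 R1 s al)); try assumption.
    - now apply hU.
    - apply is_derive_pol_x_t.
    - apply is_derive_pol_y_t. }
  assert (da : forall g, (forall x y, U x y -> ex_diff_n g 1 x y) -> forall t al, 0 < t < T ->
    is_derive (P g t) al (P (d1 g) t al * - (rad R1 t * sin al) + P (d2 g) t al * (rad R1 t * cos al))).
  { intros g hg t al ht.
    apply (chain_2d U g (pol_x c1 R1 t) (pol_y c2 R1 t)); try assumption.
    - now apply hU.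
    - apply is_derive_pol_x_al.
    - apply is_derive_pol_y_al. }
  assert (cP : forall g t al, 0 < t < T -> (forall x y, U x y -> continuity_2d_pt g x y) -> continuous2 (P g) t al).
  { intros g t al ht hg. apply continuous2_pol, continuous2_continuity_2d, hg. now apply hU. }
  assert (C1 : forall g, (forall x y, U x y -> ex_diff_n g 1 x y) ->
    (forall x y, U x y -> continuity_2d_pt (d1 g) x y) /\ (forall x y, U x y -> continuity_2d_pt (d2 g) x y)).
  { intros g hg. split; intros ? ? h; apply hg in h; apply h. }
  destruct (C1 u hd1) as [c11 c12].
  destruct (C1 (d1 u) hdx) as [cxx cxy].
  destruct (C1 (d2 u) hdy) as [cyx cyy].
  pose (rc := fun t al => rad R1 t * cos al). pose (rs := fun t al => rad R1 t * sin al).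
  assert (crc : forall t al, continuous2 rc t al) by (intros; apply continuous2_rad_cos).
  assert (crs : forall t al, continuous2 rs t al) by (intros; apply continuous2_rad_sin).
  pose (vt := fun t al => P (d1 u) t al * - rc t al + P (d2 u) t al * - rs t al).
  pose (va := fun t al => P (d1 u) t al * - rs t al + P (d2 u) t al * rc t al).
  pose (D1t := fun g t al => P (d1 g) t al * - rc t al + P (d2 g) t al * - rs t al).
  pose (D1a := fun g t al => P (d1 g) t al * - rs t al + P (d2 g) t al * rc t al).
  pose (vtt := fun t al => (D1t (d1 u) t al * - rc t al + P (d1 u) t al * rc t al)
                         + (D1t (d2 u) t al * - rs t al + P (d2 u) t al * rs t al)).
  pose (vaa := fun t al => (D1a (d1 u) t al * - rs t al + P (d1 u) t al * - rc t al)
                         + (D1a (d2 u) t al * rc t al + P (d2 u) t al * - rs t al)).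
  assert (cD : forall g h1 h2 t al, 0 < t < T -> (forall x y, U x y -> continuity_2d_pt (d1 g) x y) ->
    (forall x y, U x y -> continuity_2d_pt (d2 g) x y) ->
    continuous2 h1 t al -> continuous2 h2 t al ->
    continuous2 (fun t al => P (d1 g) t al * h1 t al + P (d2 g) t al * h2 t al) t al).
  { intros g h1 h2 t al ht hx hy k1 k2.
    apply (continuous2_plus (fun t al => P (d1 g) t al * h1 t al) (fun t al => P (d2 g) t al * h2 t al)).
    - apply (continuous2_mult (P (d1 g)) h1); [now apply cP|exact k1].
    - apply (continuous2_mult (P (d2 g)) h2); [now apply cP|exact k2]. }
  assert (crc' : forall t al, continuous2 (fun t al => - rc t al) t al) by (intros; now apply continuous2_opp).
  assert (crs' : forall t al, continuous2 (fun t al => - rs t al) t al) by (intros; now apply continuous2_opp).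
  assert (cvt : forall t al, 0 < t < T -> continuous2 vt t al) by (intros; now apply cD).
  assert (cva : forall t al, 0 < t < T -> continuous2 va t al).
  { intros; apply (cD u (fun t al => - rs t al) rc); auto. }
  assert (cvtt : forall t al, 0 < t < T -> continuous2 vtt t al).
  { intros t al ht.
    apply (continuous2_plus (fun t al => D1t (d1 u) t al * - rc t al + P (d1 u) t al * rc t al)
        (fun t al => D1t (d2 u) t al * - rs t al + P (d2 u) t al * rs t al)).
    - apply (continuous2_plus (fun t al => D1t (d1 u) t al * - rc t al) (fun t al => P (d1 u) t al * rc t al)).
      + apply (continuous2_mult (D1t (d1 u)) (fun t al => - rc t al)); [now apply cD|apply crc'].
      + apply (continuous2_mult (P (d1 u)) rc); [now apply cP|apply crc].
    - apply (continuous2_plus (fun t al => D1t (d2 u) t al * - rs t al) (fun t al => P (d2 u) t al * rs t al)).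
      + apply (continuous2_mult (D1t (d2 u)) (fun t al => - rs t al)); [now apply cD|apply crs'].
      + apply (continuous2_mult (P (d2 u)) rs); [now apply cP|apply crs]. }
  assert (cv : forall t al, continuous2 v t al).
  { intros t al. apply (log_polar_continuous c1 c2 R1 R2 mu). exact (conj hc (conj hd (conj hz he))). }
  assert (vP : forall t al, 0 < t < T -> v t al = P u t al) by (intros; now apply log_polar_inside).
  assert (dvt : forall t al, 0 < t < T -> is_derive (fun s => v s al) t (vt t al)).
  { intros t al ht. apply (is_derive_ext_loc (fun s => P u s al)); [|now apply dt].
    apply (filter_imp (fun s => 0 < s < T)); [intros s hs; symmetry; now apply vP|].
    now apply locally_open_interval. }
  assert (dva : forall t al, 0 < t < T -> is_derive (v t) al (va t al)).
  { intros t al ht. apply (is_derive_ext (P u t)); [intros s; symmetry; now apply vP|now apply da]. }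
  assert (drct : forall t al, is_derive (fun s => - rc s al) t (rc t al)).
  { intros t al. unfold rc, rad. auto_derive; [exact I|ring]. }
  assert (drst : forall t al, is_derive (fun s => - rs s al) t (rs t al)).
  { intros t al. unfold rs, rad. auto_derive; [exact I|ring]. }
  assert (drca : forall t al, is_derive (rc t) al (- rs t al)).
  { intros t al. unfold rc, rs. auto_derive; [exact I|ring]. }
  assert (drsa : forall t al, is_derive (fun be => - rs t be) al (- rc t al)).
  { intros t al. unfold rc, rs. auto_derive; [exact I|ring]. }
  assert (dvtt : forall t al, 0 < t < T -> is_derive (fun s => vt s al) t (vtt t al)).
  { intros t al ht.
    apply (is_derive_plus (fun s => P (d1 u) s al * - rc s al) (fun s => P (d2 u) s al * - rs s al)).
    - apply (is_derive_mult_R (fun s => P (d1 u) s al) (fun s => - rc s al)); [now apply dt|apply drct].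
    - apply (is_derive_mult_R (fun s => P (d2 u) s al) (fun s => - rs s al)); [now apply dt|apply drst]. }
  assert (dvaa : forall t al, 0 < t < T -> is_derive (va t) al (vaa t al)).
  { intros t al ht.
    apply (is_derive_plus (fun s => P (d1 u) t s * - rs t s) (fun s => P (d2 u) t s * rc t s)).
    - apply (is_derive_mult_R (P (d1 u) t) (fun s => - rs t s)); [now apply da|apply drsa].
    - apply (is_derive_mult_R (P (d2 u) t) (rc t)); [now apply da|apply drca]. }
  assert (lap : forall t al, 0 < t < T -> vtt t al = - (mu * rad R1 t ^ 2 * v t al) - vaa t al).
  { intros t al ht. rewrite vP by exact ht. specialize (he _ _ (hU t al ht)). unfold laplacian in he.
    change (- (P (d1 (d1 u)) t al + P (d2 (d2 u)) t al) = mu * P u t al) in he.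
    assert (E : vtt t al + vaa t al = (P (d1 (d1 u)) t al + P (d2 (d2 u)) t al) * (rc t al ^ 2 + rs t al ^ 2)).
    { unfold vtt, vaa, D1t, D1a. ring. }
    assert (E2 : rc t al ^ 2 + rs t al ^ 2 = rad R1 t ^ 2).
    { unfold rc, rs. pose proof (sin2_cos2 al) as H. unfold Rsqr in H.
      transitivity (rad R1 t ^ 2 * (sin al * sin al + cos al * cos al)); [ring|rewrite H; ring]. }
    rewrite E2 in E. replace (P (d1 (d1 u)) t al + P (d2 (d2 u)) t al) with (- (mu * P u t al)) in E by lra.
    lra. }
  exists (fun t => RInt (fun al => vt t al * trig p al) 0 (2 * PI)). split.
  { intros t ht. apply (RInt_param_derive v vt (trig p) T); auto. apply continuous_trig. }
  intros t ht.
  replace (- ((mu * rad R1 t ^ 2 - freq p ^ 2) * y t)) with (RInt (fun al => vtt t al * trig p al) 0 (2 * PI)).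
  { apply (RInt_param_derive vt vtt (trig p) T); auto. apply continuous_trig. }
  set (W := fun al => va t al * trig p al - v t al * dtrig p al).
  assert (hv1 : forall al, continuous (fun al => v t al * trig p al) al).
  { intros al. apply (continuous_mult_R (v t) (trig p)); [apply (continuous2_slice v), cv|apply continuous_trig]. }
  assert (hv2 : forall al, continuous (fun al => vtt t al * trig p al) al).
  { intros al. apply (continuous_mult_R (vtt t) (trig p)); [apply (continuous2_slice vtt), cvtt, ht|apply continuous_trig]. }
  assert (I0 : RInt (fun al => - (mu * rad R1 t ^ 2 - freq p ^ 2) * (v t al * trig p al) - vtt t al * trig p al) 0 (2 * PI) = 0).
  { apply is_RInt_unique.
    replace 0 with (minus (W (2 * PI)) (W 0)) at 2.
    2:{ assert (per : forall g, P g t (0 + 2 * PI) = P g t 0).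
        { intros g. unfold P, pol_x, pol_y. now rewrite cos_plus_2PI, sin_plus_2PI. }
        assert (pc : rc t (0 + 2 * PI) = rc t 0 /\ rs t (0 + 2 * PI) = rs t 0).
        { unfold rc, rs. now rewrite cos_plus_2PI, sin_plus_2PI. }
        destruct pc as [pc ps].
        unfold W. replace (2 * PI) with (0 + 2 * PI) by ring.
        rewrite trig_periodic, dtrig_periodic. unfold va. rewrite !vP by exact ht.
        rewrite !per, pc, ps. unfold minus, plus, opp; simpl. ring. }
    apply (is_RInt_derive W).
    - intros al _.
      replace (- (mu * rad R1 t ^ 2 - freq p ^ 2) * (v t al * trig p al) - vtt t al * trig p al)
        with ((vaa t al * trig p al + va t al * dtrig p al)
              - (va t al * dtrig p al + v t al * - (freq p ^ 2 * trig p al)))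
        by (rewrite lap by exact ht; ring).
      apply (is_derive_minus (fun al => va t al * trig p al) (fun al => v t al * dtrig p al)).
      + apply is_derive_mult_R; [now apply dvaa|apply is_derive_trig].
      + apply is_derive_mult_R; [now apply dva|apply is_derive_dtrig].
    - intros al _.
      apply (continuous_minus (fun al => - (mu * rad R1 t ^ 2 - freq p ^ 2) * (v t al * trig p al))
         (fun al => vtt t al * trig p al)); [|apply hv2].
      apply (continuous_scal_r (- (mu * rad R1 t ^ 2 - freq p ^ 2)) (fun al => v t al * trig p al)). apply hv1. }
  rewrite (RInt_minus_all (fun al => - (mu * rad R1 t ^ 2 - freq p ^ 2) * (v t al * trig p al))) in I0.
  - rewrite (RInt_scal_all (- (mu * rad R1 t ^ 2 - freq p ^ 2)) (fun al => v t al * trig p al)) in I0 by exact hv1.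
    change (RInt (fun al => v t al * trig p al) 0 (2 * PI)) with (y t) in I0.
    change (@eq R (RInt (fun al => vtt t al * trig p al) 0 (2 * PI)) (- ((mu * rad R1 t ^ 2 - freq p ^ 2) * y t))).
    pose (r := RInt (fun al => vtt t al * trig p al) 0 (2 * PI) : R).
    change (RInt (fun al => vtt t al * trig p al) 0 (2 * PI)) with r in I0 |- *. clearbody r. lra.
  - intros al. apply (continuous_scal_r (- (mu * rad R1 t ^ 2 - freq p ^ 2)) (fun al => v t al * trig p al)). apply hv1.
  - exact hv2.
Qed.

(** * Multiplicities on the annulus *)

(** The square of the radius as a function of the logarithmic coordinate, kept
    constant for negative arguments so that it is bounded on the line. *)
Definition annulus_weight (R1 t : R) : R := rad R1 (Rmax 0 t) ^ 2.

Lemma annulus_weight_continuous (R1 t : R) : continuous (annulus_weight R1) t.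
Proof.
  apply (continuous_comp (Rmax 0) (fun s => rad R1 s ^ 2)).
  - apply (lipschitz_continuous (Rmax 0) 1). intros y z.
    unfold Rmax. destruct (Rle_dec 0 y), (Rle_dec 0 z); unfold Rabs; repeat destruct Rcase_abs; lra.
  - apply (ex_derive_continuous (fun s => rad R1 s ^ 2)). unfold rad. auto_derive. exact I.
Qed.

Lemma annulus_weight_pos (R1 t : R) : 0 < R1 -> 0 < annulus_weight R1 t.
Proof. intros h. apply pow_lt, Rmult_lt_0_compat; [exact h|apply exp_pos]. Qed.

Lemma annulus_weight_bounded (R1 : R) : 0 < R1 -> bounded_by (R1 ^ 2 + 1) (annulus_weight R1).
Proof.
  intros h t. rewrite Rabs_pos_eq by (left; now apply annulus_weight_pos).
  assert (annulus_weight R1 t <= R1 ^ 2); [|lra].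
  assert (hp : 0 < exp (- Rmax 0 t)) by apply exp_pos.
  apply pow_incr. unfold rad. split; [nra|].
  assert (exp (- Rmax 0 t) <= 1); [|nra].
  rewrite exp_Ropp. rewrite <- Rinv_1. apply Rinv_le_contravar; [lra|].
  apply exp_ge_1, Rmax_l.
Qed.

Lemma annulus_weight_inside (R1 t : R) : 0 <= t -> annulus_weight R1 t = rad R1 t ^ 2.
Proof. intros h. unfold annulus_weight. now rewrite Rmax_right. Qed.

Definition annulus_eigenspace (c1 c2 R1 R2 mu : R) : (R -> R -> R) -> Prop :=
  dirichlet_solution (open_annulus c1 c2 R1 R2) (closed_annulus c1 c2 R1 R2) laplacian mu.

(** The function [phi] does not depend on the eigenfunction: in each mode an
    eigenfunction is described by one scalar, and by none if [mu] is not an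
    eigenvalue of that mode. *)
Lemma coefficient_multiple (c1 c2 R1 R2 mu : R) (ThA : R -> R -> R -> R) (p : nat + nat) :
  0 < R2 < R1 -> phase_family 0 (fun _ => 1) (annulus_weight R1) ThA ->
  exists phi : R -> R, forall u, annulus_eigenspace c1 c2 R1 R2 mu u ->
    exists c, (forall t, 0 <= t <= ln (R1 / R2) -> coefficient c1 c2 R1 R2 u p t = c * phi t) /\
      (sin (ThA (freq p ^ 2) mu (ln (R1 / R2))) <> 0 -> c = 0).
Proof.
  intros hR fA. set (T := ln (R1 / R2)).
  assert (hT : 0 < T) by (apply ln_ratio_pos; lra).
  set (q := fun t => mu * annulus_weight R1 t - freq p ^ 2).
  assert (cq : forall t, continuous q t).
  { intros t. apply mode_coefficient_continuous, annulus_weight_continuous. }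
  destruct (phase_solution 0 T (fun _ => 1) q (ThA (freq p ^ 2) mu)) as
    [phi [psi [cphi [cpsi [dphi [dpsi [hz hn]]]]]]]; [apply fA|intros; apply continuous_const|exact cq|].
  exists phi. intros u hu.
  destruct (coefficient_equation c1 c2 R1 R2 mu u p hR hu) as [cy [y0 [yT [z [dy dz]]]]].
  fold T in yT, dy, dz.
  destruct (radial_multiple T q (coefficient c1 c2 R1 R2 u p) z phi psi) as [c [h1 h2]]; try assumption.
  - intros t ht. unfold q. rewrite annulus_weight_inside by lra. now apply dz.
  - apply hz. destruct (fA (freq p ^ 2) mu T) as [_ [e _]]. rewrite e. apply sin_0.
  - intros t ht. rewrite <- (Rmult_1_l (psi t)). now apply dphi.
  - intros t ht. replace (q t * phi t) with (1 * q t * phi t) by ring. now apply dpsi.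
  - exists c. split; [exact h1|]. intros hs. apply h2. intros e. apply hs. now apply hz.
Qed.

Lemma lsum_extend_by_zero {A : Type} (K : R -> R -> Prop) (c : A -> R) (e : A -> R -> R -> R) (l : list A) (x y : R) :
  extend_by_zero K (fun x y => lsum (fun i => c i * e i x y) l) x y
  = lsum (fun i => c i * extend_by_zero K (e i) x y) l.
Proof.
  unfold extend_by_zero. destruct excluded_middle_informative; [reflexivity|].
  symmetry. apply lsum_zero. intros. ring.
Qed.

(** If the modes were fewer than the dimension, some nonzero combination of basis
    functions would have vanishing coefficients in all of them, hence in all
    modes, and would vanish by completeness of the trigonometric system. *)
Lemma annulus_multiplicity (c1 c2 R1 R2 mu : R) (ThA : R -> R -> R -> R) (d : nat) :
  0 < R2 < R1 -> phase_family 0 (fun _ => 1) (annulus_weight R1) ThA ->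
  has_dimension (closed_annulus c1 c2 R1 R2) (annulus_eigenspace c1 c2 R1 R2 mu) d ->
  exists ps : list (nat + nat), NoDup ps /\ (d <= length ps)%nat /\
    forall p, In p ps -> sin (ThA (freq p ^ 2) mu (ln (R1 / R2))) = 0.
Proof.
  intros hR fA [e [he [hfree _]]]. set (T := ln (R1 / R2)).
  assert (hT : 0 < T) by (apply ln_ratio_pos; lra).
  assert (bA := annulus_weight_bounded R1 ltac:(lra)).
  assert (b1 : bounded_by (R1 ^ 2 + 1) (fun _ => 1)).
  { intros t. rewrite Rabs_R1. pose proof (pow2_ge_0 R1). lra. }
  set (B := Rabs mu * (R1 ^ 2 + 1)).
  assert (hB : 0 <= B) by (apply Rmult_le_pos; [apply Rabs_pos|pose proof (pow2_ge_0 R1); lra]).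
  (* If [k >= 1] and [k >= B] then [k ^ 2 >= B] dominates [mu] times the weight, and the
     angle stays in (0, PI / 2]: only finitely many modes matter. *)
  assert (high : forall p, B <= freq p -> sin (ThA (freq p ^ 2) mu T) <> 0 \/ freq p < 1).
  { intros p hp. destruct (Rlt_dec (freq p) 1) as [h|h]; [now right|left].
    assert (hq : forall t, mu * annulus_weight R1 t - freq p ^ 2 <= 0).
    { intros t. specialize (bA t).
      assert (mu * annulus_weight R1 t <= B).
      { eapply Rle_trans; [apply Rle_abs|]. rewrite Rabs_mult. apply Rmult_le_compat_l; [apply Rabs_pos|exact bA]. }
      nra. }
    assert (h1 : ThA (freq p ^ 2) mu T <= PI / 2).
    { apply (phase_le_PI2 0 T (fun _ => 1) (fun t => mu * annulus_weight R1 t - freq p ^ 2) _ 1 (fA _ _ T));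
        [intros; lra|intros; apply hq|lra]. }
    assert (h2 : 0 < ThA (freq p ^ 2) mu T).
    { apply (phase_pos 0 T (fun _ => 1) (fun t => mu * annulus_weight R1 t - freq p ^ 2) _
        ((R1 ^ 2 + 1) * (Rabs mu * (R1 ^ 2 + 1) + Rabs (freq p ^ 2) + 1)) T (fA _ _ T)); [intros; lra| |lra].
      intros t _. now apply (mode_coefficient_bound (fun _ => 1) (annulus_weight R1)). }
    pose proof PI_RGT_0. assert (0 < sin (ThA (freq p ^ 2) mu T)) by (apply sin_gt_0; lra). lra. }
  destruct (INR_archimed 1 (B + 1) ltac:(lra)) as [N hN].
  set (eig := fun p : nat + nat =>
    if excluded_middle_informative (sin (ThA (freq p ^ 2) mu T) = 0) then true else false).
  set (ps := filter eig (map inl (seq 0 N) ++ map inr (seq 0 N))).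
  assert (hps : forall p, In p ps <-> sin (ThA (freq p ^ 2) mu T) = 0).
  { intros p. unfold ps. rewrite filter_In, in_app_iff, !in_map_iff. unfold eig. split.
    - intros [_ h]. destruct excluded_middle_informative; [assumption|discriminate].
    - intros h. destruct excluded_middle_informative; [|contradiction]. split; [|reflexivity].
      assert (hf : freq p < INR N).
      { destruct (Rlt_dec (freq p) (INR N)) as [|hn]; [assumption|].
        destruct (high p); [lra|contradiction|lra]. }
      destruct p as [k|k]; unfold freq in hf; apply INR_lt in hf; [left|right];
        exists k; (split; [reflexivity|apply in_seq; lia]). }
  assert (nps : NoDup ps).
  { apply NoDup_filter, NoDup_app.
    - apply NoDup_map_on; [apply seq_NoDup|]. congruence.
    - apply NoDup_map_on; [apply seq_NoDup|]. congruence.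
    - intros p h1 h2. apply in_map_iff in h1. apply in_map_iff in h2.
      destruct h1 as [? [<- _]], h2 as [? [h2 _]]. discriminate. }
  exists ps. split; [exact nps|]. split; [|intros p; apply hps].
  destruct (Nat.le_gt_cases d (length ps)) as [|hlt]; [assumption|exfalso].
  assert (hphi : forall p, exists phi : R -> R, forall u, annulus_eigenspace c1 c2 R1 R2 mu u ->
    exists c, (forall t, 0 <= t <= T -> coefficient c1 c2 R1 R2 u p t = c * phi t) /\
      (sin (ThA (freq p ^ 2) mu T) <> 0 -> c = 0)).
  { intros p. now apply coefficient_multiple. }
  destruct (choice_function _ hphi) as [phi hphi']. clear hphi.
  assert (hC : forall pi : (nat + nat) * nat, exists c, (1 <= snd pi <= d)%nat ->
     (forall t, 0 <= t <= T -> coefficient c1 c2 R1 R2 (e (snd pi)) (fst pi) t = c * phi (fst pi) t) /\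
      (sin (ThA (freq (fst pi) ^ 2) mu T) <> 0 -> c = 0)).
  { intros [p i]. simpl. destruct (classic (1 <= i <= d)%nat) as [hi|hi].
    - destruct (hphi' p (e i) (he i hi)) as [c hc]. now exists c.
    - exists 0. intros; contradiction. }
  destruct (choice_function _ hC) as [C hC']. clear hC.
  destruct (homogeneous_system ps (seq 1 d) (fun p i => C (p, i))) as [c [[i [hi hci]] hs]].
  { apply seq_NoDup. }
  { rewrite length_seq. exact hlt. }
  assert (hidx : forall i, In i (seq 1 d) <-> (1 <= i <= d)%nat) by (intros; rewrite in_seq; lia).
  apply hci. apply (hfree c); [|now apply hidx].
  set (u := fun x y => lsum (fun i => c i * e i x y) (seq 1 d)).
  intros x y hK. rewrite lsum_seq. change (u x y = 0).
  destruct (classic (open_annulus c1 c2 R1 R2 x y)) as [hU|hU].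
  2:{ apply lsum_zero. intros k hk. apply hidx, he in hk. destruct hk as [_ [_ [hz _]]].
      rewrite hz by assumption. ring. }
  assert (sumv : forall t al, log_polar c1 c2 R1 R2 u t al
     = lsum (fun i => c i * log_polar c1 c2 R1 R2 (e i) t al) (seq 1 d)).
  { intros t al. apply lsum_extend_by_zero. }
  assert (cont : forall k t, In k (seq 1 d) -> forall al, continuous (log_polar c1 c2 R1 R2 (e k) t) al).
  { intros k t hk al. apply (continuous2_slice (log_polar c1 c2 R1 R2 (e k))).
    apply (log_polar_continuous c1 c2 R1 R2 mu). now apply he, hidx. }
  assert (null : forall t, 0 < t < T -> fourier_null (fun al => log_polar c1 c2 R1 R2 u t al)).
  { intros t ht. split.
    - intros al. apply (continuous_ext (fun al => lsum (fun i => c i * log_polar c1 c2 R1 R2 (e i) t al) (seq 1 d))).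
      + intros b. symmetry. apply sumv.
      + apply (RInt_lsum (fun i al => c i * log_polar c1 c2 R1 R2 (e i) t al) (seq 1 d) 0 0).
        intros k hk b. apply (continuous_scal_r (c k) (log_polar c1 c2 R1 R2 (e k) t)). now apply cont.
    - intros p.
      rewrite (RInt_ext_all _ (fun al => lsum (fun i => c i * (log_polar c1 c2 R1 R2 (e i) t al * trig p al)) (seq 1 d))).
      2:{ intros al. rewrite sumv, Rmult_comm, <- lsum_scal. apply lsum_ext. intros; ring. }
      assert (ck : forall k, In k (seq 1 d) -> forall al, continuous (fun al => log_polar c1 c2 R1 R2 (e k) t al * trig p al) al).
      { intros k hk al. apply (continuous_mult_R (log_polar c1 c2 R1 R2 (e k) t) (trig p));
          [now apply cont|apply continuous_trig]. }
      rewrite (proj2 (RInt_lsum (fun i al => c i * (log_polar c1 c2 R1 R2 (e i) t al * trig p al)) (seq 1 d) 0 (2 * PI)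
        ltac:(intros k hk b; apply (continuous_scal_r (c k) (fun al => log_polar c1 c2 R1 R2 (e k) t al * trig p al)); now apply ck))).
      rewrite (lsum_ext _ (fun i => phi p t * (c i * C (p, i)))).
      + rewrite lsum_scal. destruct (classic (In p ps)) as [hp|hp].
        * rewrite hs by exact hp. ring_R.
        * rewrite lsum_zero; [ring_R|]. intros k hk. apply hidx in hk.
          destruct (hC' (p, k) hk) as [_ h]. simpl in h. rewrite h; [ring|]. intros hz. apply hp, hps, hz.
      + intros k hk. rewrite (RInt_scal_all (c k) (fun al => log_polar c1 c2 R1 R2 (e k) t al * trig p al)) by now apply ck.
        apply hidx in hk. destruct (hC' (p, k) hk) as [h _]. simpl in h.
        specialize (h t ltac:(lra)). unfold coefficient in h. rewrite h. ring. }
  destruct hU as [h1 h2].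
  remember (dist_euc c1 c2 x y) as r eqn:er. set (t := ln (R1 / r)).
  assert (ht : 0 < t < T).
  { unfold t, T. split.
    - apply ln_ratio_pos. lra.
    - apply ln_increasing; [apply Rdiv_lt_0_compat; lra|].
      unfold Rdiv. apply Rmult_lt_compat_l; [lra|]. apply Rinv_lt_contravar; [nra|lra]. }
  assert (hr : rad R1 t = r).
  { unfold rad, t. rewrite exp_Ropp, exp_ln by (apply Rdiv_lt_0_compat; lra). field. lra. }
  destruct (polar_angle c1 c2 x y r ltac:(lra) (eq_sym er)) as [al [hal [-> ->]]].
  rewrite <- hr. change (u (pol_x c1 R1 t al) (pol_y c2 R1 t al) = 0).
  rewrite <- (log_polar_inside c1 c2 R1 R2) by assumption.
  destruct (null t ht) as [cn _]. pose proof PI_RGT_0.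
  assert (zero : forall b, 0 < b < 2 * PI -> log_polar c1 c2 R1 R2 u t b = 0).
  { intros b hb. apply (fourier_complete (fun al => log_polar c1 c2 R1 R2 u t al)); [now apply null|exact hb]. }
  destruct (Req_dec al 0) as [->|n0].
  - apply (continuous_zero_left_end (fun al => log_polar c1 c2 R1 R2 u t al) 0 (2 * PI)); [lra|apply cn|exact zero].
  - destruct (Req_dec al (2 * PI)) as [->|n1].
    + apply (continuous_zero_right_end (fun al => log_polar c1 c2 R1 R2 u t al) 0 (2 * PI)); [lra|apply cn|exact zero].
    + apply zero. lra.
Qed.

(** * The metric of a surface of revolution *)

Lemma frame_dot (e1 e2 e3 : R3) (x y z x' y' z' : R) :
  orthonormal_frame e1 e2 e3 ->
  dot (add3 (scal3 x e1) (add3 (scal3 y e2) (scal3 z e3)))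
      (add3 (scal3 x' e1) (add3 (scal3 y' e2) (scal3 z' e3))) = x * x' + y * y' + z * z'.
Proof.
  intros [h11 [h22 [h33 [h12 [h13 h23]]]]].
  transitivity (x * x' * dot e1 e1 + y * y' * dot e2 e2 + z * z' * dot e3 e3
    + (x * y' + y * x') * dot e1 e2 + (x * z' + z * x') * dot e1 e3 + (y * z' + z * y') * dot e2 e3).
  - unfold dot, add3, scal3, mk3, pr_x, pr_y, pr_z. simpl. ring.
  - rewrite h11, h22, h33, h12, h13, h23. ring.
Qed.

(** The metric [speed2 ds^2 + F^2 dt^2] of a surface of revolution with profile
    [(F, G)]; nothing else of the embedding matters for the spectrum. *)
Definition speed2 (F G : R -> R) (s : R) : R := Derive F s ^ 2 + Derive G s ^ 2.

Definition rotational_metric (a b : R) (X : R -> R -> R3) (F G : R -> R) : Prop :=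
  smooth1 F /\ smooth1 G /\
  (forall s, a <= s <= b -> 0 < F s) /\ (forall s, a <= s <= b -> 0 < speed2 F G s) /\
  (forall s t, g11 X s t = speed2 F G s) /\ (forall s t, g12 X s t = 0) /\
  (forall s t, g22 X s t = F s ^ 2).

Lemma smooth1_ex_derive (f : R -> R) (x : R) : smooth1 f -> ex_derive f x.
Proof. intros h. exact (h 1%nat x). Qed.

Lemma smooth1_Derive (f : R -> R) : smooth1 f -> smooth1 (Derive f).
Proof.
  intros h n x. destruct n as [|n]; [exact I|].
  apply (ex_derive_ext (Derive_n f (S n))).
  - intros y. replace (S n) with (n + 1)%nat by lia. rewrite <- Derive_n_comp. reflexivity.
  - exact (h (S (S n)) x).
Qed.

(** The immersion hypothesis enters as the positivity of the speed of the profile. *)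
Lemma surface_metric (R1 R2 a b : R) (X : R -> R -> R3) :
  surface_of_revolution R1 R2 a b X ->
  exists F G, rotational_metric a b X F G /\ F a = R1 /\ F b = R2.
Proof.
  intros [p [e1 [e2 [e3 [F [G [fr [sF [sG [pF [Fa [Fb [hX him]]]]]]]]]]]]].
  exists F, G. split; [|now split].
  assert (dF : forall s, is_derive F s (Derive F s)) by (intros; now apply Derive_correct, smooth1_ex_derive).
  assert (dG : forall s, is_derive G s (Derive G s)) by (intros; now apply Derive_correct, smooth1_ex_derive).
  assert (D1 : forall s t, lift3 d1 X s t = add3 (scal3 (Derive F s * cos t) e1)
     (add3 (scal3 (Derive F s * sin t) e2) (scal3 (Derive G s) e3))).
  { intros s t.
    assert (K : forall (pr : R3 -> R), (forall v w, pr (add3 v w) = pr v + pr w) ->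
        (forall k v, pr (scal3 k v) = k * pr v) ->
        d1 (fun s t => pr (X s t)) s t = pr (add3 (scal3 (Derive F s * cos t) e1)
     (add3 (scal3 (Derive F s * sin t) e2) (scal3 (Derive G s) e3)))).
    { intros pr hadd hscal. unfold d1. apply is_derive_unique.
      apply (is_derive_ext (fun z => pr p + (F z * cos t * pr e1 + (F z * sin t * pr e2 + G z * pr e3)))).
      { intros z. now rewrite hX, !hadd, !hscal. }
      rewrite !hadd, !hscal. auto_derive; [repeat split; try (eexists; apply dF); eexists; apply dG|].
      rewrite !(Derive_ext (fun x => F x) F), !(Derive_ext (fun x => G x) G) by reflexivity. ring. }
    unfold lift3. rewrite !K by (intros; reflexivity). reflexivity. }
  assert (D2 : forall s t, lift3 d2 X s t = add3 (scal3 (- (F s * sin t)) e1)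
     (add3 (scal3 (F s * cos t) e2) (scal3 0 e3))).
  { intros s t.
    assert (K : forall (pr : R3 -> R), (forall v w, pr (add3 v w) = pr v + pr w) ->
        (forall k v, pr (scal3 k v) = k * pr v) ->
        d2 (fun s t => pr (X s t)) s t = pr (add3 (scal3 (- (F s * sin t)) e1)
     (add3 (scal3 (F s * cos t) e2) (scal3 0 e3)))).
    { intros pr hadd hscal. unfold d2. apply is_derive_unique.
      apply (is_derive_ext (fun z => pr p + (F s * cos z * pr e1 + (F s * sin z * pr e2 + G s * pr e3)))).
      { intros z. now rewrite hX, !hadd, !hscal. }
      rewrite !hadd, !hscal. auto_derive; [exact I|]. ring. }
    unfold lift3. rewrite !K by (intros; reflexivity). reflexivity. }
  assert (sc : forall t, cos t * cos t + sin t * sin t = 1).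
  { intros t. pose proof (sin2_cos2 t) as H. unfold Rsqr in H. lra. }
  split; [exact sF|split; [exact sG|split; [exact pF|split; [|split; [|split]]]]].
  - intros s hs. unfold speed2.
    pose proof (pow2_ge_0 (Derive F s)). pose proof (pow2_ge_0 (Derive G s)).
    destruct (Rlt_dec 0 (Derive F s ^ 2 + Derive G s ^ 2)) as [|hn]; [assumption|exfalso].
    assert (hF0 : Derive F s = 0) by (apply Rsqr_0_uniq; unfold Rsqr; lra).
    assert (hG0 : Derive G s = 0) by (apply Rsqr_0_uniq; unfold Rsqr; lra).
    destruct (him s 0 hs 1 0) as [h _]; [|lra].
    rewrite D1, D2, hF0, hG0. unfold add3, scal3, mk3, pr_x, pr_y, pr_z. simpl.
    f_equal; [f_equal|]; ring.
  - intros s t. unfold g11, speed2. rewrite D1, frame_dot by exact fr.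
    transitivity (Derive F s ^ 2 * (cos t * cos t + sin t * sin t) + Derive G s ^ 2); [ring|rewrite sc; ring].
  - intros s t. unfold g12. rewrite D1, D2, frame_dot by exact fr. ring.
  - intros s t. unfold g22. rewrite D2, frame_dot by exact fr.
    transitivity (F s ^ 2 * (cos t * cos t + sin t * sin t)); [ring|rewrite sc; ring].
Qed.

Fixpoint differentiable_at (n : nat) (f : R -> R) (x : R) : Prop :=
  continuous f x /\
  match n with O => True | S n => ex_derive f x /\ differentiable_at n (Derive f) x end.

Lemma ex_diff_n_product (n : nat) (f g : R -> R) (x y : R) :
  differentiable_at n f x -> differentiable_at n g y -> ex_diff_n (fun x y => f x * g y) n x y.
Proof.
  revert f g. induction n as [|n IH]; intros f g [cf hf] [cg hg].
  - split; [|exact I]. apply continuous2_continuity_2d.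
    apply (continuous2_mult (fun x _ => f x) (fun _ y => g y)); [now apply continuous2_fst|now apply continuous2_snd].
  - destruct hf as [df hf], hg as [dg hg].
    assert (lower : forall f x, differentiable_at (S n) f x -> differentiable_at n f x).
    { clear. induction n as [|n IH]; intros f x [c h].
      - split; [exact c|exact I].
      - destruct h as [d h]. split; [exact c|]. split; [exact d|]. now apply IH. }
    split; [|split; [|split; [|split]]].
    + apply continuous2_continuity_2d.
      apply (continuous2_mult (fun x _ => f x) (fun _ y => g y)); [now apply continuous2_fst|now apply continuous2_snd].
    + auto_derive. exact df.
    + auto_derive. exact dg.
    + replace (fun u v => Derive (fun z => f z * g v) u) with (fun u v => Derive f u * g v).
      * apply IH; [exact hf|]. apply lower. exact (conj cg (conj dg hg)).
      * apply functional_extensionality. intros u. apply functional_extensionality. intros v.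
        symmetry. apply Derive_scal_l.
    + replace (fun u v => Derive (fun z => f u * g z) v) with (fun u v => f u * Derive g v).
      * apply IH; [|exact hg]. apply lower. exact (conj cf (conj df hf)).
      * apply functional_extensionality. intros u. apply functional_extensionality. intros v.
        symmetry. apply Derive_scal.
Qed.

Lemma smooth1_differentiable_at (n : nat) (f : R -> R) (x : R) : smooth1 f -> differentiable_at n f x.
Proof.
  revert f. induction n as [|n IH]; intros f h.
  - split; [|exact I]. now apply (ex_derive_continuous f), smooth1_ex_derive.
  - split; [now apply (ex_derive_continuous f), smooth1_ex_derive|].
    split; [now apply smooth1_ex_derive|]. now apply IH, smooth1_Derive.
Qed.

Lemma smooth1_oscillator (f g : R -> R) (c : R) :
  (forall x, is_derive f x (g x)) -> (forall x, is_derive g x (c * f x)) -> smooth1 f /\ smooth1 g.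
Proof.
  intros df dg.
  assert (st : forall h k : R -> R, (forall x, is_derive h x (k x)) -> forall n,
    (forall x, ex_derive_n k n x) -> forall x, ex_derive_n h (S n) x).
  { intros h k d n hk x. destruct n as [|n]; [eexists; apply d|].
    apply (ex_derive_ext (Derive_n k n)); [|exact (hk x)].
    intros y. replace (S n) with (n + 1)%nat by lia. rewrite <- Derive_n_comp. simpl.
    apply Derive_n_ext. intros z. symmetry. now apply is_derive_unique. }
  assert (H : forall n, (forall x, ex_derive_n f n x) /\ (forall x, ex_derive_n g n x)).
  { induction n as [|n [IHf IHg]]; [now split|]. split.
    - now apply (st f g).
    - apply (st g (fun x => c * f x)); [exact dg|]. intros x. now apply ex_derive_n_scal_l. }
  split; intros n x; apply H.
Qed.

Lemma smooth1_cos_sin : smooth1 cos /\ smooth1 sin.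
Proof.
  apply and_comm, (smooth1_oscillator sin cos (-1)); intros x; apply is_derive_Reals.
  - apply derivable_pt_lim_sin.
  - replace (-1 * sin x) with (- sin x) by ring. apply derivable_pt_lim_cos.
Qed.

Lemma smooth1_trig (p : nat + nat) : smooth1 (trig p).
Proof.
  apply (smooth1_oscillator (trig p) (dtrig p) (- freq p ^ 2)); intros x; [apply is_derive_trig|].
  replace (- freq p ^ 2 * trig p x) with (- (freq p ^ 2 * trig p x)) by ring. apply is_derive_dtrig.
Qed.

(** The profile is controlled on [[a, b]] only; composing with [clamp] extends its
    weights continuously and boundedly to the line. *)
Definition clamp (a b s : R) : R := Rmax a (Rmin b s).

Lemma clamp_in (a b s : R) : a <= b -> a <= clamp a b s <= b.
Proof. intros h. unfold clamp, Rmax, Rmin. destruct (Rle_dec b s); destruct Rle_dec; lra. Qed.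

Lemma clamp_id (a b s : R) : a <= s <= b -> clamp a b s = s.
Proof. intros h. unfold clamp, Rmax, Rmin. destruct (Rle_dec b s); destruct Rle_dec; lra. Qed.

Lemma clamp_continuous (a b s : R) : continuous (clamp a b) s.
Proof.
  apply (lipschitz_continuous (clamp a b) 1). intros y z.
  unfold clamp, Rmax, Rmin. destruct (Rle_dec b y), (Rle_dec b z);
    repeat destruct Rle_dec; unfold Rabs; repeat destruct Rcase_abs; lra.
Qed.

Definition arc_weight (a b : R) (F G : R -> R) (s : R) : R :=
  sqrt (speed2 F G (clamp a b s)) / F (clamp a b s).

Definition radius_weight (a b : R) (F : R -> R) (s : R) : R := F (clamp a b s) ^ 2.

Lemma speed2_ex_derive (F G : R -> R) (s : R) : smooth1 F -> smooth1 G -> ex_derive (speed2 F G) s.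
Proof.
  intros hF hG. unfold speed2. auto_derive. split; [|split; [|exact I]].
  - apply (smooth1_ex_derive (Derive F)). now apply smooth1_Derive.
  - apply (smooth1_ex_derive (Derive G)). now apply smooth1_Derive.
Qed.

Lemma arc_weight_continuous (a b : R) (X : R -> R -> R3) (F G : R -> R) (s : R) :
  a <= b -> rotational_metric a b X F G -> continuous (arc_weight a b F G) s.
Proof.
  intros ab [sF [sG [pF [pS _]]]].
  apply (continuous_comp (clamp a b) (fun s => sqrt (speed2 F G s) / F s)); [apply clamp_continuous|].
  pose proof (clamp_in a b s ab) as hc.
  apply (ex_derive_continuous (fun s => sqrt (speed2 F G s) / F s)).
  auto_derive. split; [now apply speed2_ex_derive|]. split; [now apply pS|].
  split; [now apply smooth1_ex_derive|]. split; [|exact I]. specialize (pF _ hc). lra.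
Qed.

Lemma radius_weight_continuous (a b : R) (F : R -> R) (s : R) :
  smooth1 F -> continuous (radius_weight a b F) s.
Proof.
  intros sF. apply (continuous_comp (clamp a b) (fun s => F s ^ 2)); [apply clamp_continuous|].
  apply (ex_derive_continuous (fun s => F s ^ 2)). auto_derive. now apply smooth1_ex_derive.
Qed.

Lemma arc_weight_pos (a b : R) (X : R -> R -> R3) (F G : R -> R) (s : R) :
  a <= b -> rotational_metric a b X F G -> 0 < arc_weight a b F G s.
Proof.
  intros ab [_ [_ [pF [pS _]]]]. pose proof (clamp_in a b s ab) as hc.
  apply Rdiv_lt_0_compat; [apply sqrt_lt_R0|]; auto.
Qed.

Lemma arc_weight_C1 (a b : R) (X : R -> R -> R3) (F G : R -> R) :
  rotational_metric a b X F G ->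
  exists w1 : R -> R, forall s, a < s < b ->
    is_derive (arc_weight a b F G) s (w1 s) /\ continuous w1 s.
Proof.
  intros [sF [sG [pF [pS _]]]].
  set (w := fun s => sqrt (speed2 F G s) / F s).
  set (w1 := fun s => ((2 * Derive F s * Derive (Derive F) s + 2 * Derive G s * Derive (Derive G) s)
     / (2 * sqrt (speed2 F G s)) * F s - sqrt (speed2 F G s) * Derive F s) / F s ^ 2).
  assert (eF : forall s, ex_derive F s) by (intros; now apply smooth1_ex_derive).
  assert (eF1 : forall s, ex_derive (Derive F) s) by (intros; now apply smooth1_ex_derive, smooth1_Derive).
  assert (eG1 : forall s, ex_derive (Derive G) s) by (intros; now apply smooth1_ex_derive, smooth1_Derive).
  assert (eF2 : forall s, ex_derive (Derive (Derive F)) s)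
    by (intros; now apply smooth1_ex_derive, smooth1_Derive, smooth1_Derive).
  assert (eG2 : forall s, ex_derive (Derive (Derive G)) s)
    by (intros; now apply smooth1_ex_derive, smooth1_Derive, smooth1_Derive).
  exists w1. intros s hs.
  assert (hF : 0 < F s) by (apply pF; lra). assert (hS : 0 < speed2 F G s) by (apply pS; lra).
  pose proof (sqrt_lt_R0 _ hS) as hq.
  split.
  - apply (is_derive_ext_loc w).
    + apply (filter_imp (fun s => a < s < b)).
      * intros z hz. unfold w, arc_weight. rewrite clamp_id by lra. reflexivity.
      * now apply locally_open_interval.
    + assert (dS : is_derive (speed2 F G) s
          (2 * Derive F s * Derive (Derive F) s + 2 * Derive G s * Derive (Derive G) s)).
      { unfold speed2. auto_derive.
        - split; [apply eF1|]. split; [apply eG1|exact I].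
        - rewrite !(Derive_ext (fun x => Derive (fun x => F x) x) (Derive F)), !(Derive_ext (fun x => Derive (fun x => G x) x) (Derive G)) by reflexivity.
          ring. }
      apply (is_derive_div (fun s => sqrt (speed2 F G s)) F); [|now apply Derive_correct|lra].
      apply (is_derive_sqrt (speed2 F G)); [exact dS|exact hS].
  - apply (ex_derive_continuous w1). unfold w1.
    assert (eS := speed2_ex_derive F G s sF sG).
    auto_derive. repeat split; auto; nra.
Qed.

(** * Separated eigenfunctions on the surface *)

Definition surface_eigenspace (a b : R) (X : R -> R -> R3) (mu : R) (u : R -> R -> R) : Prop :=
  periodic2 a b u /\
  dirichlet_solution (fun s t => a < s < b) (fun s t => a <= s <= b) (laplace_beltrami X) mu u.

(** Separation of variables: [(F / h) phi' = psi], where [h ds] is the arc length, so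
    that the divergence form of the Laplace-Beltrami operator only involves
    [psi'] and the angular second derivative. *)
Lemma mode_eigenfunction (a b : R) (X : R -> R -> R3) (F G phi psi : R -> R) (mu : R) (p : nat + nat) :
  a < b -> rotational_metric a b X F G ->
  (forall s, continuous phi s) -> (forall s, continuous psi s) ->
  (forall s, a < s < b -> is_derive phi s (arc_weight a b F G s * psi s)) ->
  (forall s, a < s < b -> is_derive psi s
     (- (arc_weight a b F G s * (mu * radius_weight a b F s - freq p ^ 2) * phi s))) ->
  phi a = 0 -> phi b = 0 ->
  surface_eigenspace a b X mu (fun s t => phi s * trig p t).
Proof.
  intros ab hm cphi cpsi dphi dpsi phia phib.
  destruct (arc_weight_C1 a b X F G hm) as [w1 hw1].
  assert (cw := fun s => arc_weight_continuous a b X F G s (Rlt_le _ _ ab) hm).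
  destruct hm as [sF [sG [pF [pS [eg11 [eg12 eg22]]]]]].
  assert (cr := fun s => radius_weight_continuous a b F s sF).
  set (w := arc_weight a b F G) in *. set (rho := radius_weight a b F) in *.
  split; [|split; [|split; [|split]]].
  - intros s t _. now rewrite trig_periodic.
  - intros [s t] _. simpl fst. simpl snd.
    assert (c : continuous2 (fun s t => phi s * trig p t) s t).
    { apply (continuous2_mult (fun s _ => phi s) (fun _ t => trig p t));
        [apply continuous2_fst, cphi|apply continuous2_snd, continuous_trig]. }
    intros P hP. specialize (c P hP). unfold within.
    apply (filter_imp (F := locally (s, t)) _ _ (fun z h _ => h) c).
  - intros s t hs. apply ex_diff_n_product; [|apply smooth1_differentiable_at, smooth1_trig].
    assert (L := locally_open_interval a b s hs).
    assert (L1 : locally s (fun z => Derive phi z = w z * psi z)).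
    { apply (filter_imp (fun z => a < z < b)); [|exact L]. intros z hz. now apply is_derive_unique, dphi. }
    assert (d2phi : forall z, a < z < b -> is_derive (fun z => w z * psi z) z
      (w1 z * psi z + w z * (- (w z * (mu * rho z - freq p ^ 2) * phi z)))).
    { intros z hz. apply (is_derive_mult_R w psi); [now apply hw1|now apply dpsi]. }
    assert (L2 : locally s (fun z => Derive (Derive phi) z =
       w1 z * psi z + w z * (- (w z * (mu * rho z - freq p ^ 2) * phi z)))).
    { apply (filter_imp (fun z => a < z < b)); [|exact L]. intros z hz.
      rewrite (Derive_ext_loc (Derive phi) (fun z => w z * psi z)).
      - now apply is_derive_unique, d2phi.
      - apply (filter_imp (fun z => a < z < b)); [|now apply locally_open_interval].
        intros y hy. now apply is_derive_unique, dphi. }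
    split; [apply cphi|]. split; [eexists; now apply dphi|].
    split; [|split; [|split; [|exact I]]].
    + apply (continuous_ext_loc _ (fun z => w z * psi z)).
      * apply (filter_imp _ _) with (2 := L1). intros z hz. now symmetry.
      * apply (continuous_mult_R w psi); [apply cw|apply cpsi].
    + apply (ex_derive_ext_loc (fun z => w z * psi z)).
      * apply (filter_imp _ _) with (2 := L1). intros z hz. now symmetry.
      * eexists. now apply d2phi.
    + apply (continuous_ext_loc _ (fun z => w1 z * psi z + w z * (- (w z * (mu * rho z - freq p ^ 2) * phi z)))).
      * apply (filter_imp _ _) with (2 := L2). intros z hz. now symmetry.
      * apply (continuous_plus (fun z => w1 z * psi z) (fun z => w z * (- (w z * (mu * rho z - freq p ^ 2) * phi z)))).
        -- apply (continuous_mult_R w1 psi); [now apply hw1|apply cpsi].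
        -- apply (continuous_mult_R w (fun z => - (w z * (mu * rho z - freq p ^ 2) * phi z))); [apply cw|].
           apply (continuous_opp (fun z => w z * (mu * rho z - freq p ^ 2) * phi z)).
           apply (continuous_mult_R (fun z => w z * (mu * rho z - freq p ^ 2)) phi); [|apply cphi].
           apply (continuous_mult_R w (fun z => mu * rho z - freq p ^ 2)); [apply cw|].
           apply mode_coefficient_continuous, cr.
  - intros s t hs hn. assert (s = a \/ s = b) as [-> | ->] by lra; [rewrite phia|rewrite phib]; ring.
  - intros s t hs. unfold laplace_beltrami.
    set (h := fun s => sqrt (speed2 F G s)).
    assert (ar : forall s t, a < s < b -> area_density X s t = h s * F s).
    { intros z t' hz. unfold area_density. rewrite eg11, eg12, eg22.
      replace (speed2 F G z * F z ^ 2 - 0 ^ 2) with (speed2 F G z * Rsqr (F z)) by (unfold Rsqr; ring).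
      rewrite sqrt_mult_alt by (left; apply pS; lra).
      rewrite sqrt_Rsqr by (left; apply pF; lra). reflexivity. }
    assert (hp : forall s, a < s < b -> 0 < h s /\ 0 < F s /\ h s ^ 2 = speed2 F G s /\ w s = h s / F s /\ rho s = F s ^ 2).
    { intros z hz. assert (0 < speed2 F G z) by (apply pS; lra).
      split; [now apply sqrt_lt_R0|]. split; [apply pF; lra|]. split; [apply pow2_sqrt; lra|].
      unfold w, rho, arc_weight, radius_weight. rewrite clamp_id by lra. now split. }
    assert (E1 : d1 (fun s t => (g22 X s t * d1 (fun s t => phi s * trig p t) s t -
        g12 X s t * d2 (fun s t => phi s * trig p t) s t) / area_density X s t) s t
      = - (w s * (mu * rho s - freq p ^ 2) * phi s) * trig p t).
    { unfold d1 at 1.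
      rewrite (Derive_ext_loc _ (fun z => psi z * trig p t)).
      - rewrite Derive_scal_l. f_equal. now apply is_derive_unique, dpsi.
      - apply (filter_imp (fun z => a < z < b)); [|now apply locally_open_interval].
        intros z hz. rewrite ar, eg22, eg12 by exact hz. unfold d1. rewrite Derive_scal_l.
        rewrite (is_derive_unique phi z _ (dphi z hz)).
        destruct (hp z hz) as [h1 [h2 [_ [h4 _]]]]. rewrite h4. field. lra. }
    assert (E2 : d2 (fun s t => (g11 X s t * d2 (fun s t => phi s * trig p t) s t -
        g12 X s t * d1 (fun s t => phi s * trig p t) s t) / area_density X s t) s t
      = - (w s * freq p ^ 2 * phi s * trig p t)).
    { unfold d2 at 1.
      destruct (hp s hs) as [h1 [h2 [h3 [h4 _]]]].
      rewrite (Derive_ext _ (fun z => w s * phi s * dtrig p z)).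
      - rewrite Derive_scal. rewrite (is_derive_unique (dtrig p) t _ (is_derive_dtrig p t)). ring.
      - intros z. rewrite ar, eg11, eg12 by exact hs. unfold d2. rewrite Derive_scal.
        rewrite (is_derive_unique (trig p) z _ (is_derive_trig p z)).
        rewrite <- h3, h4. field. lra. }
    rewrite E1, E2, ar by exact hs.
    destruct (hp s hs) as [h1 [h2 [h3 [h4 h5]]]]. rewrite h4, h5. field. lra.
Qed.

(** More modes than the dimension would be linearly dependent on the surface;
    integrating the relation against each [trig q] kills its coefficients. *)
Lemma surface_multiplicity (a b : R) (X : R -> R -> R3) (F G : R -> R) (mu : R)
  (Th : R -> R -> R -> R) (d : nat) (ps : list (nat + nat)) :
  a < b -> rotational_metric a b X F G ->
  phase_family a (arc_weight a b F G) (radius_weight a b F) Th ->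
  has_dimension (fun s t => a <= s <= b) (surface_eigenspace a b X mu) d ->
  NoDup ps -> (forall p, In p ps -> sin (Th (freq p ^ 2) mu b) = 0) ->
  (length ps <= d)%nat.
Proof.
  intros ab hm fT [e [_ [_ hspan]]] nps hps.
  destruct (Nat.le_gt_cases (length ps) d) as [|hlt]; [assumption|exfalso].
  assert (cw := fun s => arc_weight_continuous a b X F G s (Rlt_le _ _ ab) hm).
  assert (cr := fun s => radius_weight_continuous a b F s (proj1 hm)).
  assert (pw := fun s => arc_weight_pos a b X F G s (Rlt_le _ _ ab) hm).
  assert (H : forall p, exists phi : R -> R, In p ps ->
     surface_eigenspace a b X mu (fun s t => phi s * trig p t) /\ exists s, a <= s <= b /\ phi s <> 0).
  { intros p. destruct (classic (In p ps)) as [hp|hp]; [|exists (fun _ => 0); intros; contradiction].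
    destruct (phase_solution a b (arc_weight a b F G) (fun t => mu * radius_weight a b F t - freq p ^ 2)
      (Th (freq p ^ 2) mu)) as [phi [psi [cphi [cpsi [dphi [dpsi [hz hn]]]]]]]; [apply fT|exact cw| |].
    { intros t. apply mode_coefficient_continuous, cr. }
    exists phi. intros _. split.
    - apply (mode_eigenfunction a b X F G phi psi); try assumption.
      + apply hz. destruct (fT (freq p ^ 2) mu b) as [_ [e0 _]]. rewrite e0. apply sin_0.
      + apply hz. now apply hps.
    - destruct (classic (exists s, a <= s <= b /\ phi s <> 0)) as [|hno]; [assumption|exfalso].
      assert (z0 : forall s, a < s < b -> phi s = 0).
      { intros s hs. destruct (Req_dec (phi s) 0) as [|hne]; [assumption|].
        exfalso. apply hno. exists s. split; [lra|exact hne]. }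
      set (m := (a + b) / 2). assert (hm' : a < m < b) by (unfold m; lra).
      pose proof (is_derive_unique _ _ _ (dphi m hm')) as D.
      rewrite (Derive_ext_loc phi (fun _ => 0)), Derive_const in D.
      + symmetry in D. apply Rmult_integral in D. specialize (pw m).
        destruct D as [D|D]; [lra|]. specialize (hn m). rewrite D, z0 in hn by exact hm'. lra.
      + apply (filter_imp (fun z => a < z < b)); [exact z0|now apply locally_open_interval]. }
  destruct (choice_function _ H) as [phi hphi]. clear H.
  assert (HC : forall p, exists c : nat -> R, In p ps -> forall s t, a <= s <= b ->
     phi p s * trig p t = sum_n_m (fun i => c i * e i s t) 1 d).
  { intros p. destruct (classic (In p ps)) as [hp|hp]; [|exists (fun _ => 0); intros; contradiction].
    destruct (hspan _ (proj1 (hphi p hp))) as [c hc]. exists c. intros _ s t hs. now apply hc. }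
  destruct (choice_function _ HC) as [C hC]. clear HC.
  destruct (homogeneous_system (seq 1 d) ps (fun i p => C p i) nps) as [al [[q [hq hal]] hs]].
  { rewrite length_seq. exact hlt. }
  apply hal.
  assert (rel : forall s t, a <= s <= b -> lsum (fun p => al p * (phi p s * trig p t)) ps = 0).
  { intros s t hst.
    rewrite (lsum_ext _ (fun p => lsum (fun i => al p * C p i * e i s t) (seq 1 d))).
    - rewrite lsum_swap. apply lsum_zero. intros i hi.
      rewrite (lsum_ext _ (fun p => e i s t * (al p * C p i))) by (intros; ring).
      rewrite lsum_scal, hs by exact hi. ring.
    - intros p hp. rewrite (hC p hp s t hst), lsum_seq, <- lsum_scal. apply lsum_ext. intros; ring. }
  destruct (hphi q hq) as [_ [s [hss hne]]].
  assert (I0 : RInt (fun t => lsum (fun p => al p * phi p s * (trig p t * trig q t)) ps) 0 (2 * PI) = 0).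
  { rewrite (RInt_ext_all _ (fun _ => 0)).
    - rewrite RInt_const_R. ring_R.
    - intros t. rewrite (lsum_ext _ (fun p => trig q t * (al p * (phi p s * trig p t)))) by (intros; ring).
      rewrite lsum_scal, rel by exact hss. ring. }
  assert (ct : forall p t, continuous (fun t => trig p t * trig q t) t).
  { intros p t. apply (continuous_mult_R (trig p) (trig q)); apply continuous_trig. }
  rewrite (proj2 (RInt_lsum (fun p t => al p * phi p s * (trig p t * trig q t)) ps 0 (2 * PI)
    ltac:(intros p _ t; apply (continuous_scal_r (al p * phi p s) (fun t => trig p t * trig q t)); apply ct))) in I0.
  rewrite (lsum_single _ ps q nps hq) in I0.
  - rewrite (RInt_scal_all (al q * phi q s) (fun t => trig q t * trig q t)) in I0 by apply ct.
    pose proof (trig_norm_pos q) as hpos.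
    apply Rmult_integral in I0. destruct I0 as [I0|I0]; [|lra].
    apply Rmult_integral in I0. destruct I0; [assumption|contradiction].
  - intros p hp hpq. rewrite (RInt_scal_all (al p * phi p s) (fun t => trig p t * trig q t)) by apply ct.
    rewrite trig_orthogonal by exact hpq. ring.
Qed.

(** * Conformal length and the comparison of spectra *)

Lemma smooth2_shifted_product (c : R) (f g : R -> R) :
  smooth1 f -> smooth1 g -> smooth2 (fun x y => c + f x * g y).
Proof.
  intros hf hg n x y.
  assert (c0 : continuity_2d_pt (fun x y => c + f x * g y) x y).
  { apply continuous2_continuity_2d.
    apply (continuous2_plus (fun _ _ => c) (fun x y => f x * g y)).
    - apply (continuous2_fst (fun _ => c)), continuous_const.
    - apply (continuous2_mult (fun x _ => f x) (fun _ y => g y)).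
      + apply continuous2_fst, (smooth1_differentiable_at 0 f x hf).
      + apply continuous2_snd, (smooth1_differentiable_at 0 g y hg). }
  destruct n as [|n]; [split; [exact c0|exact I]|].
  assert (df := fun x => smooth1_ex_derive f x hf). assert (dg := fun x => smooth1_ex_derive g x hg).
  split; [exact c0|]. split; [auto_derive; apply df|]. split; [auto_derive; apply dg|]. split.
  - replace (fun u v => Derive (fun z => c + f z * g v) u) with (fun u v => Derive f u * g v).
    + apply ex_diff_n_product; apply smooth1_differentiable_at; [now apply smooth1_Derive|exact hg].
    + apply functional_extensionality. intros u. apply functional_extensionality. intros v.
      rewrite Derive_plus, Derive_const, Derive_scal_l; [ring|apply ex_derive_const|auto_derive; apply df].
  - replace (fun u v => Derive (fun z => c + f u * g z) v) with (fun u v => f u * Derive g v).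
    + apply ex_diff_n_product; apply smooth1_differentiable_at; [exact hf|now apply smooth1_Derive].
    + apply functional_extensionality. intros u. apply functional_extensionality. intros v.
      rewrite Derive_plus, Derive_const, Derive_scal; [ring|apply ex_derive_const|auto_derive; apply dg].
Qed.

Lemma same_angle (t t' : R) :
  cos t = cos t' -> sin t = sin t' -> exists k : Z, t' = t + 2 * PI * IZR k.
Proof.
  intros hc hs.
  assert (H : cos (2 * ((t' - t) / 2)) = 1).
  { replace (2 * ((t' - t) / 2)) with (t' - t) by field.
    rewrite cos_minus, hc, hs. pose proof (sin2_cos2 t') as H. unfold Rsqr in H. lra. }
  rewrite cos_2a_sin in H.
  destruct (sin_eq_0_0 ((t' - t) / 2)) as [k hk]; [nra|].
  exists k. lra.
Qed.

(** If [F'] is minus the speed of the profile, then [G' = 0] and [F] decreases from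
    [R1] to [R2]: the isometry is given by polar coordinates of radius [F s]. *)
Lemma isometric_of_flat_profile (R1 R2 a b : R) (X : R -> R -> R3) (F G : R -> R) (c1 c2 : R) :
  0 < R2 -> a < b -> rotational_metric a b X F G -> F a = R1 -> F b = R2 ->
  (forall s, a <= s <= b -> Derive F s = - sqrt (speed2 F G s)) ->
  isometric_to_annulus a b X c1 c2 R1 R2.
Proof.
  intros hR2 ab [sF [sG [pF [pS [eg11 [eg12 eg22]]]]]] Fa Fb hflat.
  destruct smooth1_cos_sin as [sc ss].
  assert (cF : forall s, continuous F s) by (intros; apply (smooth1_differentiable_at 0 F), sF).
  assert (dF : forall s, is_derive F s (Derive F s)) by (intros; now apply Derive_correct, smooth1_ex_derive).
  assert (decr : forall s s', a <= s -> s < s' -> s' <= b -> F s' < F s).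
  { intros s s' h1 h2 h3. assert (- F s < - F s'); [|lra].
    apply (pos_derive_lt (fun z => - F z) (fun z => - Derive F z)); [exact h2| |].
    - intros x hx. split; [apply (is_derive_opp F), dF|].
      rewrite hflat by lra. assert (0 < sqrt (speed2 F G x)) by (apply sqrt_lt_R0, pS; lra). lra.
    - intros x _. apply (continuous_opp F), cF. }
  assert (bd : forall s, a <= s <= b -> R2 <= F s <= R1).
  { intros s hs. rewrite <- Fa, <- Fb. split.
    - destruct (Req_dec s b) as [->|]; [lra|]. left. apply decr; lra.
    - destruct (Req_dec s a) as [->|]; [lra|]. left. apply decr; lra. }
  exists (fun s t => c1 + F s * cos t), (fun s t => c2 + F s * sin t).
  split; [now apply smooth2_shifted_product|]. split; [now apply smooth2_shifted_product|].
  split; [intros s t _; now rewrite cos_plus_2PI|].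
  split; [intros s t _; now rewrite sin_plus_2PI|].
  split; [|split; [|split]].
  - intros s t hs. unfold closed_annulus. specialize (bd s hs). rewrite dist_euc_polar; lra.
  - intros x y [h1 h2].
    destruct (IVT_gen F a b (dist_euc c1 c2 x y)) as [s [hs es]].
    + intros z. apply continuity_pt_filterlim, cF.
    + rewrite Fa, Fb. rewrite Rmin_right, Rmax_left; lra.
    + rewrite Rmin_left, Rmax_right in hs by lra.
      destruct (polar_angle c1 c2 x y (F s)) as [t [_ [ex ey]]]; [now apply pF|now symmetry|].
      exists s, t. now repeat split.
  - intros s t s' t' hs hs' eP eQ.
    assert (eF : F s = F s').
    { rewrite <- (dist_euc_polar c1 c2 (F s) t), <- (dist_euc_polar c1 c2 (F s') t')
        by (pose proof (bd s hs); pose proof (bd s' hs'); lra). now rewrite eP, eQ. }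
    split.
    + destruct (Rtotal_order s s') as [h|[h|h]]; [|exact h|].
      * assert (F s' < F s) by (apply decr; lra). lra.
      * assert (F s < F s') by (apply decr; lra). lra.
    + rewrite <- eF in eP, eQ. assert (0 < F s) by now apply pF.
      apply same_angle; apply (Rmult_eq_reg_l (F s)); lra.
  - intros s t hs.
    assert (e1 : d1 (fun s t => c1 + F s * cos t) s t = Derive F s * cos t).
    { unfold d1. rewrite Derive_plus, Derive_const, Derive_scal_l; [ring|apply ex_derive_const|].
      auto_derive. now apply smooth1_ex_derive. }
    assert (e2 : d1 (fun s t => c2 + F s * sin t) s t = Derive F s * sin t).
    { unfold d1. rewrite Derive_plus, Derive_const, Derive_scal_l; [ring|apply ex_derive_const|].
      auto_derive. now apply smooth1_ex_derive. }
    assert (e3 : d2 (fun s t => c1 + F s * cos t) s t = - (F s * sin t)).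
    { unfold d2. apply is_derive_unique. auto_derive; [exact I|ring]. }
    assert (e4 : d2 (fun s t => c2 + F s * sin t) s t = F s * cos t).
    { unfold d2. apply is_derive_unique. auto_derive; [exact I|ring]. }
    rewrite e1, e2, e3, e4, eg11, eg12, eg22.
    pose proof (sin2_cos2 t) as H. unfold Rsqr in H.
    split; [|split].
    + transitivity (Derive F s ^ 2 * (sin t * sin t + cos t * cos t)); [ring|].
      rewrite H, hflat by exact hs.
      transitivity (sqrt (speed2 F G s) ^ 2); [ring|apply pow2_sqrt; left; now apply pS].
    + ring.
    + transitivity (F s ^ 2 * (sin t * sin t + cos t * cos t)); [ring|rewrite H; ring].
Qed.

Lemma slope_ge_neg_speed (F G : R -> R) (s : R) : - sqrt (speed2 F G s) <= Derive F s.
Proof.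
  assert (H : Rabs (Derive F s) <= sqrt (speed2 F G s)).
  { rewrite <- sqrt_Rsqr_abs. apply sqrt_le_1_alt. unfold speed2, Rsqr.
    pose proof (pow2_ge_0 (Derive G s)). lra. }
  apply Rabs_le_between in H. lra.
Qed.

(** In terms of the conformal length [tau], the profile obeys
    [|(ln F)'| <= 1]; along the flat annulus [ln F] decreases at full speed. *)
Lemma log_radius_lower_bound (a b : R) (X : R -> R -> R3) (F G : R -> R) (s : R) :
  rotational_metric a b X F G -> a <= s <= b ->
  F a * exp (- RInt (arc_weight a b F G) a s) <= F s.
Proof.
  intros hm hs.
  assert (cw := fun s => arc_weight_continuous a b X F G s ltac:(lra) hm).
  destruct hm as [sF [sG [pF [pS _]]]].
  set (tau := fun s => RInt (arc_weight a b F G) a s).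
  assert (dtau : forall s, is_derive tau s (arc_weight a b F G s)) by (intros; now apply is_derive_RInt_all).
  assert (t0 : tau a = 0) by exact (RInt_point a (arc_weight a b F G)).
  assert (dF : forall s, is_derive F s (Derive F s)) by (intros; now apply Derive_correct, smooth1_ex_derive).
  assert (D : forall x, is_derive (fun x => F x * exp (tau x)) x
     (Derive F x * exp (tau x) + F x * (arc_weight a b F G x * exp (tau x)))).
  { intros x. apply (is_derive_mult_R F (fun x => exp (tau x))); [apply dF|].
    apply (is_derive_comp exp tau); [|apply dtau]. apply is_derive_Reals, derivable_pt_lim_exp. }
  assert (H : F a * exp (tau a) <= F s * exp (tau s)).
  { apply (nonneg_derive_le (fun x => F x * exp (tau x))
      (fun x => Derive F x * exp (tau x) + F x * (arc_weight a b F G x * exp (tau x))) a s (proj1 hs)).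
    - intros x hx. split; [apply D|].
      pose proof (exp_pos (tau x)) as hp. assert (hF : 0 < F x) by (apply pF; lra).
      unfold arc_weight. rewrite clamp_id by lra.
      pose proof (slope_ge_neg_speed F G x) as hd.
      replace (Derive F x * exp (tau x) + F x * (sqrt (speed2 F G x) / F x * exp (tau x)))
        with ((Derive F x + sqrt (speed2 F G x)) * exp (tau x)) by (field; lra).
      apply Rmult_le_pos; lra.
    - intros x _. apply (ex_derive_continuous (fun x => F x * exp (tau x))). eexists. apply D. }
  rewrite t0, exp_0, Rmult_1_r in H. change (RInt (arc_weight a b F G) a s) with (tau s).
  rewrite exp_Ropp. pose proof (exp_pos (tau s)) as hp.
  apply (Rmult_le_reg_r (exp (tau s))); [exact hp|].
  replace (F a * / exp (tau s) * exp (tau s)) with (F a) by (field; lra). exact H.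
Qed.

(** Equality of the conformal lengths forces [(ln F)' = - 1] throughout, so that
    the surface is a flat annulus; otherwise the surface is strictly longer. *)
Lemma conformal_length_gt (R1 R2 a b : R) (X : R -> R -> R3) (F G : R -> R) (c1 c2 : R) :
  0 < R2 < R1 -> a < b -> rotational_metric a b X F G -> F a = R1 -> F b = R2 ->
  ~ isometric_to_annulus a b X c1 c2 R1 R2 ->
  ln (R1 / R2) < RInt (arc_weight a b F G) a b.
Proof.
  intros hR ab hm Fa Fb hiso.
  assert (cw := fun s => arc_weight_continuous a b X F G s ltac:(lra) hm).
  assert (low := fun s => log_radius_lower_bound a b X F G s hm).
  set (tau := fun s => RInt (arc_weight a b F G) a s). change (ln (R1 / R2) < tau b).
  destruct (Rlt_dec (ln (R1 / R2)) (tau b)) as [|hn]; [assumption|exfalso]. apply hiso. clear hiso.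
  apply (isometric_of_flat_profile R1 R2 a b X F G c1 c2); try assumption; [lra|].
  destruct hm as [sF [sG [pF [pS _]]]].
  assert (dtau : forall s, is_derive tau s (arc_weight a b F G s)) by (intros; now apply is_derive_RInt_all).
  assert (t0 : tau a = 0) by exact (RInt_point a (arc_weight a b F G)).
  assert (dF : forall s, is_derive F s (Derive F s)) by (intros; now apply Derive_correct, smooth1_ex_derive).
  set (g := fun s => ln (F s) + tau s).
  assert (dg : forall s, a <= s <= b -> is_derive g s ((Derive F s + sqrt (speed2 F G s)) / F s)).
  { intros s hs. assert (hF : 0 < F s) by now apply pF.
    replace ((Derive F s + sqrt (speed2 F G s)) / F s) with (Derive F s * / F s + arc_weight a b F G s)
      by (unfold arc_weight; rewrite clamp_id by exact hs; field; lra).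
    apply (is_derive_plus (fun s => ln (F s)) tau); [|apply dtau].
    apply (is_derive_comp ln F); [|apply dF]. now apply is_derive_Reals, derivable_pt_lim_ln. }
  assert (dpos : forall s, a <= s <= b -> 0 <= (Derive F s + sqrt (speed2 F G s)) / F s).
  { intros s hs. assert (hF : 0 < F s) by now apply pF.
    pose proof (slope_ge_neg_speed F G s). apply Rmult_le_pos; [lra|]. left. now apply Rinv_0_lt_compat. }
  assert (mono : forall s s', a <= s -> s <= s' -> s' <= b -> g s <= g s').
  { intros s s' h1 h2 h3.
    apply (nonneg_derive_le g (fun s => (Derive F s + sqrt (speed2 F G s)) / F s)); [exact h2| |].
    - intros x hx. split; [apply dg; lra|apply dpos; lra].
    - intros x hx. apply (ex_derive_continuous g). eexists. apply dg. lra. }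
  assert (ends : g b <= g a).
  { unfold g. rewrite Fa, Fb, t0. unfold Rdiv in hn.
    rewrite ln_mult, ln_Rinv in hn; try lra. apply Rinv_0_lt_compat; lra. }
  assert (inner : forall s, a < s < b -> Derive F s + sqrt (speed2 F G s) = 0).
  { intros s hs.
    assert (D0 : is_derive g s 0).
    { apply (is_derive_ext_loc (fun _ => g a)); [|apply (is_derive_const (g a))].
      apply (filter_imp (fun z => a < z < b)); [|now apply locally_open_interval].
      intros z hz. pose proof (mono a z ltac:(lra) ltac:(lra) ltac:(lra)).
      pose proof (mono z b ltac:(lra) ltac:(lra) ltac:(lra)). change (@eq R (g a) (g z)). lra. }
    pose proof (is_derive_unique _ _ _ D0) as U1.
    pose proof (is_derive_unique _ _ _ (dg s ltac:(lra))) as U2. rewrite U1 in U2.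
    symmetry in U2. apply Rmult_integral in U2. destruct U2 as [U2|U2]; [exact U2|].
    exfalso. revert U2. apply Rinv_neq_0_compat. assert (0 < F s) by (apply pF; lra). lra. }
  assert (cs : forall s, a <= s <= b -> continuous (fun s => Derive F s + sqrt (speed2 F G s)) s).
  { intros s hs. apply (ex_derive_continuous (fun s => Derive F s + sqrt (speed2 F G s))).
    auto_derive. split; [|split; [|split; [|exact I]]].
    - apply (smooth1_ex_derive (Derive F)). now apply smooth1_Derive.
    - now apply speed2_ex_derive.
    - now apply pS. }
  intros s hs.
  assert (E : Derive F s + sqrt (speed2 F G s) = 0); [|lra].
  destruct (Req_dec s a) as [->|na].
  - apply (continuous_zero_left_end (fun s => Derive F s + sqrt (speed2 F G s)) a b); [exact ab|apply cs; lra|exact inner].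
  - destruct (Req_dec s b) as [->|nb].
    + apply (continuous_zero_right_end (fun s => Derive F s + sqrt (speed2 F G s)) a b); [exact ab|apply cs; lra|exact inner].
    + apply inner. lra.
Qed.

Lemma clamped_bounded (a b : R) (f : R -> R) :
  a <= b -> (forall s, continuous f s) -> (forall s, f (clamp a b s) = f s) -> exists M, bounded_by M f.
Proof.
  intros ab cf hf.
  destruct (continuity_ab_maj (fun x => Rabs (f x)) a b ab) as [m [hm _]].
  { intros x _. apply continuity_pt_filterlim, continuous_Rabs_comp, cf. }
  exists (Rabs (f m)). intros s. rewrite <- hf. apply (hm (clamp a b s)). now apply clamp_in.
Qed.

Lemma bounded_by_le (M M' : R) (f : R -> R) : M <= M' -> bounded_by M f -> bounded_by M' f.
Proof. intros h hf t. specialize (hf t). lra. Qed.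

Theorem theorem1p1 (R1 R2 : R) (hR2 : 0 < R2) (hR : R2 < R1)
  (a b : R) (hab : a < b) (X : R -> R -> R3)
  (hX : surface_of_revolution R1 R2 a b X)
  (c1 c2 : R)
  (hiso : ~ isometric_to_annulus a b X c1 c2 R1 R2)
  (lamS lamA : nat -> R)
  (hS : dirichlet_eigenvalues_surface a b X lamS)
  (hA : dirichlet_eigenvalues_annulus c1 c2 R1 R2 lamA) :
  forall j : nat, (1 <= j)%nat -> lamS j < lamA j.
Proof.
  intros j hj.
  destruct (surface_metric R1 R2 a b X hX) as [F [G [hm [Fa Fb]]]].
  set (T := ln (R1 / R2)).
  assert (hT : 0 < T) by (apply ln_ratio_pos; lra).
  set (w := arc_weight a b F G). set (rho := radius_weight a b F).
  assert (cw : forall s, continuous w s) by (intros; apply (arc_weight_continuous a b X); [lra|exact hm]).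
  assert (cr : forall s, continuous rho s) by (intros; apply radius_weight_continuous, hm).
  assert (pw : forall s, 0 < w s) by (intros; apply (arc_weight_pos a b X); [lra|exact hm]).
  assert (idem : forall s, clamp a b (clamp a b s) = clamp a b s) by (intros; apply clamp_id, clamp_in; lra).
  destruct (clamped_bounded a b w ltac:(lra) cw) as [Mw bw].
  { intros s. unfold w, arc_weight. now rewrite idem. }
  destruct (clamped_bounded a b rho ltac:(lra) cr) as [Mr br].
  { intros s. unfold rho, radius_weight. now rewrite idem. }
  apply (bounded_by_le Mw (Rmax Mw Mr) w (Rmax_l _ _)) in bw.
  apply (bounded_by_le Mr (Rmax Mw Mr) rho (Rmax_r _ _)) in br.
  set (tau := fun s => RInt w a s).
  assert (dtau : forall s, is_derive tau s (w s)) by (intros; now apply is_derive_RInt_all).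
  assert (ctau : forall s, continuous tau s).
  { intros s. apply (ex_derive_continuous tau). eexists. apply dtau. }
  assert (t0 : tau a = 0) by exact (RInt_point a w).
  assert (incr : forall s s', s < s' -> tau s < tau s').
  { intros s s' h. apply (pos_derive_lt tau w); [exact h| |].
    - intros x _. split; [apply dtau|apply pw].
    - intros x _. apply ctau. }
  assert (hlen : T < tau b) by (apply (conformal_length_gt R1 R2 a b X F G c1 c2); try assumption; lra).
  destruct (IVT_gen tau a b T) as [s0 [hs0 es0]].
  { intros z. apply continuity_pt_filterlim, ctau. }
  { rewrite t0, Rmin_left, Rmax_right; lra. }
  rewrite Rmin_left, Rmax_right in hs0 by lra.
  assert (hs0' : a <= s0 < b).
  { split; [lra|]. destruct (Req_dec s0 b) as [e|]; [|lra]. rewrite e in es0. lra. }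
  destruct (phase_family_exists a w rho (Rmax Mw Mr) cw cr bw br) as [ThS fS].
  assert (b1 : bounded_by (R1 ^ 2 + 1) (fun _ => 1)).
  { intros t. rewrite Rabs_R1. pose proof (pow2_ge_0 R1). lra. }
  destruct (phase_family_exists 0 (fun _ => 1) (annulus_weight R1) (R1 ^ 2 + 1)) as [ThA fA].
  { intros; apply continuous_const. }
  { intros; apply annulus_weight_continuous. }
  { exact b1. }
  { apply annulus_weight_bounded. lra. }
  destruct (mode_transfer a b s0 T (Rmax Mw Mr) (R1 ^ 2 + 1) w rho (annulus_weight R1) tau ThS ThA (lamA j))
    as [tr [tr1 tr2]]; try assumption.
  - apply annulus_weight_bounded. lra.
  - pose proof (pow2_ge_0 R1). lra.
  - intros t. apply annulus_weight_pos. lra.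
  - intros s _. apply dtau.
  - intros s hs. rewrite <- t0, <- es0. split; apply incr; lra.
  - intros s hs. rewrite annulus_weight_inside by (rewrite <- t0; left; apply incr; lra).
    unfold rho, radius_weight. rewrite clamp_id by lra.
    apply pow_incr. split; [left; apply Rmult_lt_0_compat; [lra|apply exp_pos]|].
    unfold rad. rewrite <- Fa. apply (log_radius_lower_bound a b X F G s hm). lra.
  - destruct hS as [mS hS], hA as [mA hA].
    apply (counting_comparison (inl O : nat + nat) lamS lamA
      (fun p nu => sin (ThS (freq p ^ 2) nu b) = 0) (fun p nu => sin (ThA (freq p ^ 2) nu T) = 0)
      (fun p nu => tr (freq p ^ 2) nu) j); try assumption.
    + intros nu. destruct (hA nu) as [js [n1 [hjs hd]]].
      destruct (annulus_multiplicity c1 c2 R1 R2 nu ThA (length js) (conj hR2 hR) fA hd) as [ps [n2 [hl hp]]].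
      exists js, ps. now repeat split; try apply hjs.
    + intros nu. destruct (hS nu) as [js [n1 [hjs hd]]].
      exists js. split; [exact hjs|]. split; [exact n1|]. intros ps n2 hp.
      now apply (surface_multiplicity a b X F G nu ThS (length js) ps).
    + intros p nu hnu hs. apply tr1; [apply pow2_ge_0|exact hnu|exact hs].
    + intros p nu1 nu2 h1 h2 s1 s2. apply tr2; try assumption. apply pow2_ge_0.
Qed.
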